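(* Let $n\ge1$, $q\in(0,1)$, $a=(a_1,\dots,a_n)\in\mathbb{R}_{>0}^n$. Let $(\mathbf Z(t),t\ge 0)$ be a Markov process with state space $\mathbb{K}_0^{2n}$ and initial distribution $M^n_{a,q}(\cdot;z)$, for some $z\in\mathcal W_0^n$, that evolves according to the $q$-deformed Berele dynamics. Then $(Z^{2n}(t),t\ge0)$ is a Markov process on $\mathcal W_0^n$, started at $z$, with transition rates $\{Q^q_n(z,z'):z,z'\in\mathcal W_0^n\}$ given for $z'\ne z$ by $$Q_n^q(z,z')=\frac{\mathcal P^{(n)}_{z'}(a;q)}{\mathcal P^{(n)}_z(a;q)}\,f_n(z,z'),$$ where $$f_n(z,z')=\begin{cases}1-q^{z_{i-1}-z_i}&\text{if }z'-z=e_i,\ 1\le i\le n,\\ 1-q^{z_i-z_{i+1}}&\text{if }z'-z=-e_i,\ 1\le i\le n,\\ 0&\text{otherwise},\end{cases}$$ with the conventions $z_0=+\infty$, $z_{n+1}=0$, and with diagonal entries $Q_n^q(z,z)=-\sum_{i=1}^n(a_i+a_i^{-1})$. Moreover, for each $t>0$ the conditional law of $\mathbf Z(t)$ given $\{Z^{2n}(s),s\le t\}$ is $M^n_{a,q}(\cdot;Z^{2n}(t))$.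
   Context: **Patterns.** $\mathcal{W}_0^n=\{z\in\mathbb{Z}^n: z_1\ge\dots\ge z_n\ge 0\}$. $\mathbb{K}_0^{2n}$ is the set of symplectic Gelfand–Tsetlin patterns $\mathbf z=(z^1,\dots,z^{2n})$ with $z^{2l-1},z^{2l}\in\mathbb{Z}_{\ge0}^l$ for $1\le l\le n$, satisfying $z^{2l}_{i+1}\le z^{2l-1}_i\le z^{2l}_i$ for $1\le i\le l$ (with $z^{2l}_{l+1}:=0$) and $z^{2l+1}_{i+1}\le z^{2l}_i\le z^{2l+1}_i$ for $1\le i\le l$. $|z|=\sum_iz_i$, $|z^0|=0$; $\mathbb{K}_0^{2n}[z]=\{\mathbf z\in\mathbb{K}_0^{2n}: z^{2n}=z\}$; $e_i$ are standard basis vectors. **Weights.** $(x;q)_m=\prod_{k=0}^{m-1}(1-xq^k)$, $\binom{m}{k}_q=\frac{(q;q)_m}{(q;q)_k(q;q)_{m-k}}$. For $\mathbf z\in\mathbb K_0^{2n}$, $w^{2n}_{a,q}(\mathbf z)=\prod_{k=1}^n\Lambda^{a_k,q}_{k-1,k}(z^{2k-2},z^{2k-1},z^{2k})$ with $$\Lambda^{a_k,q}_{k-1,k}=a_k^{2|z^{2k-1}|-|z^{2k-2}|-|z^{2k}|}\prod_{i=1}^{k-1}\binom{z^{2k-1}_i-z^{2k-1}_{i+1}}{z^{2k-1}_i-z^{2k-2}_i}_q\binom{z^{2k}_i-z^{2k}_{i+1}}{z^{2k}_i-z^{2k-1}_i}_q\binom{z^{2k}_k}{z^{2k}_k-z^{2k-1}_k}_q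 .$$ $\mathcal P_z^{(n)}(a;q)=\sum_{\mathbf z\in\mathbb K_0^{2n}[z]}w^{2n}_{a,q}(\mathbf z)$ and $M^n_{a,q}(\mathbf z;z)=w^{2n}_{a,q}(\mathbf z)/\mathcal P_z^{(n)}(a;q)$ for $\mathbf z\in\mathbb K_0^{2n}[z]$. **Probabilities.** For $(x,y)\in\mathbb R^n\times\mathbb R^n$ or $\mathbb R^{n-1}\times\mathbb R^n$, $$r_i(y;x)=q^{y_i-x_i}\frac{1-q^{x_{i-1}-y_i}}{1-q^{x_{i-1}-x_i}},\qquad l_i(y;x)=q^{x_i-y_{i+1}}\frac{1-q^{y_{i+1}-x_{i+1}}}{1-q^{x_i-x_{i+1}}},$$ with the conventions that the $0$-th coordinate of a vector is $+\infty$ and the coordinate one past the last is $0$ (so $q^{\infty}=0$). **$q$-deformed Berele dynamics.** $Z^k_i$ is the $i$-th particle of level $k$, $1\le i\le[\frac{k+1}2]$, $1\le k\le 2n$. Only the right-edge particles $Z^k_1$ attempt jumps of their own volition, one step to the right, with independent exponential clocks: $Z^{2l-1}_1$ at rate $a_l$ and $Z^{2l}_1$ at rate $a_l^{-1}$. Every attempted move propagates instantaneously to the bottom level; all probabilities are evaluated at the configuration just before the jump time and the random choices are independent. Rightward attempt by $Z^k_i$, $k<2n$ (own volition or triggered from above): (i) if $k$ is odd and $i=\frac{k+1}2$ (including $k=1$), then with probability $r_i(Z^{k+1};Z^k)$ the jump is performed and triggers a rightward attempt of $Z^{k+1}_i$, and with probability $1-r_i(Z^{k+1};Z^k)$ the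 jump is suppressed and $Z^{k+1}_i$ performs a left jump instead; (ii) for all other particles the jump is performed, and it triggers a rightward attempt of $Z^{k+1}_i$ with probability $r_i(Z^{k+1};Z^k)$ or of $Z^{k+1}_{i+1}$ with probability $1-r_i(Z^{k+1};Z^k)$. At level $2n$ a rightward attempt is simply performed. Left jump of $Z^k_i$, $k<2n$: it triggers the left jump of exactly one particle of level $k+1$: $Z^{k+1}_{i+1}$ with probability $l_i(Z^{k+1};Z^k)$ and $Z^{k+1}_i$ with probability $1-l_i(Z^{k+1};Z^k)$. At level $2n$ the procedure ends. *)

(* Defs.v *)
From HB Require Import structures.
From mathcomp Require Import all_boot all_order all_algebra.
From mathcomp Require Import all_classical all_reals all_analysis.
From mathcomp Require Import zify.
Set Implicit Arguments.
Unset Strict Implicit.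
Unset Printing Implicit Defensive.
Import Order.TTheory GRing.Theory Num.Theory.
Import numFieldNormedType.Exports.
Local Open Scope classical_set_scope.
Local Open Scope ring_scope.

(* Integer vectors; coordinates and standard basis vectors are numbered from 1. *)

Notation ivec n := {ffun 'I_n -> int}.

Definition ent n (v : ivec n) (i : nat) : int :=
  if i is j.+1 then (if insub j is Some o then v o else 0) else 0.

(* The 0-th coordinate is +oo, the coordinates past the last one are 0. *)
Definition crd n (v : ivec n) (i : nat) : \bar int :=
  if i is 0 then +oo%E else (ent v i)%:E.

Definition evec n (i : nat) : ivec n := [ffun j : 'I_n => (j.+1 == i)%:R].

Definition wt n (v : ivec n) : int := \sum_(i < n) v i.

Definition in_chamber n (z : ivec n) : Prop :=
  (forall i, (1 <= i < n)%N -> ent z i.+1 <= ent z i) /\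
  (forall i, (1 <= i <= n)%N -> 0 <= ent z i).

Record chamber n := Chamber {
  chamber_val :> ivec n;
  _ : `[< in_chamber chamber_val >] }.

HB.instance Definition _ n := [isSub for @chamber_val n].
HB.instance Definition _ n := [Countable of chamber n by <:].

(* An array of 2n levels, each stored as a vector of length n; in a pattern,
   level k has (k.+1)./2 particles and the remaining entries are 0. *)
Notation iarray n := {ffun 'I_n.*2 -> ivec n}.

Definition lvl n (z : iarray n) (k : nat) : ivec n :=
  if k is j.+1 then (if insub j is Some o then z o else 0) else 0.

Definition earray n (k i : nat) : iarray n :=
  [ffun j : 'I_n.*2 => if j.+1 == k then evec n i else 0].

Record is_pattern n (z : iarray n) : Prop := IsPattern {
  pattern_pad : forall k i,
    (1 <= k <= n.*2)%N -> ((k.+1)./2 < i)%N -> ent (lvl z k) i = 0;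
  pattern_ge0 : forall k i,
    (1 <= k <= n.*2)%N -> (1 <= i <= (k.+1)./2)%N -> 0 <= ent (lvl z k) i;
  pattern_even : forall l i, (1 <= l <= n)%N -> (1 <= i <= l)%N ->
    ent (lvl z l.*2) i.+1 <= ent (lvl z l.*2.-1) i <= ent (lvl z l.*2) i;
  pattern_odd : forall l i, (1 <= l < n)%N -> (1 <= i <= l)%N ->
    ent (lvl z l.*2.+1) i.+1 <= ent (lvl z l.*2) i <= ent (lvl z l.*2.+1) i }.

Record pattern n := Pattern {
  pattern_val :> iarray n;
  _ : `[< is_pattern pattern_val >] }.

HB.instance Definition _ n := [isSub for @pattern_val n].
HB.instance Definition _ n := [Countable of pattern n by <:].

Lemma bottom_in_chamber n (z : pattern n) : `[< in_chamber (lvl z n.*2) >].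
Proof.
case: z => z /= /asboolP[_ z_ge0 z_even _]; apply/asboolP; split=> i hi.
- have hn : (1 <= n <= n)%N by lia.
  have hi' : (1 <= i <= n)%N by lia.
  by have /andP[h1 h2] := z_even n i hn hi'; exact: le_trans h1 h2.
- by apply: z_ge0; lia.
Qed.

Definition bottom_row n (z : pattern n) : chamber n := Chamber (bottom_in_chamber z).

Section Weights.
Variables (R : realType) (n : nat) (q : R) (a : 'I_n -> R).

Definition qpoch (x : R) (m : nat) : R := \prod_(k < m) (1 - x * q ^+ k).

Definition qbinom (m k : nat) : R :=
  qpoch q m / (qpoch q k * qpoch q (m - k)).

(* In a pattern both differences below are nonnegative. *)
Definition qbin (m k : int) : R := qbinom `|m| `|k|.

Definition Lambda (c : R) (k : nat) (x y z : ivec n) : R :=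
  c ^ (2 * wt y - wt x - wt z) *
  (\prod_(1 <= i < k)
     (qbin (ent y i - ent y i.+1) (ent y i - ent x i) *
      qbin (ent z i - ent z i.+1) (ent z i - ent y i))) *
  qbin (ent z k) (ent z k - ent y k).

Definition weight (z : pattern n) : R :=
  \prod_(l < n)
    Lambda (a l) l.+1 (lvl z l.*2) (lvl z l.*2.+1) (lvl z l.*2.+2).

(* The set of patterns with given bottom level is finite. *)
Definition calP (z : chamber n) : R :=
  \sum_(y \in [set y | bottom_row y = z]) weight y.

Definition Mlaw (z : chamber n) (y : pattern n) : R :=
  if bottom_row y == z then weight y / calP z else 0.

(* The value at -oo is irrelevant. *)
Definition qpow (e : \bar int) : R := if e is k%:E then q ^ k else 0.

(* 0/0 = 0 here; a vanishing denominator only occurs for moves that are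
   triggered with probability 0. *)
Definition rprob (y x : ivec n) (i : nat) : R :=
  qpow (crd y i - crd x i)%E *
  (1 - qpow (crd x i.-1 - crd y i)%E) / (1 - qpow (crd x i.-1 - crd x i)%E).

Definition lprob (y x : ivec n) (i : nat) : R :=
  qpow (crd x i - crd y i.+1)%E *
  (1 - qpow (crd y i.+1 - crd x i.+1)%E) / (1 - qpow (crd x i - crd x i.+1)%E).

Definition dirac_mass (c c' : iarray n) : R := (c == c')%:R.

Definition mix (p : R) (f g : iarray n -> R) (c : iarray n) : R :=
  p * f c + (1 - p) * g c.

(* Probability mass function of the final configuration after a left jump of
   particle (k, i), where [z] is the configuration just before the jump time,
   [c] the configuration updated so far, and m = 2n - k is the number of levels
   still to be visited below level k. *)
Fixpoint leftward (z : iarray n) (m k i : nat) (c : iarray n) : iarray n -> R :=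
  if m is m'.+1 then
    mix (lprob (lvl z k.+1) (lvl z k) i)
      (leftward z m' k.+1 i.+1 (c - earray n k i))
      (leftward z m' k.+1 i (c - earray n k i))
  else dirac_mass (c - earray n k i).

(* The same after a rightward attempt of particle (k, i). *)
Fixpoint rightward (z : iarray n) (m k i : nat) (c : iarray n) : iarray n -> R :=
  if m is m'.+1 then
    let r := rprob (lvl z k.+1) (lvl z k) i in
    if odd k && (i == (k.+1)./2) then
      mix r
        (rightward z m' k.+1 i (c + earray n k i))
        (leftward z m' k.+1 i c)
    else
      mix r
        (rightward z m' k.+1 i (c + earray n k i))
        (rightward z m' k.+1 i.+1 (c + earray n k i))
  else dirac_mass (c + earray n k i).

(* Law of the configuration when the clock of the first particle of level k
   rings in configuration [z]. *)
Definition attempt (k : nat) (z z' : pattern n) : R :=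
  rightward z (n.*2 - k) k 1 z z'.

Definition berele_rate (z z' : pattern n) : R :=
  \sum_(l < n) (a l * (attempt l.*2.+1 z z' - (z == z')%:R) +
                (a l)^-1 * (attempt l.*2.+2 z z' - (z == z')%:R)).

Definition frate (z z' : chamber n) : R :=
  if [pick i : 'I_n | (z' : ivec n) - (z : ivec n) == evec n i.+1] is Some i
  then 1 - qpow (crd z i - crd z i.+1)%E
  else if [pick i : 'I_n | (z' : ivec n) - (z : ivec n) == - evec n i.+1] is Some i
  then 1 - qpow (crd z i.+1 - crd z i.+2)%E
  else 0.

Definition Qrate (z z' : chamber n) : R :=
  if z' == z then - \sum_(i < n) (a i + (a i)^-1)
  else calP z' / calP z * frate z z'.

End Weights.

Section MarkovProcesses.
Variables (R : realType) (S : choiceType).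

Record transition_function (p : R -> S -> S -> R) : Prop := TransitionFunction {
  tf_ge0 : forall t x y, 0 <= t -> 0 <= p t x y;
  tf_mass1 : forall t x, 0 <= t ->
    (\esum_(y in [set: S]) (p t x y)%:E = 1)%E;
  tf_id : forall x y, p 0 x y = (x == y)%:R;
  tf_chapman_kolmogorov : forall s t x y, 0 <= s -> 0 <= t ->
    ((p (s + t) x y)%:E = \esum_(u in [set: S]) (p s x u * p t u y)%:E)%E }.

(* For a bounded conservative Q there is exactly one such transition function. *)
Definition has_rates (p : R -> S -> S -> R) (Q : S -> S -> R) : Prop :=
  forall x y, (p h x y - (x == y)%:R) / h @[h --> 0^'+] --> Q x y.

Variables (d : measure_display) (Omega : measurableType d).
Variable (P : probability Omega R).

Definition past (X : R -> Omega -> S) (t : R) : set (set Omega) :=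
  <<s [set A | exists s x, [/\ 0 <= s, s <= t & A = X s @^-1` [set x]]] >>.

(* K is a version of the conditional law of Y given the sigma-algebra G;
   S is countable in all uses, so that singletons suffice. *)
Definition cond_law (G : set (set Omega)) (Y : Omega -> S)
    (K : Omega -> S -> R) : Prop :=
  forall y,
    (forall B : set R, measurable B -> G ((fun w => K w y) @^-1` B)) /\
    (forall A, G A ->
       (P (A `&` Y @^-1` [set y]) = \int[P]_(w in A) (K w y)%:E)%E).

Definition markov_process (X : R -> Omega -> S) (p : R -> S -> S -> R) : Prop :=
  (forall t x, 0 <= t -> measurable (X t @^-1` [set x])) /\
  (forall s t, 0 <= s -> s <= t ->
     cond_law (past X s) (X t) (fun w => p (t - s) (X s w))).

Definition markov_with_rates (X : R -> Omega -> S) (Q : S -> S -> R) : Prop :=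
  exists p, [/\ transition_function p, has_rates p Q & markov_process X p].

End MarkovProcesses.

(* Main.v *)
Require Import Defs.
From HB Require Import structures.
From mathcomp Require Import all_boot all_order all_algebra.
From mathcomp Require Import all_classical all_reals all_analysis.
From mathcomp Require Import measurable_realfun.
From mathcomp Require Import zify ring lra.
Import Order.TTheory GRing.Theory Num.Theory.
Import numFieldNormedType.Exports.
Local Open Scope classical_set_scope.
Local Open Scope ring_scope.
Set Implicit Arguments.
Unset Strict Implicit.
Unset Printing Implicit Defensive.

(** The bottom row is a Markov process by the criterion of Rogers and Pitman.
    For a row z let M z be the law on the patterns with bottom row z, let Q be
    the rates of the pattern and Qhat those claimed for the bottom row. What has
    to be shown is that the generators intertwine:
      sum over v above z of  M z v * Q v u  =  Qhat z z' * M z' u,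
    where z' is the bottom row of u ([generator_intertwining]).

    From generators to processes. For a fixed pattern u with bottom row z', let
    h t z be the probability of being at u at time t when started from M z. By
    the intertwining, h solves the backward equation of the rates Qhat, and so
    does its sum over all patterns with bottom row z'. These rates are bounded,
    so bounded solutions are determined by their initial values
    ([backward_unique]), and h t z is M z' u times that sum
    ([mixed_kernel_lumped]): the intertwining holds for the transition functions
    too. Hence, if at some time the pattern has the law M given the bottom row,
    on an event of the past, then this remains so at later times
    ([propagate]). Conditioning successively on the bottom row at finitely many
    times gives the statement for cylinder events, and a pi-lambda argument for
    the whole past of the bottom row ([past_distributed]). The Markov property of
    the bottom row and the conditional law of the pattern both follow.

    The intertwining of the generators. Fix the pattern u after a jump and the
    bottom row z before it, and sum the weight of the pattern before the jump,
    times the probabilities of the choices made, over all ways in which the jump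
    can have propagated ([fibre_rightward]). This sum is evaluated from the top
    level downwards. The jump rates 1 - q^gap of a row cancel the denominators of
    the probabilities, and the weights of two consecutive levels change by
    explicit factors, so that each level reduces to a polynomial identity in a
    few powers of q ([lace_right], [lace_left]). The flow of right jumps keeps its
    form from each level to the next ([right_flow]). The flow of left jumps does
    not at an odd level, whose last particle has no partner in the level above;
    the deficit is exactly what the suppressed right jumps of that particle
    contribute one level below ([suppression_flow]), so the form is recovered
    from each even level to the next ([row_flow_step]).

    The backward equation also uses that the rates out of a pattern are finitely
    many and sum to 0 ([berele_row]). This holds because a jump that would break
    the interlacing has probability 0 ([leftward_laced], [rightward_laced]). *)

(** * q-factorials and the factor of an interlaced triple *)

Section QFactorials.
Variables (R : realType) (q : R).
Hypotheses (q_gt0 : 0 < q) (q_lt1 : q < 1).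

(** The q-factorial (q;q)_m, indexed by integers so that differences of entries can
    be inserted without truncation. *)
Definition qfact (m : int) : R := if m is Posz k then qpoch q q k else 1.
(** The reciprocal of (q;q)_m, extended by 0 to negative m. With this value the
    recurrence [qfactVS] holds for every integer, and the identities below need no
    case distinction when a move breaks the interlacing. *)
Definition qfactV (m : int) : R := if m is Posz k then (qpoch q q k)^-1 else 0.

Lemma qpochS k : qpoch q q k.+1 = (1 - q ^ (k.+1)%:Z) * qpoch q q k.
Proof. by rewrite /qpoch big_ord_recr /= mulrC -exprS. Qed.

Lemma onem_qpow_gt0 (m : int) : 0 < m -> 0 < 1 - q ^ m.
Proof.
case: m => // -[|k] // _; rewrite subr_gt0 -exprnP exprn_ilt1 //.
exact: ltW.
Qed.

Lemma qpoch_gt0 k : 0 < qpoch q q k.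
Proof.
elim: k => [|k IHk]; first by rewrite /qpoch big_ord0.
by rewrite qpochS mulr_gt0 // onem_qpow_gt0.
Qed.

Lemma qfact_gt0 m : 0 < qfact m.
Proof. by case: m => k //=; exact: qpoch_gt0. Qed.

Lemma qfactV_gt0 m : 0 <= m -> 0 < qfactV m.
Proof. by case: m => k //= _; rewrite invr_gt0 qpoch_gt0. Qed.

Lemma qfactV_neq0 m : (qfactV m != 0) = (0 <= m).
Proof.
case: m => k /=; last by rewrite eqxx.
by rewrite invr_neq0 // gt_eqF // qpoch_gt0.
Qed.

Lemma qfactS m : 0 <= m -> qfact (m + 1) = (1 - q ^ (m + 1)) * qfact m.
Proof. by case: m => // k _; rewrite -PoszD addn1 /= qpochS. Qed.

Lemma qfact_pred m : 0 < m -> qfact m = (1 - q ^ m) * qfact (m - 1).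
Proof. by move=> m0; rewrite -{1 2}(subrK 1 m) qfactS //; lia. Qed.

Lemma qfactVS m : qfactV m = (1 - q ^ (m + 1)) * qfactV (m + 1).
Proof.
case: m => [k|[|k]].
- rewrite -PoszD addn1 /= qpochS invfM mulrA divff ?mul1r //.
  by rewrite gt_eqF // onem_qpow_gt0.
- by rewrite /= expr0z subrr mul0r.
- have -> : Negz k.+1 + 1 = Negz k by lia.
  by rewrite /= mulr0.
Qed.

Lemma qfactV_pred m : qfactV (m - 1) = (1 - q ^ m) * qfactV m.
Proof. by rewrite qfactVS subrK. Qed.

(** The q-binomial coefficient of an entry x0 that lies between the entries y0 and y1
    of the next row. It vanishes unless y1 <= x0 <= y0. *)
Definition lace_factor (y0 x0 y1 : int) : R :=
  qfact (y0 - y1) * qfactV (y0 - x0) * qfactV (x0 - y1).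

Lemma lace_neq0 y0 x0 y1 : lace_factor y0 x0 y1 != 0 -> y1 <= x0 <= y0.
Proof.
rewrite /lace_factor !mulf_eq0 !negb_or !qfactV_neq0 => /andP[/andP[_ h1] h2].
by apply/andP; split; lia.
Qed.

Lemma lace_gt0 y0 x0 y1 : y1 <= x0 <= y0 -> 0 < lace_factor y0 x0 y1.
Proof.
by move=> /andP[h1 h2]; rewrite !mulr_gt0 ?qfact_gt0 // qfactV_gt0 // subr_ge0.
Qed.

Lemma lace_qbin y0 x0 y1 : y1 <= x0 <= y0 ->
  qbin q (y0 - y1) (y0 - x0) = lace_factor y0 x0 y1.
Proof.
move=> h; rewrite /qbin /qbinom /lace_factor.
have -> : y0 - y1 = `|y0 - y1|%N :> int by lia.
have -> : y0 - x0 = `|y0 - x0|%N :> int by lia.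
have -> : x0 - y1 = `|x0 - y1|%N :> int by lia.
rewrite !absz_nat.
have -> : (`|(y0 - y1)%R| - `|(y0 - x0)%R| = `|(x0 - y1)%R|)%N by lia.
by rewrite /= invfM mulrA.
Qed.

Let q_neq0 : q != 0. Proof. by rewrite gt_eqF. Qed.

Let qD (m p : int) : q ^ (m + p) = q ^ m * q ^ p.
Proof. exact: expfzDr. Qed.

(** Here x0, x1 and y0, y1, y2 are entries after a right jump of y1, which has been
    pushed by x1 (first term) or by x0 (second term). Once common factors are removed
    this is q^d * (1 - q^e) + (1 - q^d) = 1 - q^(d + e). *)
Lemma lace_right (y0 x0 y1 x1 y2 : int) : y1 <= y0 -> y2 < y1 ->
  lace_factor y0 x0 (y1 - 1) * lace_factor (y1 - 1) (x1 - 1) y2 *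
    (q ^ (y1 - x1) * (1 - q ^ (x0 - y1 + 1))) +
  lace_factor y0 (x0 - 1) (y1 - 1) * lace_factor (y1 - 1) x1 y2 * (1 - q ^ (y0 - x0 + 1)) =
  (1 - q ^ (y0 - y1 + 1)) * (lace_factor y0 x0 y1 * lace_factor y1 x1 y2).
Proof.
move=> h1 h2; rewrite /lace_factor.
have -> : y0 - (y1 - 1) = (y0 - y1) + 1 by lia.
have -> : y1 - 1 - (x1 - 1) = y1 - x1 by lia.
have -> : x1 - 1 - y2 = (x1 - y2) - 1 by lia.
have -> : x0 - (y1 - 1) = x0 - y1 + 1 by lia.
have -> : y0 - (x0 - 1) = y0 - x0 + 1 by lia.
have -> : x0 - 1 - (y1 - 1) = x0 - y1 by lia.
have -> : y1 - 1 - x1 = (y1 - x1) - 1 by lia.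
have -> : y1 - 1 - y2 = (y1 - y2) - 1 by lia.
rewrite (qfactS (m := y0 - y1)) ?subr_ge0 // (qfact_pred (m := y1 - y2)) ?subr_gt0 //.
rewrite !qfactV_pred (qfactVS (x0 - y1)) (qfactVS (y0 - x0)).
have -> : y1 - y2 = (y1 - x1) + (x1 - y2) by lia.
rewrite [q ^ ((y1 - x1) + _)]qD; ring.
Qed.

(** The first particle has no left neighbour; its own clock takes the place of the
    push by x0. *)
Lemma lace_right1 (y1 x1 y2 : int) : y2 < y1 ->
  lace_factor (y1 - 1) (x1 - 1) y2 * q ^ (y1 - x1) + lace_factor (y1 - 1) x1 y2 =
  lace_factor y1 x1 y2.
Proof.
move=> h; rewrite /lace_factor.
have -> : y1 - 1 - (x1 - 1) = y1 - x1 by lia.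
have -> : x1 - 1 - y2 = (x1 - y2) - 1 by lia.
have -> : y1 - 1 - x1 = (y1 - x1) - 1 by lia.
have -> : y1 - 1 - y2 = (y1 - y2) - 1 by lia.
rewrite (qfact_pred (m := y1 - y2)) ?subr_gt0 // !qfactV_pred.
have -> : y1 - y2 = (y1 - x1) + (x1 - y2) by lia.
rewrite [q ^ ((y1 - x1) + _)]qD; ring.
Qed.

(** The counterpart of [lace_right] for a left jump of y1, pulled by x1 or by x0. *)
Lemma lace_left (y0 x0 y1 x1 y2 : int) : y1 < y0 -> y2 <= y1 ->
  lace_factor y0 x0 (y1 + 1) * lace_factor (y1 + 1) (x1 + 1) y2 * (1 - q ^ (x1 - y2 + 1)) +
  lace_factor y0 (x0 + 1) (y1 + 1) * lace_factor (y1 + 1) x1 y2 *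
    (q ^ (x0 - y1) * (1 - q ^ (y1 - x1 + 1))) =
  (1 - q ^ (y1 - y2 + 1)) * (lace_factor y0 x0 y1 * lace_factor y1 x1 y2).
Proof.
move=> h1 h2; rewrite /lace_factor.
have -> : y0 - (y1 + 1) = (y0 - y1) - 1 by lia.
have -> : y1 + 1 - (x1 + 1) = y1 - x1 by lia.
have -> : x1 + 1 - y2 = (x1 - y2) + 1 by lia.
have -> : x0 - (y1 + 1) = x0 - y1 - 1 by lia.
have -> : y0 - (x0 + 1) = y0 - x0 - 1 by lia.
have -> : x0 + 1 - (y1 + 1) = x0 - y1 by lia.
have -> : y1 + 1 - x1 = (y1 - x1) + 1 by lia.
have -> : y1 + 1 - y2 = (y1 - y2) + 1 by lia.
rewrite (qfactS (m := y1 - y2)) ?subr_ge0 // (qfact_pred (m := y0 - y1)) ?subr_gt0 //.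
rewrite !qfactV_pred (qfactVS (x1 - y2)) (qfactVS (y1 - x1)).
have -> : y0 - y1 = (y0 - x0) + (x0 - y1) by lia.
rewrite [q ^ ((y0 - x0) + _)]qD; ring.
Qed.

Lemma lace_left1 (y1 x1 y2 : int) : y2 <= y1 ->
  lace_factor (y1 + 1) (x1 + 1) y2 * (1 - q ^ (x1 - y2 + 1)) =
  (1 - q ^ (y1 - y2 + 1)) * lace_factor y1 x1 y2.
Proof.
move=> h; rewrite /lace_factor.
have -> : y1 + 1 - (x1 + 1) = y1 - x1 by lia.
have -> : x1 + 1 - y2 = (x1 - y2) + 1 by lia.
have -> : y1 + 1 - y2 = (y1 - y2) + 1 by lia.
rewrite (qfactS (m := y1 - y2)) ?subr_ge0 // (qfactVS (x1 - y2)); ring.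
Qed.

(** For the last particle y1 of an odd level, with z1 the last particle of the next
    level: on the left, the deficit of the left flow into y1, carried on to z1; on the
    right, the contribution to z1 of the suppressed right jumps of y1. *)
Lemma lace_suppress (y0 x0 y1 z0 z1 : int) : y1 < y0 ->
  (1 - q ^ (y0 - y1)) *
  ((1 - q ^ (y1 + 1)) * lace_factor y0 x0 (y1 + 1) * (lace_factor z0 y0 z1 * lace_factor z1 (y1 + 1) 0)) =
  (1 - q ^ (y0 - x0 + 1)) * lace_factor y0 (x0 - 1) y1 *
    ((1 - q ^ (z1 - y1)) * (lace_factor z0 y0 z1 * lace_factor z1 y1 0)).
Proof.
move=> h; rewrite /lace_factor !subr0.
have -> : y0 - (y1 + 1) = (y0 - y1) - 1 by lia.
have -> : x0 - (y1 + 1) = x0 - y1 - 1 by lia.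
have -> : x0 - 1 - y1 = x0 - y1 - 1 by lia.
have -> : y0 - (x0 - 1) = y0 - x0 + 1 by lia.
have -> : z1 - (y1 + 1) = z1 - y1 - 1 by lia.
rewrite (qfact_pred (m := y0 - y1)) ?subr_gt0 //.
rewrite (qfactVS y1) (qfactVS (y0 - x0)) (qfactV_pred (z1 - y1)); ring.
Qed.

Lemma lace_suppress1 (y1 z1 : int) :
  (1 - q ^ (y1 + 1)) * lace_factor z1 (y1 + 1) 0 = (1 - q ^ (z1 - y1)) * lace_factor z1 y1 0.
Proof.
rewrite /lace_factor !subr0.
have -> : z1 - (y1 + 1) = z1 - y1 - 1 by lia.
rewrite (qfactVS y1) (qfactV_pred (z1 - y1)); ring.
Qed.

End QFactorials.

(** * Rows, interlacing, and the weight of two consecutive levels *)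

(* Coordinates have to stay folded under simplification, to be rewritten by the
   lemmas below. *)
Arguments ent : simpl never.
Arguments lvl : simpl never.
Arguments crd : simpl never.

Section Vectors.
Variable n : nat.
Implicit Types x y : ivec n.

Lemma entE x (j : 'I_n) : ent x j.+1 = x j.
Proof. by rewrite /ent valK. Qed.

Lemma ent_out x i : (n < i)%N -> ent x i = 0.
Proof. by case: i => // i h; rewrite /ent insubN // -leqNgt. Qed.

Lemma ent_eq x y : (forall i, (1 <= i <= n)%N -> ent x i = ent y i) -> x = y.
Proof. by move=> h; apply/ffunP => j; rewrite -!entE h //=. Qed.

Lemma entD x y i : ent (x + y) i = ent x i + ent y i.
Proof.
rewrite /ent; case: i => [|i]; first by rewrite addr0.
by case: insubP => [j _ _| _]; rewrite ?ffunE ?addr0.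
Qed.

Lemma entN x i : ent (- x) i = - ent x i.
Proof.
rewrite /ent; case: i => [|i]; first by rewrite oppr0.
by case: insubP => [j _ _| _]; rewrite ?ffunE ?oppr0.
Qed.

Lemma ent0 i : ent (0 : ivec n) i = 0.
Proof. by rewrite /ent; case: i => [|i] //; case: insubP => [j _ _| _]; rewrite ?ffunE. Qed.

Lemma ent_evec i j : (1 <= i <= n)%N -> ent (evec n i) j = (j == i)%:R.
Proof.
move=> hi; rewrite /ent; case: j => [|j]; first by case: eqP => // h; move: hi; rewrite -h.
case: insubP => [j0 _ oj|]; first by rewrite ffunE oj.
by rewrite -leqNgt => hj; case: eqP => // h; lia.
Qed.

Lemma evec_out i : (n < i)%N -> evec n i = 0.
Proof. by move=> h; apply/ffunP => j; rewrite !ffunE; case: eqP => // e; have := ltn_ord j; lia. Qed.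

Lemma wtD x y : wt (x + y) = wt x + wt y.
Proof. by rewrite /wt -big_split; apply: eq_bigr => i _; rewrite ffunE. Qed.

Lemma wtN x : wt (- x) = - wt x.
Proof. by rewrite /wt -sumrN; apply: eq_bigr => i _; rewrite ffunE. Qed.

Lemma wt_evec i : (1 <= i <= n)%N -> wt (evec n i) = 1.
Proof.
move=> hi; have hi' : (i.-1 < n)%N by lia.
rewrite /wt (bigD1 (Ordinal hi')) //= big1 ?addr0 => [|j hj]; rewrite !ffunE /=.
  by rewrite (_ : i.-1.+1 == i) //; apply/eqP; lia.
by case: eqP => // h; case/eqP: hj; apply/val_inj => /=; lia.
Qed.

(** Level k of a pattern has (k.+1)./2 particles. *)
Definition padded (k : nat) x : bool :=
  [forall j : 'I_n, ((k.+1)./2 < j.+1)%N ==> (x j == 0)].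

Lemma paddedP k x :
  reflect (forall i, ((k.+1)./2 < i)%N -> ent x i = 0) (padded k x).
Proof.
apply: (iffP forallP) => [h i hi|h j].
  case: i hi => // i hi; case: (leqP i.+1 n) => [hn|]; last exact: ent_out.
  by have /implyP/(_ hi)/eqP <- := h (Ordinal hn); rewrite -entE.
by apply/implyP => hj; rewrite -entE h.
Qed.

(** Entries past the last particle are 0, so the same inequalities at all positions
    describe the passage to an even and to an odd level, and include nonnegativity. *)
Definition interlaced x y : Prop :=
  forall j, (1 <= j)%N -> ent y j.+1 <= ent x j <= ent y j.

Lemma interlaced_dec_lower x y j : interlaced x y -> (1 <= j)%N ->
  ent y j.+1 <= ent y j.
Proof. by move=> h j1; have /andP[h1 h2] := h j j1; exact: le_trans h1 h2. Qed.

Lemma interlaced_dec_upper x y j : interlaced x y -> (1 <= j)%N ->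
  ent x j.+1 <= ent x j.
Proof.
move=> h j1; have /andP[h1 _] := h j j1.
have /andP[_ h2] := h j.+1 isT; exact: le_trans h2 h1.
Qed.

Definition decreasing (x : ivec n) := forall j, (1 <= j)%N -> ent x j.+1 <= ent x j.

Lemma chamber_decreasing x : in_chamber x -> decreasing x.
Proof.
move=> [h1 h2] j hj; case: (ltnP j n) => hjn; first by apply: h1; rewrite hj.
rewrite (@ent_out x j.+1); last by lia.
by case: (ltnP n j) => [h|h]; [rewrite ent_out|apply: h2; lia].
Qed.

End Vectors.

Section Flows.
Variables (R : realType) (n : nat) (q : R) (a : 'I_n -> R).
Hypotheses (q_gt0 : 0 < q) (q_lt1 : q < 1) (a_gt0 : forall i, 0 < a i).
Implicit Types x y : ivec n.

Let q_neq0 : q != 0. Proof. by rewrite gt_eqF. Qed.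

Definition level_parameter (l : nat) : R := if insub l is Some o then a o else 1.

Lemma level_parameter_gt0 l : 0 < level_parameter l.
Proof. by rewrite /level_parameter; case: insubP. Qed.

Lemma level_parameterE (l : 'I_n) : level_parameter l = a l.
Proof. by rewrite /level_parameter valK. Qed.

(** The clock of the first particle of level k.+1. In the weight of a pattern the same
    number is raised to the increase of the sum of the entries from level k to level
    k.+1, which is why moving one level at the right edge costs one such factor. *)
Definition clock_speed (k : nat) : R := if odd k then (level_parameter k./2)^-1 else level_parameter k./2.

(** The value 1 at j = 0 lets [lace_product_split] treat the first particle like the
    others. *)
Definition lace_factor_at x y (j : nat) : R :=
  if j is 0 then 1 else lace_factor q (ent y j) (ent x j) (ent y j.+1).

Definition lace_product x y : R := \prod_(0 <= j < n.+1) lace_factor_at x y j.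

(** The part of the weight of a pattern that involves levels k and k.+1. It vanishes
    unless the rows interlace and x has no entries past its last particle, so that
    products of such factors can be evaluated at arrays that are not patterns. *)
Definition level_weight (k : nat) x y : R :=
  (padded k x)%:R * clock_speed k ^ (wt y - wt x) * lace_product x y.

(** Moving particle i of y, or particle i or i.-1 of x, affects the factors at i and
    i.-1 only; these are the others. *)
Definition lace_product_away i x y : R :=
  \prod_(0 <= j < n.+1 | (j != i) && (j != i.-1)) lace_factor_at x y j.

Lemma lace_product_split i x y : (1 <= i <= n)%N ->
  lace_product x y = lace_factor_at x y i.-1 * lace_factor_at x y i * lace_product_away i x y.
Proof.
move=> hi; rewrite /lace_product /lace_product_away.
rewrite /lace_product /lace_product_away (big_mkcond (fun j => (j != i) && (j != i.-1))).
rewrite -big_mkcond /= (bigD1_seq i) ?iota_uniq //=; last by rewrite mem_index_iota; lia.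
rewrite -big_filter (bigD1_seq i.-1) ?filter_uniq ?iota_uniq //; last first.
  by rewrite mem_filter mem_index_iota; lia.
by rewrite big_filter_cond mulrA [_ * lace_factor_at _ _ i.-1]mulrC.
Qed.

Lemma lace_product_away_eq i x y x' y' :
  (forall j, j != i -> j != i.-1 -> ent x j = ent x' j) ->
  (forall j, j != i -> ent y j = ent y' j) ->
  lace_product_away i x y = lace_product_away i x' y'.
Proof.
move=> hx hy; apply: eq_bigr => -[|j] // /andP[h1 h2] /=.
by rewrite hx // !hy //; apply: contraNneq h2 => <-.
Qed.

Lemma lace_product_neq0 x y : lace_product x y != 0 -> interlaced x y.
Proof.
move=> h [|j] // _; case: (leqP j.+1 n) => [hj|hj]; last first.
  by rewrite !ent_out //; lia.
apply: (@lace_neq0 R q q_gt0 q_lt1); apply: contraNneq h => h0.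
rewrite (lace_product_split (i := j.+1)) //; first by rewrite /= h0 mulr0 mul0r.
Qed.

Lemma level_weight_neq0 k x y : level_weight k x y != 0 -> padded k x /\ interlaced x y.
Proof.
rewrite /level_weight !mulf_eq0 !negb_or => /andP[/andP[h _] /lace_product_neq0 h'].
by split=> //; case: padded h => //; rewrite eqxx.
Qed.

Lemma level_weight_unpadded k x y : ~~ padded k x -> level_weight k x y = 0.
Proof. by rewrite /level_weight => /negbTE ->; rewrite !mul0r. Qed.

Lemma level_weight_gt0 k x y : padded k x -> interlaced x y -> 0 < level_weight k x y.
Proof.
move=> h hxy; rewrite /level_weight h mul1r mulr_gt0 ?exprz_gt0 //.
  by rewrite /clock_speed; case: odd; rewrite ?invr_gt0 level_parameter_gt0.
apply: prodr_gt0 => -[|j] _ //=; apply: lace_gt0 => //; exact: hxy.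
Qed.

(** The function f_n of the theorem, for right jumps; the rates of a row are these
    numbers times a ratio of values of calP. *)
Definition right_rate x i : R := 1 - qpow q (crd x i.-1 - crd x i)%E.
Definition left_rate x i : R := 1 - qpow q (crd x i - crd x i.+1)%E.

Lemma qpow_crd x y i j : qpow q (crd x i.+1 - crd y j.+1)%E = q ^ (ent x i.+1 - ent y j.+1).
Proof. by []. Qed.

Lemma qpow_eq1 (m : int) : (q ^ m == 1) = (m == 0).
Proof.
apply/idP/eqP => [|->]; last by rewrite expr0z eqxx.
have h (p : int) : 0 < p -> (q ^ p == 1) = false.
  by move=> p0; have := onem_qpow_gt0 q_gt0 q_lt1 p0; rewrite subr_gt0 => /lt_eqF.
move=> hm; case: (ltrgtP m 0) => // m0; last by rewrite h in hm.
by move: hm; rewrite -(opprK m) -invr_expz invr_eq1 h // oppr_gt0.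
Qed.

(** The denominator of the probability is the jump rate of the row. If it vanishes
    then interlacing pins the entry of y and the right side vanishes as well, so the
    convention 0 / 0 = 0 does no harm. *)
Lemma level_weight_rprob k x y i : (1 <= i)%N ->
  level_weight k x y * (right_rate x i * rprob q y x i) =
  level_weight k x y * (q ^ (ent y i - ent x i) * (1 - qpow q (crd x i.-1 - crd y i)%E)).
Proof.
move=> hi; have [->|/level_weight_neq0[_ hxy]] := eqVneq (level_weight k x y) 0; first by rewrite !mul0r.
congr (_ * _); case: i hi => // -[|i] _.
  by rewrite /right_rate /rprob /= !subr0 divr1 mul1r.
rewrite /right_rate /rprob /=.
have [h0|h0] := eqVneq (q ^ (ent x i.+1 - ent x i.+2)) 1.
  have {h0} : ent x i.+1 - ent x i.+2 = 0 by apply/eqP; rewrite -qpow_eq1 h0.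
  have := hxy i.+1 isT; have := hxy i.+2 isT => /andP[h1 h2] /andP[h3 h4] h5.
  have -> : ent x i.+1 - ent y i.+2 = 0 by lia.
  by rewrite h5 expr0z subrr !mul0r mulr0.
by field; rewrite subr_eq0 eq_sym.
Qed.

Lemma level_weight_onem_rprob k x y i : (1 <= i)%N ->
  level_weight k x y * (right_rate x i * (1 - rprob q y x i)) =
  level_weight k x y * (1 - q ^ (ent y i - ent x i)).
Proof.
move=> hi; rewrite mulrBr mulr1 mulrBr level_weight_rprob // -mulrBr.
have [->|/level_weight_neq0[_ hxy]] := eqVneq (level_weight k x y) 0; first by rewrite !mul0r.
congr (_ * _); case: i hi => // -[|i] _.
  by rewrite /right_rate /= !subr0 mulr1.
rewrite /right_rate /=.
rewrite (_ : ent x i.+1 - ent x i.+2 = (ent y i.+2 - ent x i.+2) + (ent x i.+1 - ent y i.+2)); last by lia.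
by rewrite expfzDr //; ring.
Qed.

Lemma level_weight_lprob k x y i : (1 <= i)%N ->
  level_weight k x y * (left_rate x i * lprob q y x i) =
  level_weight k x y * (q ^ (ent x i - ent y i.+1) * (1 - q ^ (ent y i.+1 - ent x i.+1))).
Proof.
move=> hi; have [->|/level_weight_neq0[_ hxy]] := eqVneq (level_weight k x y) 0; first by rewrite !mul0r.
congr (_ * _); case: i hi => // i _.
rewrite /left_rate /lprob !qpow_crd.
have [h0|h0] := eqVneq (q ^ (ent x i.+1 - ent x i.+2)) 1.
  have {h0} : ent x i.+1 - ent x i.+2 = 0 by apply/eqP; rewrite -qpow_eq1 h0.
  have := hxy i.+1 isT; have := hxy i.+2 isT => /andP[h1 h2] /andP[h3 h4] h5.
  have -> : ent y i.+2 - ent x i.+2 = 0 by lia.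
  by rewrite h5 expr0z subrr !mul0r mulr0.
by field; rewrite subr_eq0 eq_sym.
Qed.

Lemma level_weight_onem_lprob k x y i : (1 <= i)%N ->
  level_weight k x y * (left_rate x i * (1 - lprob q y x i)) =
  level_weight k x y * (1 - q ^ (ent x i - ent y i.+1)).
Proof.
move=> hi; rewrite mulrBr mulr1 mulrBr level_weight_lprob // -mulrBr.
have [->|/level_weight_neq0[_ hxy]] := eqVneq (level_weight k x y) 0; first by rewrite !mul0r.
congr (_ * _); case: i hi => // i _.
rewrite /left_rate !qpow_crd.
rewrite (_ : ent x i.+1 - ent x i.+2 = (ent x i.+1 - ent y i.+2) + (ent y i.+2 - ent x i.+2)); last by lia.
by rewrite expfzDr //; ring.
Qed.

End Flows.

(** * Flow identities between consecutive levels *)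

Lemma eqn_succ (j : nat) : ((j == j.+1) = false) * ((j.+1 == j) = false).
Proof. by split; lia. Qed.

Section Moves.
Variable n : nat.
Implicit Types x y : ivec n.

Lemma ent_subE x i j : (1 <= i <= n)%N ->
  ent (x - evec n i) j = if j == i then ent x j - 1 else ent x j.
Proof. by move=> hi; rewrite entD entN ent_evec //; case: eqP; rewrite ?subr0. Qed.

Lemma ent_addE x i j : (1 <= i <= n)%N ->
  ent (x + evec n i) j = if j == i then ent x j + 1 else ent x j.
Proof. by move=> hi; rewrite entD ent_evec //; case: eqP; rewrite ?addr0. Qed.

Lemma padded_sub k x i : padded k x -> (1 <= i <= n)%N -> (i <= (k.+1)./2)%N ->
  padded k (x - evec n i).
Proof.
move=> /paddedP h hi ik; apply/paddedP => j hj; rewrite ent_subE //.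
by rewrite (gtn_eqF (leq_ltn_trans ik hj)) h.
Qed.

Lemma padded_add k x i : padded k x -> (1 <= i <= n)%N -> (i <= (k.+1)./2)%N ->
  padded k (x + evec n i).
Proof.
move=> /paddedP h hi ik; apply/paddedP => j hj; rewrite ent_addE //.
by rewrite (gtn_eqF (leq_ltn_trans ik hj)) h.
Qed.

End Moves.

Section FlowIdentities.
Variables (R : realType) (n : nat) (q : R) (a : 'I_n -> R).
Hypotheses (q_gt0 : 0 < q) (q_lt1 : q < 1) (a_gt0 : forall i, 0 < a i).
Implicit Types x y z : ivec n.

Notation lam := (level_weight q a).
Notation laceprod := (lace_product q).
Notation lacerest := (lace_product_away q).
Notation lace := (lace_factor q).
Notation Rrate := (right_rate q).
Notation Lrate := (left_rate q).
Notation rate := (clock_speed a).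
Notation e := (evec n).

Let q_neq0 : q != 0. Proof. by rewrite gt_eqF. Qed.

Lemma clock_speed_neq0 k : rate k != 0.
Proof.
by rewrite /clock_speed; case: odd; rewrite ?invr_eq0 gt_eqF // level_parameter_gt0.
Qed.

Lemma clock_speedS k : ~~ odd k -> rate k.+1 = (rate k)^-1.
Proof. by move=> hk; rewrite /clock_speed /= hk (negbTE hk) /= uphalf_half (negbTE hk). Qed.

Section TwoLevels.
Variables (k : nat) (x y : ivec n).
Hypotheses (px : padded k x) (py : padded k.+1 y) (xy : interlaced x y).

(** Also true when particle i does not exist in x: then moving it breaks the
    interlacing and both sides are 0. *)
Lemma level_weight_shift i : (1 <= i <= n)%N ->
  lam k (x - e i) (y - e i) =
  rate k ^ (wt y - wt x) * laceprod (x - e i) (y - e i).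
Proof.
move=> hi; rewrite /level_weight.
have -> : wt (y - e i) - wt (x - e i) = wt y - wt x.
  by rewrite !wtD !wtN !wt_evec //; ring.
have [ik|ik] := leqP i (k.+1)./2; first by rewrite padded_sub // mul1r.
have [->|/(lace_product_neq0 q_gt0 q_lt1)/(_ i)] := eqVneq (laceprod (x - e i) (y - e i)) 0.
  by rewrite !mulr0.
rewrite !ent_subE // eqxx (gtn_eqF (ltnSn i)) (paddedP _ _ px i ik).
by rewrite (paddedP _ _ py i.+1); lia.
Qed.

Lemma lace_product_away_sub i j : (1 <= i <= n)%N -> (1 <= j <= n)%N -> (j == i) || (j == i.-1) ->
  lacerest i (x - e j) (y - e i) = lacerest i x y.
Proof.
move=> hi hj ij; apply: lace_product_away_eq => l l1; rewrite ent_subE //.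
  by move=> l2; case: eqP => // h; case/orP: ij => /eqP h'; move: l1 l2; rewrite h h' eqxx.
by rewrite (negbTE l1).
Qed.

Lemma lace_product_away_add i j : (1 <= i <= n)%N -> (1 <= j <= n)%N -> (j == i) || (j == i.-1) ->
  lacerest i (x + e j) (y + e i) = lacerest i x y.
Proof.
move=> hi hj ij; apply: lace_product_away_eq => l l1; rewrite ent_addE //.
  by move=> l2; case: eqP => // h; case/orP: ij => /eqP h'; move: l1 l2; rewrite h h' eqxx.
by rewrite (negbTE l1).
Qed.

(** With x and y the rows after the jump: the flow of right jumps in x, of the form
    jump rate times weight, is passed on to a flow of the same form in y. *)
Lemma right_flow i : (2 <= i <= n)%N -> (i <= (k.+2)./2)%N ->
  ent y i.+1 < ent y i ->
  lam k (x - e i) (y - e i) * (Rrate (x - e i) i * rprob q (y - e i) (x - e i) i) +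
  lam k (x - e i.-1) (y - e i) *
    (Rrate (x - e i.-1) i.-1 * (1 - rprob q (y - e i) (x - e i.-1) i.-1)) =
  Rrate (y - e i) i * lam k x y.
Proof.
move=> hi ik hlt; have hi1 : (1 <= i <= n)%N by lia.
have hi2 : (1 <= i.-1 <= n)%N by lia.
rewrite level_weight_rprob ?level_weight_onem_rprob //; try lia.
rewrite level_weight_shift // [in X in _ + X]/level_weight padded_sub //; last by lia.
rewrite [in RHS]/level_weight px !mul1r.
have -> : wt (y - e i) - wt (x - e i.-1) = wt y - wt x.
  by rewrite !wtD !wtN !wt_evec //; ring.
rewrite !(lace_product_split q_gt0 q_lt1 (i := i)) // !lace_product_away_sub ?eqxx ?orbT //.
case: i hi ik hlt hi1 hi2 => // -[|j] // hi ik hlt hi1 hi2.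
rewrite /lace_factor_at /right_rate /= !ent_subE // !eqxx.
rewrite !eqn_succ.
have := interlaced_dec_lower (j := j.+1) xy isT.
set y0 := ent y j.+1; set y1 := ent y j.+2; set y2 := ent y j.+3.
set x0 := ent x j.+1; set x1 := ent x j.+2 => h01.
have := lace_right q_gt0 q_lt1 x0 x1 h01 hlt.
have -> : y1 - 1 - (x1 - 1) = y1 - x1 by ring.
have -> : x0 - (y1 - 1) = x0 - y1 + 1 by ring.
have -> : y0 - (x0 - 1) = y0 - x0 + 1 by ring.
have -> : y0 - (y1 - 1) = y0 - y1 + 1 by ring.
set W := rate k ^ _; set Rst := lacerest _ _ _ => h.
transitivity (W * Rst * ((1 - q ^ (y0 - y1 + 1)) * (lace y0 x0 y1 * lace y1 x1 y2)));
  last by ring.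
rewrite -h; ring.
Qed.

(** For the first particle the push from the left is replaced by its own clock, whose
    rate compensates the change of the power of the parameter. *)
Lemma right_flow1 : (1 <= n)%N -> ent y 2 < ent y 1 ->
  lam k (x - e 1) (y - e 1) * (Rrate (x - e 1) 1 * rprob q (y - e 1) (x - e 1) 1) +
  rate k * lam k x (y - e 1) =
  Rrate (y - e 1) 1 * lam k x y.
Proof.
move=> hn hlt; have hi1 : (1 <= 1 <= n)%N by lia.
rewrite level_weight_rprob // level_weight_shift // /level_weight px !mul1r.
have -> : wt (y - e 1) - wt x = (wt y - wt x) - 1.
  by rewrite !wtD !wtN !wt_evec //; ring.
rewrite (expfzDr (wt y - wt x) (-1) (clock_speed_neq0 k)) exprN1.
rewrite !(lace_product_split q_gt0 q_lt1 (i := 1)) // !lace_product_away_sub ?eqxx ?orbT //.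
have -> : lacerest 1 x (y - e 1) = lacerest 1 x y.
  by apply: lace_product_away_eq => // l l1; rewrite ent_subE // (negbTE l1).
rewrite /lace_factor_at /right_rate /= !ent_subE // !eqxx /= !subr0.
set y1 := ent y 1; set y2 := ent y 2; set x1 := ent x 1.
have := lace_right1 q_gt0 q_lt1 x1 hlt; rewrite -/y1.
have -> : y1 - 1 - (x1 - 1) = y1 - x1 by ring.
set W := rate k ^ _; set Rst := lacerest _ _ _ => <-.
field; exact: clock_speed_neq0.
Qed.

(** The left flow keeps its form as long as particle i has a partner in x, which fails
    only for the last particle of an odd level. *)
Lemma left_flow i : (2 <= i <= n)%N -> (i <= (k.+1)./2)%N ->
  ent y i < ent y i.-1 ->
  lam k (x + e i) (y + e i) * (Lrate (x + e i) i * (1 - lprob q (y + e i) (x + e i) i)) +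
  lam k (x + e i.-1) (y + e i) *
    (Lrate (x + e i.-1) i.-1 * lprob q (y + e i) (x + e i.-1) i.-1) =
  Lrate (y + e i) i * lam k x y.
Proof.
move=> hi ik hlt; have hi1 : (1 <= i <= n)%N by lia.
have hi2 : (1 <= i.-1 <= n)%N by lia.
rewrite level_weight_onem_lprob ?level_weight_lprob //; try lia.
rewrite /level_weight !padded_add //; try lia.
rewrite px !mul1r.
have -> : wt (y + e i) - wt (x + e i) = wt y - wt x.
  by rewrite !wtD !wt_evec //; ring.
have -> : wt (y + e i) - wt (x + e i.-1) = wt y - wt x.
  by rewrite !wtD !wt_evec //; ring.
rewrite !(lace_product_split q_gt0 q_lt1 (i := i)) // !lace_product_away_add ?eqxx ?orbT //.
case: i hi ik hlt hi1 hi2 => // -[|j] // hi ik hlt hi1 hi2.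
rewrite /lace_factor_at /left_rate /= !ent_addE // !eqxx.
rewrite !eqn_succ.
have := interlaced_dec_lower (j := j.+2) xy isT.
move: hlt; rewrite /=.
set y0 := ent y j.+1; set y1 := ent y j.+2; set y2 := ent y j.+3.
set x0 := ent x j.+1; set x1 := ent x j.+2 => h01 h12.
have := lace_left q_gt0 q_lt1 x0 x1 h01 h12.
have -> : x1 + 1 - y2 = x1 - y2 + 1 by ring.
have -> : x0 + 1 - (y1 + 1) = x0 - y1 by ring.
have -> : y1 + 1 - x1 = y1 - x1 + 1 by ring.
have -> : y1 + 1 - y2 = y1 - y2 + 1 by ring.
set W := rate k ^ _; set Rst := lacerest _ _ _ => h.
transitivity (W * Rst * ((1 - q ^ (y1 - y2 + 1)) * (lace y0 x0 y1 * lace y1 x1 y2)));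
  last by ring.
rewrite -h; ring.
Qed.

Lemma left_flow1 : (1 <= n)%N -> (1 <= k)%N ->
  lam k (x + e 1) (y + e 1) * (Lrate (x + e 1) 1 * (1 - lprob q (y + e 1) (x + e 1) 1)) =
  Lrate (y + e 1) 1 * lam k x y.
Proof.
move=> hn hk; have hi1 : (1 <= 1 <= n)%N by lia.
rewrite level_weight_onem_lprob //; rewrite /level_weight !padded_add //; try lia.
rewrite px !mul1r.
have -> : wt (y + e 1) - wt (x + e 1) = wt y - wt x.
  by rewrite !wtD !wt_evec //; ring.
rewrite !(lace_product_split q_gt0 q_lt1 (i := 1)) // !lace_product_away_add ?eqxx ?orbT //.
rewrite /lace_factor_at /left_rate /= !ent_addE // !eqxx /=.
have := interlaced_dec_lower (j := 1) xy isT.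
set y1 := ent y 1; set y2 := ent y 2; set x1 := ent x 1 => h12.
have := lace_left1 q_gt0 q_lt1 x1 h12.
have -> : x1 + 1 - y2 = x1 - y2 + 1 by ring.
have -> : y1 + 1 - y2 = y1 - y2 + 1 by ring.
set W := rate k ^ _; set Rst := lacerest _ _ _ => h.
transitivity (W * Rst * ((1 - q ^ (y1 - y2 + 1)) * lace y1 x1 y2)); last by ring.
rewrite -h; ring.
Qed.

End TwoLevels.

(** The pull to the right of the last particle of an odd level has probability 0: the
    next level has no particle there. *)
Lemma lprob_last (y z : ivec n) i : (1 <= i <= n)%N ->
  ent y i.+1 = 0 -> ent z i.+1 = 0 -> lprob q (z + e i) (y + e i) i = 0.
Proof.
move=> hi y0 z0; have E : (i.+1 == i) = false by lia.
by rewrite /lprob /= !ent_addE // E y0 z0 expr0z subrr mulr0 mul0r.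
Qed.

(** From the even level k to the next even level. Particle i is the last one of the odd
    level in between. *)
Section ThreeLevels.
Variables (k : nat) (x y z : ivec n).
Hypotheses (px : padded k x) (py : padded k.+1 y) (pz : padded k.+2 z).
Hypotheses (k_even : ~~ odd k) (xy : interlaced x y).

Let i := (k./2).+1.

Let half_k1 : (k.+1)./2 = k./2. Proof. by rewrite /= uphalf_half (negbTE k_even). Qed.
Let half_k2 : (k.+2)./2 = i. Proof. by []. Qed.

Let x_i0 : ent x i = 0.
Proof. by apply: (paddedP _ _ px); rewrite half_k1. Qed.

Let y_i1 : ent y i.+1 = 0.
Proof. by apply: (paddedP _ _ py); rewrite half_k2. Qed.

Let z_i1 : ent z i.+1 = 0.
Proof. by apply: (paddedP _ _ pz); rewrite /= uphalf_half (negbTE k_even). Qed.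

Let lam_z (yy : ivec n) : padded k.+1 yy ->
  lam k.+1 yy (z + e i) = rate k ^ (wt yy - wt (z + e i)) * laceprod yy (z + e i).
Proof.
by move=> h; rewrite /level_weight h mul1r clock_speedS // exprz_inv opprB.
Qed.

Let y_last_ge0 : 0 <= ent y i.
Proof. by have := interlaced_dec_lower (j := i) xy isT; rewrite y_i1. Qed.

(** The bracket on the left is what the left flow into particle i lacks; the right side
    is the contribution of the right jumps that are suppressed at particle i. *)
Lemma suppression_flow : (2 <= i <= n)%N ->
  (Lrate (y + e i) i * lam k x y -
   lam k (x + e i.-1) (y + e i) *
    (Lrate (x + e i.-1) i.-1 * lprob q (y + e i) (x + e i.-1) i.-1)) *
  (lam k.+1 (y + e i) (z + e i) * (1 - lprob q (z + e i) (y + e i) i)) =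
  lam k (x - e i.-1) y *
    (Rrate (x - e i.-1) i.-1 * (1 - rprob q y (x - e i.-1) i.-1)) *
  (lam k.+1 y (z + e i) * (1 - rprob q (z + e i) y i)).
Proof.
move=> hi; have hi1 : (1 <= i <= n)%N by lia.
have hi2 : (1 <= i.-1 <= n)%N by lia.
rewrite lprob_last // subr0 mulr1.
have [hlt|hge] := ltP (ent y i) (ent y i.-1); last first.
  rewrite [lam k.+1 (y + e i) _](_ : _ = 0); last first.
    apply/eqP/negPn/negP => /(level_weight_neq0 q_gt0 q_lt1)[_ h].
    have := interlaced_dec_upper (j := i.-1) h.
    by rewrite !ent_addE // prednK //; rewrite eqxx (_ : (i.-1 == i) = false); lia.
  rewrite [lam k (x - e i.-1) y](_ : _ = 0) ?mulr0 ?mul0r //.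
  apply/eqP/negPn/negP => /(level_weight_neq0 q_gt0 q_lt1)[_ h].
  have := h i.-1; rewrite ent_subE // eqxx prednK //.
  have := xy (j := i.-1); rewrite prednK //; lia.
rewrite level_weight_lprob ?level_weight_onem_rprob //; try lia.
rewrite !lam_z ?padded_add // /level_weight padded_add ?padded_sub // ?half_k1; try lia.
rewrite px !mul1r.
have -> : wt (y + e i) - wt (x + e i.-1) = wt y - wt x.
  by rewrite !wtD !wt_evec //; ring.
have -> : wt y - wt (x - e i.-1) = wt y - wt x + 1.
  by rewrite !wtD wtN !wt_evec //; ring.
have -> : wt (y + e i) - wt (z + e i) = wt y - wt z.
  by rewrite !wtD !wt_evec //; ring.
have -> : wt y - wt (z + e i) = (wt y - wt z) - 1.
  by rewrite !wtD !wt_evec //; ring.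
rewrite (expfzDr (wt y - wt z) (-1) (clock_speed_neq0 k)) exprN1.
rewrite (expfzDr (wt y - wt x) 1 (clock_speed_neq0 k)) expr1z.
rewrite !(lace_product_split q_gt0 q_lt1 (i := i)) // !lace_product_away_add ?eqxx ?orbT //.
have -> : lacerest i (x - e i.-1) y = lacerest i x y.
  by apply: lace_product_away_eq => // l l1 l2; rewrite ent_subE // (negbTE l2).
have -> : lacerest i y (z + e i) = lacerest i y z.
  by apply: lace_product_away_eq => // l l1; rewrite ent_addE // (negbTE l1).
rewrite /rprob; move: x_i0 y_i1 z_i1 y_last_ge0 hi hi1 hi2 hlt.
case: i => // -[|j] // xi0 yi1 zi1 yi0 hi hi1 hi2 hlt.
rewrite /lace_factor_at /left_rate /= !ent_addE // !ent_subE // !eqxx !eqn_succ.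
rewrite xi0 yi1 zi1.
move: hlt yi0; rewrite /=.
set y0 := ent y j.+1; set y1 := ent y j.+2.
set z0 := ent z j.+1; set z1 := ent z j.+2 + 1.
set x0 := ent x j.+1 => h01 yi0.
have hk (m : int) : 0 <= m -> lace m 0 0 = 1.
  move=> m0; rewrite /lace_factor subr0 subrr -mulrA /= /qpoch big_ord0 invr1 mulr1.
  case: m m0 => // m _ /=; rewrite divff // gt_eqF //; exact: qpoch_gt0.
have := lace_left q_gt0 q_lt1 x0 0 h01 yi0.
have := lace_left1 q_gt0 q_lt1 0 yi0.
have y1S : 0 <= y1 + 1 by lia.
rewrite !(hk y1) // !(hk (y1 + 1)) // !subr0 !add0r !mulr1 => h1.
rewrite -[X in X + _ = _]mulrA h1 => h2.
have h3 := lace_suppress q_gt0 q_lt1 x0 z0 z1 h01.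
have D0 : 1 - q ^ (y0 - y1) != 0.
  by rewrite gt_eqF // onem_qpow_gt0 // subr_gt0.
have -> : y0 - (x0 - 1) = y0 - x0 + 1 by ring.
have -> : x0 + 1 - (y1 + 1) = x0 - y1 by ring.
have h4 : 1 - q ^ (z1 - y1) * (1 - q ^ (y0 - z1)) / (1 - q ^ (y0 - y1)) =
    (1 - q ^ (z1 - y1)) / (1 - q ^ (y0 - y1)).
  have : q ^ (y0 - y1) = q ^ (z1 - y1) * q ^ (y0 - z1).
    by rewrite -expfzDr //; congr (q ^ _); ring.
  by move: D0; set d := q ^ (y0 - y1) => D0 dE; field: dE.
rewrite h4.
set W1 := rate k ^ (wt y - wt x); set W2 := rate k ^ (wt y - wt z).
set R1 := lacerest _ x y; set R2 := lacerest _ y z.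
transitivity (W1 * W2 * R1 * R2 * ((1 - q ^ (y1 + 1)) * lace y0 x0 (y1 + 1) *
   (lace z0 y0 z1 * lace z1 (y1 + 1) 0))).
  transitivity (W1 * W2 * R1 * R2 * (((1 - q ^ (y1 + 1)) * lace y0 x0 y1 -
   lace y0 (x0 + 1) (y1 + 1) * (q ^ (x0 - y1) * (1 - q ^ (y1 + 1)))) *
   (lace z0 y0 z1 * lace z1 (y1 + 1) 0))); first by ring.
  by congr (_ * (_ * _)); rewrite -h2; ring.
apply: (mulfI D0); rewrite mulrCA h3.
by field; rewrite D0 clock_speed_neq0.
Qed.

End ThreeLevels.

(** The top of the array, where all left jumps come from the suppressed jumps of the
    single particle of level 1. *)
Lemma suppression_flow1 (y z : ivec n) : (1 <= n)%N -> padded 1 y -> padded 2 z ->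
  Lrate (y + e 1) 1 * lam 0 0 y *
  (lam 1 (y + e 1) (z + e 1) * (1 - lprob q (z + e 1) (y + e 1) 1)) =
  rate 0 * lam 0 0 y * (lam 1 y (z + e 1) * (1 - rprob q (z + e 1) y 1)).
Proof.
move=> hn py pz; have hi : (1 <= 1 <= n)%N by [].
have y2 : ent y 2 = 0 by exact: (paddedP _ _ py).
have z2 : ent z 2 = 0 by exact: (paddedP _ _ pz).
rewrite lprob_last // subr0 mulr1.
rewrite /level_weight !(padded_add (k := 1)) // py !mul1r (clock_speedS (k := 0)) // !exprz_inv.
have -> : - (wt (z + e 1) - wt (y + e 1)) = wt y - wt z.
  by rewrite !wtD !wt_evec //; ring.
have -> : - (wt (z + e 1) - wt y) = wt y - wt z - 1.
  by rewrite !wtD !wt_evec //; ring.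
rewrite (expfzDr (wt y - wt z) (-1) (clock_speed_neq0 0)) exprN1.
rewrite !(lace_product_split q_gt0 q_lt1 (i := 1)) //.
have -> : lacerest 1 y (z + e 1) = lacerest 1 y z.
  by apply: lace_product_away_eq => // l l1; rewrite ent_addE // (negbTE l1).
rewrite !lace_product_away_add //.
rewrite /lace_factor_at /left_rate /rprob /= !ent_addE // !eqxx /=.
rewrite y2 z2 !subr0 divr1 !mulr1.
have := lace_suppress1 q_gt0 q_lt1 (ent y 1) (ent z 1 + 1).
set W1 := rate 0 ^ _; set W2 := rate 0 ^ (wt y - wt z).
set h1 := lace _ _ 0; set h2 := lace _ _ 0; set h3 := lace _ _ _ => h.
transitivity (W2 * ((1 - q ^ (ent y 1 + 1)) * h1) * lacerest 1 y z *
  (padded 0 (0 : ivec n))%:R * W1 * h3 * lacerest 1 0 y); first by ring.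
rewrite h; field; exact: clock_speed_neq0.
Qed.

End FlowIdentities.

(** * Sums over the paths of a jump *)

Section PathSums.
Variables (R : realType) (n : nat) (q : R) (a : 'I_n -> R).
Hypotheses (q_gt0 : 0 < q) (q_lt1 : q < 1) (a_gt0 : forall i, 0 < a i).
Variables (u : iarray n) (z : ivec n).

Notation lam := (level_weight q a).
Notation Rrate := (right_rate q).
Notation Lrate := (left_rate q).
Notation rate := (clock_speed a).
Notation e := (evec n).

(** Let u be the array after the jump and z the bottom row before it. A left jump of
    particle i of level k can propagate through the m levels below in several ways;
    given u, each of them determines the rows before the jump. The sum runs over those
    that lead from z, and the terms are products of the weights of the consecutive
    levels from k on before the jump, of the probabilities of the choices, and of g at
    row k before the jump. *)
Fixpoint left_paths (m k i : nat) (g : ivec n -> R) : R :=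
  let x := lvl u k + e i in
  g x * (if m is m'.+1 then
           left_paths m' k.+1 i.+1 (fun y => lam k x y * lprob q y x i) +
           left_paths m' k.+1 i (fun y => lam k x y * (1 - lprob q y x i))
         else (x == z)%:R).

(** The same for a rightward attempt. A suppressed attempt does not change row k, so g
    has to be evaluated at two different rows and cannot be factored out. *)
Fixpoint right_paths (m k i : nat) (g : ivec n -> R) : R :=
  let x := lvl u k - e i in
  if m is m'.+1 then
    if odd k && (i == (k.+1)./2) then
      g x * right_paths m' k.+1 i (fun y => lam k x y * rprob q y x i) +
      g (lvl u k) * left_paths m' k.+1 i
        (fun y => lam k (lvl u k) y * (1 - rprob q y (lvl u k) i))
    else
      g x * (right_paths m' k.+1 i (fun y => lam k x y * rprob q y x i) +
             right_paths m' k.+1 i.+1 (fun y => lam k x y * (1 - rprob q y x i)))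
  else g x * (x == z)%:R.

Definition left_paths1 m k i := left_paths m k i (fun=> 1).
Definition right_paths1 m k i := right_paths m k i (fun=> 1).

Lemma left_pathsE m k i g : left_paths m k i g = g (lvl u k + e i) * left_paths1 m k i.
Proof. by case: m => [|m] /=; rewrite /left_paths1 /= mul1r. Qed.

Lemma right_paths_even m k i g : ~~ odd k ->
  right_paths m k i g = g (lvl u k - e i) * right_paths1 m k i.
Proof. by move=> /negbTE ko; case: m => [|m]; rewrite /right_paths1 /= ?ko /= mul1r. Qed.

Lemma right_pathsS m k i g : right_paths m.+1 k i g =
  if odd k && (i == (k.+1)./2) then
    g (lvl u k - e i) * right_paths m k.+1 i
      (fun y => lam k (lvl u k - e i) y * rprob q y (lvl u k - e i) i) +
    g (lvl u k) * left_paths m k.+1 i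
      (fun y => lam k (lvl u k) y * (1 - rprob q y (lvl u k) i))
  else
    g (lvl u k - e i) *
      (right_paths m k.+1 i (fun y => lam k (lvl u k - e i) y * rprob q y (lvl u k - e i) i) +
       right_paths m k.+1 i.+1
         (fun y => lam k (lvl u k - e i) y * (1 - rprob q y (lvl u k - e i) i))).
Proof. by []. Qed.

Lemma left_paths1S m k i : left_paths1 m.+1 k i =
  lam k (lvl u k + e i) (lvl u k.+1 + e i.+1) *
    lprob q (lvl u k.+1 + e i.+1) (lvl u k + e i) i * left_paths1 m k.+1 i.+1 +
  lam k (lvl u k + e i) (lvl u k.+1 + e i) *
    (1 - lprob q (lvl u k.+1 + e i) (lvl u k + e i) i) * left_paths1 m k.+1 i.
Proof. by rewrite /left_paths1 [LHS]/= mul1r; congr (_ + _); rewrite left_pathsE. Qed.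

Lemma right_pathsD m k i g h : right_paths m k i (fun y => g y + h y) = right_paths m k i g + right_paths m k i h.
Proof. by case: m => [|m] /=; [ring|case: ifP => _; ring]. Qed.

Lemma right_pathsZ m k i c g : right_paths m k i (fun y => c * g y) = c * right_paths m k i g.
Proof. by case: m => [|m] /=; [ring|case: ifP => _; ring]. Qed.

Lemma right_paths0 m k i g : (forall y, g y = 0) -> right_paths m k i g = 0.
Proof. by move=> h; case: m => [|m] /=; rewrite ?h; [ring|case: ifP => _; ring]. Qed.

Hypothesis z_ch : in_chamber z.

Let lam0 k (x : ivec n) : ~ (padded k x /\ decreasing x) -> forall y, lam k x y = 0.
Proof.
move=> h y; apply/eqP/negPn/negP => /(level_weight_neq0 q_gt0 q_lt1)[h1 h2]; apply: h.
split=> // j; exact: (interlaced_dec_upper h2).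
Qed.

(** The continuation vanishes unless row k before the jump is weakly decreasing: this is
    what the flow identities require. *)
Lemma left_paths1_neq0 m k i : left_paths1 m k i != 0 ->
  decreasing (lvl u k + e i) /\ ((0 < m)%N -> padded k (lvl u k + e i)).
Proof.
case: m => [|m]; rewrite /left_paths1 /= mul1r.
  case: (lvl u k + e i =P z) => [-> _|]; last by rewrite eqxx.
  by split=> //; exact: chamber_decreasing.
move=> h; suff [h1 h2] : padded k (lvl u k + e i) /\ decreasing (lvl u k + e i) by [].
apply: contrapT => /lam0 h0; case/eqP: h.
by rewrite !left_pathsE !h0; ring.
Qed.

Lemma right_paths1_neq0 m k i : ~~ odd k -> right_paths1 m k i != 0 -> decreasing (lvl u k - e i).
Proof.
move=> /negbTE ko; case: m => [|m]; rewrite /right_paths1 /= ?ko /= mul1r.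
  case: (lvl u k - e i =P z) => [-> _|]; last by rewrite eqxx.
  by exact: chamber_decreasing.
move=> h; suff [h1 h2] : padded k (lvl u k - e i) /\ decreasing (lvl u k - e i) by [].
apply: contrapT => /lam0 h0; case/eqP: h.
by rewrite !right_paths0 ?addr0 // => y; rewrite h0 mul0r.
Qed.

Hypothesis u_pad : forall k, (k <= n.*2)%N -> padded k (lvl u k).
Hypothesis u_lace : forall k, (k < n.*2)%N -> interlaced (lvl u k) (lvl u k.+1).

Definition head_weight (v : iarray n) (k : nat) : R := \prod_(0 <= j < k) lam j (lvl v j) (lvl v j.+1).

(** The flow identities propagate the total flow of the jumps in this form, at the even
    level l.*2: jump rate of the row times continuation. *)
Definition row_flow l : R :=
  \sum_(i < l) Rrate (lvl u l.*2 - e i.+1) i.+1 * right_paths1 (n.*2 - l.*2) l.*2 i.+1 +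
  \sum_(i < l) Lrate (lvl u l.*2 + e i.+1) i.+1 * left_paths1 (n.*2 - l.*2) l.*2 i.+1.

Lemma sum_shift l (f h : nat -> R) : f l = 0 ->
  \sum_(i < l) (f i + h i.+1) + h 0%N = \sum_(i < l.+1) (f i + h i).
Proof.
move=> fl; rewrite !big_split /= [X in _ = X + _]big_ord_recr /= fl addr0.
by rewrite big_ord_recl /= -addrA [_ + h 0%N]addrC.
Qed.

(** One step of the induction, from level k = l.*2 over y to w, the rows after the jump.
    The continuations below level k.+2 are cR and cL. The total flow into a rightward
    attempt of particle i.+1 of level k.+1 is G i, as a function of the row of that level
    before the jump; B i continues a performed and S a suppressed jump. For left jumps
    the flow is Nl i + Nr i and the continuation D i. *)
Section Step.
Variable l : nat.
Hypothesis ln : (l < n)%N.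
Let k := l.*2.
Let m := (n.*2 - k.+2)%N.
Let x := lvl u k.
Let y := lvl u k.+1.
Let w := lvl u k.+2.

Let k_even : ~~ odd k. Proof. by rewrite odd_double. Qed.
Let km : (k.+2 <= n.*2)%N. Proof. by rewrite /k; lia. Qed.
Let px : padded k x. Proof. by apply: u_pad; lia. Qed.
Let py : padded k.+1 y. Proof. by apply: u_pad; lia. Qed.
Let pw : padded k.+2 w. Proof. by apply: u_pad; lia. Qed.
Let xy : interlaced x y. Proof. by apply: u_lace; lia. Qed.
Let yw : interlaced y w. Proof. by apply: u_lace; lia. Qed.
Let kh : k./2 = l. Proof. by rewrite /k doubleK. Qed.
Let kh1 : (k.+1)./2 = l. Proof. by rewrite /= uphalf_half (negbTE k_even) kh. Qed.
Let kh2 : (k.+2)./2 = l.+1. Proof. by rewrite /= kh. Qed.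


Let mS : (n.*2 - k)%N = m.+2. Proof. by rewrite /m; lia. Qed.

Lemma sum_shift_last (f h : nat -> R) :
  \sum_(i < l.+1) (f i + (i != l :> nat)%:R * h i.+1) + h 0%N =
  \sum_(i < l.+1) (f i + h i).
Proof.
rewrite !big_split /= -addrA; congr (_ + _).
rewrite big_ord_recr /= eqxx mul0r addr0 [RHS]big_ord_recl /= addrC; congr (_ + _).
by apply: eq_bigr => i _; rewrite (ltn_eqF (ltn_ord i)) mul1r.
Qed.

Let lam_out (v : ivec n) : lam k (x + e l.+1) v = 0.
Proof.
apply: level_weight_unpadded; apply/negP => /paddedP/(_ l.+1).
rewrite ent_addE ?eqxx; last by lia.
rewrite (paddedP _ _ px l.+1) kh1 //; by lia.
Qed.

Let lam_out' (v : ivec n) : lam k (x - e l.+1) v = 0.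
Proof.
apply: level_weight_unpadded; apply/negP => /paddedP/(_ l.+1).
rewrite ent_subE ?eqxx; last by lia.
rewrite (paddedP _ _ px l.+1) kh1 //; by lia.
Qed.

Let cR i := right_paths1 m k.+2 i.
Let cL i := left_paths1 m k.+2 i.

Let Gl (i : nat) (yy : ivec n) : R :=
  Rrate (x - e i.+1) i.+1 * (lam k (x - e i.+1) yy * rprob q yy (x - e i.+1) i.+1).
Let Gr (i : nat) (yy : ivec n) : R :=
  if i is j.+1 then
    Rrate (x - e j.+1) j.+1 * (lam k (x - e j.+1) yy * (1 - rprob q yy (x - e j.+1) j.+1))
  else rate k * lam k x yy.
Let G i yy := Gl i yy + Gr i yy.

(* Regroup the right jumps of x and the clock of level k.+1 by the particle of y that they set
   in motion. *)
Let R1 : \sum_(i < l) Rrate (x - e i.+1) i.+1 * right_paths1 m.+2 k i.+1 +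
    rate k * right_paths m.+1 k.+1 1 (lam k x) =
  \sum_(i < l.+1) right_paths m.+1 k.+1 i.+1 (G i).
Proof.
rewrite -right_pathsZ.
transitivity (\sum_(i < l) (right_paths m.+1 k.+1 i.+1 (Gl i) + right_paths m.+1 k.+1 i.+2 (Gr i.+1))
   + right_paths m.+1 k.+1 1 (Gr 0)).
  congr (_ + _); apply: eq_bigr => i _.
  rewrite /right_paths1 right_pathsS (negbTE k_even) andFb mul1r.
  by rewrite !right_pathsZ mulrDr.
rewrite (@sum_shift l (fun i => right_paths m.+1 k.+1 i.+1 (Gl i))
  (fun i => right_paths m.+1 k.+1 i.+1 (Gr i))).
  by apply: eq_bigr => i _; rewrite right_pathsD.
by apply: right_paths0 => v; rewrite /Gl lam_out' mul0r mulr0.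
Qed.

Let S : R := lam k.+1 y (w + e l.+1) * (1 - rprob q (w + e l.+1) y l.+1) * cL l.+1.

Let B (i : nat) : R :=
  lam k.+1 (y - e i.+1) (w - e i.+1) * rprob q (w - e i.+1) (y - e i.+1) i.+1 * cR i.+1 +
  (i != l)%:R * (lam k.+1 (y - e i.+1) (w - e i.+2) *
    (1 - rprob q (w - e i.+2) (y - e i.+1) i.+1) * cR i.+2).

Let G_flow i : (i <= l)%N -> ent y i.+2 < ent y i.+1 ->
  G i (y - e i.+1) = Rrate (y - e i.+1) i.+1 * lam k x y.
Proof.
case: i => [|i] il hlt.
  rewrite -(right_flow1 q_gt0 q_lt1 a_gt0 px py) //; last by lia.
  by rewrite /G /Gl /Gr; ring.
have h1 : (2 <= i.+2 <= n)%N by lia.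
have h2 : (i.+2 <= (k.+2)./2)%N by rewrite kh2.
rewrite -(right_flow a q_gt0 q_lt1 px py xy h1 h2 hlt).
by rewrite /G /Gl /Gr /=; ring.
Qed.

(* Apply the flow identity to the performed jumps and split off the suppressed ones. *)
Let R2 i : (i <= l)%N -> right_paths m.+1 k.+1 i.+1 (G i) =
  Rrate (y - e i.+1) i.+1 * lam k x y * B i + (i == l)%:R * (G i y * S).
Proof.
move=> il.
have -> : right_paths m.+1 k.+1 i.+1 (G i) = G i (y - e i.+1) * B i + (i == l)%:R * (G i y * S).
  rewrite right_pathsS [odd _]/= k_even andTb kh2 eqSS /B /S; have [->|il'] := eqVneq i l.
    by rewrite left_pathsE right_paths_even //= /cR /cL ?mul0r ?mul1r ?addr0 ?negbK.
  by rewrite !right_paths_even /= ?negbK // !mul1r !mul0r addr0.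
congr (_ + _); have [h|h] := ltP (ent y i.+2) (ent y i.+1); first by rewrite G_flow.
suff h0 v : lam k.+1 (y - e i.+1) v = 0 by rewrite /B !h0 !mul0r mulr0 addr0 !mulr0.
have hi : (1 <= i.+1 <= n)%N by lia.
apply: lam0 => -[_ /(_ i.+1 isT)]; rewrite !ent_subE // eqxx eqn_succ.
by move: h; lia.
Qed.

(* Regroup by the particle of w and apply the flow identity again. *)
Let R3 : \sum_(i < l.+1) Rrate (y - e i.+1) i.+1 * B i + rate k.+1 * right_paths m k.+2 1 (lam k.+1 y) =
  lam k.+1 y w * \sum_(i < l.+1) Rrate (w - e i.+1) i.+1 * cR i.+1.
Proof.
pose f i := Rrate (y - e i.+1) i.+1 * lam k.+1 (y - e i.+1) (w - e i.+1) *
  rprob q (w - e i.+1) (y - e i.+1) i.+1 * cR i.+1.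
pose h i := if i is j.+1 then Rrate (y - e j.+1) j.+1 *
  (lam k.+1 (y - e j.+1) (w - e j.+2) * (1 - rprob q (w - e j.+2) (y - e j.+1) j.+1) * cR j.+2)
  else rate k.+1 * lam k.+1 y (w - e 1) * cR 1.
transitivity (\sum_(i < l.+1) (f i + (i != l :> nat)%:R * h i.+1) + h 0%N).
  congr (_ + _); first by apply: eq_bigr => i _; rewrite /f /h /B; ring.
  by rewrite right_paths_even /= ?negbK // mulrA.
rewrite sum_shift_last mulr_sumr; apply: eq_bigr => -[[|i] /= il] _.
  have [c0|c0] := eqVneq (cR 1) 0; first by rewrite /f /h c0 !mulr0 addr0.
  have := right_paths1_neq0 _ c0; rewrite /= negbK => /(_ k_even 1%N isT).
  have hn : (1 <= 1 <= n)%N by lia.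
  rewrite -/w !ent_subE //= => hlt.
  have hlt' : ent w 2 < ent w 1 by move: hlt; lia.
  have := right_flow1 q_gt0 q_lt1 a_gt0 py pw (leq_ltn_trans (leq0n _) ln) hlt' => hE.
  by rewrite [RHS]mulrA [lam k.+1 y w * _]mulrC -hE /f /h; ring.
have [c0|c0] := eqVneq (cR i.+2) 0; first by rewrite /f /h c0 !mulr0 addr0.
have := right_paths1_neq0 _ c0; rewrite /= negbK => /(_ k_even i.+2 isT).
have hn : (1 <= i.+2 <= n)%N by lia.
rewrite -/w !ent_subE // eqxx eqn_succ => hlt.
have hlt' : ent w i.+3 < ent w i.+2 by move: hlt; lia.
have h1 : (2 <= i.+2 <= n)%N by lia.
have h2 : (i.+2 <= (k.+3)./2)%N by rewrite /= uphalf_half; lia.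
have hE := right_flow a q_gt0 q_lt1 py pw yw h1 h2 hlt'.
by rewrite [RHS]mulrA [lam k.+1 y w * _]mulrC -hE /f /h /=; ring.
Qed.

Let D (i : nat) : R := left_paths1 m.+1 k.+1 i.+1.
Let Nl (i : nat) : R := lam k (x + e i.+1) (y + e i.+1) *
  (Lrate (x + e i.+1) i.+1 * (1 - lprob q (y + e i.+1) (x + e i.+1) i.+1)).
Let Nr (i : nat) : R := if i is j.+1 then
    lam k (x + e j.+1) (y + e j.+2) *
    (Lrate (x + e j.+1) j.+1 * lprob q (y + e j.+2) (x + e j.+1) j.+1)
  else 0.

Let L1 : \sum_(i < l) Lrate (x + e i.+1) i.+1 * left_paths1 m.+2 k i.+1 =
  \sum_(i < l.+1) (Nl i + Nr i) * D i.
Proof.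
transitivity (\sum_(i < l) (Nl i * D i + Nr i.+1 * D i.+1) + Nr 0%N * D 0%N).
  rewrite /Nr mul0r addr0; apply: eq_bigr => i _.
  by rewrite left_paths1S /Nl /D -/x -/y; ring.
rewrite (@sum_shift l (fun i => Nl i * D i) (fun i => Nr i * D i)).
  by apply: eq_bigr => i _; rewrite mulrDl.
by rewrite /Nl lam_out !mul0r.
Qed.

Let D_E i : D i =
  lam k.+1 (y + e i.+1) (w + e i.+2) * lprob q (w + e i.+2) (y + e i.+1) i.+1 * cL i.+2 +
  lam k.+1 (y + e i.+1) (w + e i.+1) * (1 - lprob q (w + e i.+1) (y + e i.+1) i.+1) *
    cL i.+1.
Proof. by rewrite /D left_paths1S. Qed.

Let y_out : ent y l.+2 = 0.
Proof. by apply: (paddedP _ _ py); rewrite kh2. Qed.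

Let w_out : ent w l.+2 = 0.
Proof. by apply: (paddedP _ _ pw); rewrite /= uphalf_half (negbTE k_even) kh. Qed.

Let D_last : D l = lam k.+1 (y + e l.+1) (w + e l.+1) *
  (1 - lprob q (w + e l.+1) (y + e l.+1) l.+1) * cL l.+1.
Proof.
rewrite D_E [X in X + _](_ : _ = 0) ?add0r //.
have hl : (1 <= l.+1 <= n)%N by lia.
case: (ltnP l.+1 n) => hn; last first.
  rewrite (@evec_out n l.+2) // /lprob addr0 /= !ent_addE // ?eqxx eqn_succ y_out w_out subrr.
  by rewrite !mulr0 !mul0r mulr0 mul0r.
have [->|/left_paths1_neq0[_ /(_ _)/paddedP/(_ l.+2)]] := eqVneq (cL l.+2) 0; first by rewrite mulr0.
rewrite -/w ent_addE ?eqxx ?w_out; last by lia.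
rewrite /= uphalf_half (negbTE k_even) kh; rewrite /m; lia.
Qed.

Let Y_dec i v : (1 <= i < n)%N -> lam k.+1 (y + e i.+1) v != 0 -> ent y i.+1 < ent y i.
Proof.
move=> hi h; apply/negPn/negP => h'; case/eqP: h; apply: lam0 => -[_ /(_ i)].
have h1 : (1 <= i.+1 <= n)%N by lia.
by rewrite !ent_addE // eqxx eqn_succ; lia.
Qed.

Let L2 i : (i < l)%N -> (Nl i + Nr i) * D i = Lrate (y + e i.+1) i.+1 * lam k x y * D i.
Proof.
move=> il; case: i il => [|i] il.
  rewrite -(left_flow1 a q_gt0 q_lt1 px py xy) ?addr0 //; rewrite /k; lia.
have h1 : (2 <= i.+2 <= n)%N by lia.
have h2 : (i.+2 <= (k.+1)./2)%N by rewrite kh1.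
have [hlt|hge] := boolP (ent y i.+2 < ent y i.+1).
  rewrite -(left_flow a q_gt0 q_lt1 px py xy h1 h2 hlt) //.
have h0 v : lam k.+1 (y + e i.+2) v = 0.
  by apply/eqP; apply: contraNT hge; apply: Y_dec; lia.
by rewrite D_E !h0 !mul0r addr0 !mulr0.
Qed.

(* The suppressed jumps complete the left flow at the last particle of y. *)
Let L2_last : (Nl l + Nr l) * D l + G l y * S = Lrate (y + e l.+1) l.+1 * lam k x y * D l.
Proof.
have -> : Nl l = 0 by rewrite /Nl lam_out mul0r.
have -> : G l y = Gr l y by rewrite /G /Gl lam_out' mul0r mulr0 add0r.
rewrite add0r D_last /S /Nr /Gr; have [l0|l0] := posnP l.
  have h := suppression_flow1 q_gt0 q_lt1 a_gt0 (y := y) (z := w) (leq_ltn_trans (leq0n _) ln).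
  have k0 : k = 0%N by rewrite /k l0.
  have x0 : x = 0 by rewrite /x k0.
  rewrite l0 x0 mul0r add0r !mulrA; congr (_ * _).
  have py1 : padded 1 y by move: py; rewrite k0.
  have pw2 : padded 2 w by move: pw; rewrite k0.
  rewrite k0; have := h py1 pw2 => /esym.
  by rewrite -!mulrA => ->.
have := suppression_flow q_gt0 q_lt1 a_gt0 px py pw k_even xy.
have hl2 : (1 < l.+1 <= n)%N by lia.
rewrite kh => /(_ hl2); have -> : l = l.-1.+1 by rewrite prednK.
rewrite [l.-1.+2.-1]/= => h.
have lin (A B' C D' E : R) : (A - B') * C = D' -> B' * (C * E) + D' * E = A * (C * E).
  by move=> <-; ring.
rewrite -(lin _ _ _ _ (cL l.-1.+2) h); congr (_ + _); ring.
Qed.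

Let L3 : \sum_(i < l.+1) Lrate (y + e i.+1) i.+1 * D i =
  lam k.+1 y w * \sum_(i < l.+1) Lrate (w + e i.+1) i.+1 * cL i.+1.
Proof.
pose f i := Lrate (y + e i.+1) i.+1 * lam k.+1 (y + e i.+1) (w + e i.+1) *
  (1 - lprob q (w + e i.+1) (y + e i.+1) i.+1) * cL i.+1.
pose h i := if i is j.+1 then Lrate (y + e j.+1) j.+1 *
  (lam k.+1 (y + e j.+1) (w + e j.+2) * lprob q (w + e j.+2) (y + e j.+1) j.+1 * cL j.+2)
  else 0.
transitivity (\sum_(i < l.+1) (f i + (i != l :> nat)%:R * h i.+1) + h 0%N).
  rewrite addr0; apply: eq_bigr => i _; have [->|il] := eqVneq (i : nat) l.
    by rewrite D_last /f mul0r addr0; ring.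
  by rewrite mul1r D_E /f /h; ring.
rewrite sum_shift_last mulr_sumr; apply: eq_bigr => -[[|i] /= il] _.
  have [c0|c0] := eqVneq (cL 1) 0; first by rewrite /f /h c0 !mulr0 addr0.
  have hE := left_flow1 a q_gt0 q_lt1 py pw yw (leq_ltn_trans (leq0n _) ln) isT.
  by rewrite [RHS]mulrA [lam k.+1 y w * _]mulrC -hE /f /h; ring.
have [c0|c0] := eqVneq (cL i.+2) 0; first by rewrite /f /h c0 !mulr0 addr0.
have [/(_ i.+1 isT) hlt _] := left_paths1_neq0 c0.
have hn : (1 <= i.+2 <= n)%N by lia.
move: hlt; rewrite -/w !ent_addE // eqxx eqn_succ => hlt.
have hlt' : ent w i.+2 < ent w i.+1 by move: hlt; lia.
have h1 : (2 <= i.+2 <= n)%N by lia.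
have h2 : (i.+2 <= (k.+2)./2)%N by rewrite kh2.
have hE := left_flow a q_gt0 q_lt1 py pw yw h1 h2 hlt'.
by rewrite [RHS]mulrA [lam k.+1 y w * _]mulrC -hE /f /h /=; ring.
Qed.

(** The right flow closes up at each of the two levels. The left flow closes up after both,
    thanks to the suppressed right jumps. *)
Lemma row_flow_step :
  row_flow l + rate k * right_paths m.+1 k.+1 1 (lam k x) +
    rate k.+1 * lam k x y * right_paths m k.+2 1 (lam k.+1 y) =
  lam k x y * lam k.+1 y w * row_flow l.+1.
Proof.
rewrite /row_flow doubleS -/k -/x -/w mS -/m.
rewrite -[lam k x y * _ * _]mulrA [lam k.+1 y w * _]mulrDr -R3 -L3 L1.
rewrite [_ + _ + rate k * _]addrAC R1.
have -> : \sum_(i < l.+1) right_paths m.+1 k.+1 i.+1 (G i) =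
    \sum_(i < l.+1) Rrate (y - e i.+1) i.+1 * lam k x y * B i + G l y * S.
  rewrite (eq_bigr (fun i : 'I_l.+1 => Rrate (y - e i.+1) i.+1 * lam k x y * B i +
    (i == l :> nat)%:R * (G i y * S))); last by move=> i _; rewrite R2 // -ltnS.
  rewrite big_split /=; congr (_ + _); rewrite big_ord_recr /= eqxx mul1r big1 ?add0r //.
  by move=> i _; rewrite (ltn_eqF (ltn_ord i)) mul0r.
rewrite -[_ + G l y * S + _]addrA [G l y * S + _]addrC.
have -> : \sum_(i < l.+1) (Nl i + Nr i) * D i + G l y * S =
    \sum_(i < l.+1) Lrate (y + e i.+1) i.+1 * lam k x y * D i.
  rewrite big_ord_recr /= -addrA L2_last [RHS]big_ord_recr /=; congr (_ + _).
  by apply: eq_bigr => i _; rewrite L2.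
rewrite addrAC 2![in RHS]mulrDr; congr (_ + _ + _).
- by rewrite mulr_sumr; apply: eq_bigr => i _; ring.
- ring.
- by rewrite mulr_sumr; apply: eq_bigr => i _; ring.
Qed.

End Step.

Lemma head_weightS (v : iarray n) k :
  head_weight v k.+1 = head_weight v k * lam k (lvl v k) (lvl v k.+1).
Proof. by rewrite /head_weight big_nat_recr. Qed.

(** All clocks above the even level l.*2 together; for l = n this is the whole dynamics. *)
Lemma clocks_row_flow l : (l <= n)%N ->
  \sum_(0 <= k < l.*2) rate k * (head_weight u k *
    right_paths (n.*2 - k.+1) k.+1 1 (lam k (lvl u k))) = head_weight u l.*2 * row_flow l.
Proof.
elim: l => [|l IHl] ln; first by rewrite /row_flow big_geq // !big_ord0 addr0 mulr0.
rewrite doubleS 2?big_nat_recr //= IHl; last exact: ltnW.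
rewrite !head_weightS.
have -> : (n.*2 - l.*2.+1 = (n.*2 - l.*2.+2).+1)%N by lia.
have h := row_flow_step ln.
transitivity (head_weight u l.*2 * (lam l.*2 (lvl u l.*2) (lvl u l.*2.+1) *
  lam l.*2.+1 (lvl u l.*2.+1) (lvl u l.*2.+2) * row_flow l.+1)); last by ring.
by rewrite -h; ring.
Qed.

Lemma row_flow_bottom : row_flow n =
  \sum_(i < n) (Rrate z i.+1 * (lvl u n.*2 - e i.+1 == z)%:R +
                Lrate z i.+1 * (lvl u n.*2 + e i.+1 == z)%:R).
Proof.
rewrite /row_flow subnn -big_split; apply: eq_bigr => i _; congr (_ + _).
  by rewrite /right_paths1 /= mul1r; case: eqP => [->|]; rewrite ?mulr0.
by rewrite /left_paths1 /= mul1r; case: eqP => [->|]; rewrite ?mulr0.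
Qed.

End PathSums.

(** * Patterns and their weights *)

Section Arrays.
Variable n : nat.
Implicit Types v c d : iarray n.

Lemma lvlE v (j : 'I_n.*2) : lvl v j.+1 = v j.
Proof. by rewrite /lvl valK. Qed.

Lemma lvlD v c k : lvl (v + c) k = lvl v k + lvl c k.
Proof.
rewrite /lvl; case: k => [|k]; first by rewrite addr0.
by case: insubP => [j _ _| _]; rewrite ?ffunE ?addr0.
Qed.

Lemma lvlN v k : lvl (- v) k = - lvl v k.
Proof.
rewrite /lvl; case: k => [|k]; first by rewrite oppr0.
by case: insubP => [j _ _| _]; rewrite ?ffunE ?oppr0.
Qed.

Lemma lvl0 k : lvl (0 : iarray n) k = 0.
Proof. by rewrite /lvl; case: k => [|k] //; case: insubP => [j _ _| _]; rewrite ?ffunE. Qed.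

Lemma lvl_earray k i j : (1 <= k <= n.*2)%N ->
  lvl (earray n k i) j = if j == k then evec n i else 0.
Proof.
move=> hk; rewrite /lvl; case: j => [|j]; first by case: eqP => // h; move: hk; rewrite -h.
case: insubP => [j0 _ oj|]; first by rewrite ffunE oj.
by rewrite -leqNgt => hj; case: eqP => // h; lia.
Qed.

(** One condition for all levels, by the convention that missing entries are 0. *)
Lemma is_patternP v : is_pattern v <->
  (forall k, (k <= n.*2)%N -> padded k (lvl v k)) /\
  (forall k, (k < n.*2)%N -> interlaced (lvl v k) (lvl v k.+1)).
Proof.
split=> [[h_pad h_ge0 h_even h_odd]|[h_pad h_lace]].
- have pad k : (k <= n.*2)%N -> padded k (lvl v k).
    case: k => [|k] hk; apply/paddedP => i hi; first by rewrite ent0.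
    by apply: h_pad.
  split=> // k hk j hj; case: (leqP j (k.+1)./2) => hjk; last first.
    rewrite (paddedP _ _ (pad k _) j) //; last by lia.
    have hj1 : ((k.+2)./2 < j.+1)%N by rewrite /= in hjk *; lia.
    rewrite (paddedP _ _ (pad k.+1 _) j.+1) // lexx /=.
    case: (leqP j (k.+2)./2) => hj2; first by apply: h_ge0; lia.
    by rewrite (paddedP _ _ (pad k.+1 _) j).
  have [ko|ko] := boolP (odd k).
    have kE : k = (k./2.+1).*2.-1 by have := odd_double_half k; rewrite ko; lia.
    have := h_even k./2.+1 j; rewrite -kE (_ : k./2.+1.*2 = k.+1); last by lia.
    by apply; rewrite /= uphalf_half ko in hjk; lia.
  have kE : k = (k./2).*2 by have := odd_double_half k; rewrite (negbTE ko).
  rewrite {2 4}kE; rewrite {1}kE in hk; have := h_odd k./2 j; rewrite -kE; apply.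
    by rewrite /= uphalf_half (negbTE ko) in hjk; lia.
  by rewrite /= uphalf_half (negbTE ko) in hjk; lia.
- have ge0 k i : (1 <= k <= n.*2)%N -> (1 <= i)%N -> 0 <= ent (lvl v k) i.
    move=> /andP[k1]; move: i; have [m] := ubnP (n.*2 - k); elim: m k k1 => // m IHm k k1 hm i hk i1.
    case: (ltnP k n.*2) => hk2.
      have /andP[h _] := h_lace k hk2 i i1; apply: le_trans h; apply: IHm => //; lia.
    have {}hk2 : k = n.*2 by lia.
    have hl : interlaced (lvl v n.*2.-1) (lvl v n.*2.-1.+1) by apply: h_lace; lia.
    rewrite prednK -?hk2 // in hl.
    have [p] := ubnP (n.+1 - i); elim: p i i1 => // p IHp i i1 hp.
    have := interlaced_dec_lower hl i1; apply: le_trans.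
    case: (ltnP n i) => hi; first by rewrite ent_out //; lia.
    by apply: IHp => //; lia.
  split.
  + by move=> k i hk hi; apply: (paddedP _ _ (h_pad k _)) => //; lia.
  + by move=> k i hk hi; apply: ge0 => //; lia.
  + move=> l i hl hi; have := h_lace l.*2.-1; rewrite prednK; last by lia.
    by apply; lia.
  + by move=> l i hl hi; apply: h_lace; lia.
Qed.

End Arrays.

Section Weights.
Variables (R : realType) (n : nat) (q : R) (a : 'I_n -> R).
Hypotheses (q_gt0 : 0 < q) (q_lt1 : q < 1) (a_gt0 : forall i, 0 < a i).
Implicit Types (v c d : iarray n) (x y w : ivec n).
Notation lam := (level_weight q a).
Notation lace := (lace_factor q).
Notation laceat := (lace_factor_at q).
Notation headweight := (head_weight q a).
Notation rate := (clock_speed a).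
Notation e := (evec n).

Lemma lace_top (m : int) : 0 <= m -> lace m 0 0 = 1.
Proof.
move=> m0; rewrite /lace_factor subr0 subrr -mulrA /= /qpoch big_ord0 invr1 mulr1.
by case: m m0 => // m _ /=; rewrite divff // gt_eqF //; exact: qpoch_gt0.
Qed.

Lemma lace_product_trunc m x y : (m <= n)%N -> (forall j, (m < j)%N -> laceat x y j = 1) ->
  lace_product q x y = \prod_(1 <= j < m.+1) laceat x y j.
Proof.
move=> mn h; rewrite /lace_product big_ltn // mul1r (@big_cat_nat _ _ _ m.+1) //= [X in _ * X]big_nat_cond [X in _ * X]big1 ?mulr1 //.
by move=> j /andP[/andP[h1 _] _]; rewrite h.
Qed.

Lemma clock_speed_double (l : 'I_n) : rate l.*2 = a l.
Proof. by rewrite /clock_speed odd_double doubleK -(level_parameterE a). Qed.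

Lemma clock_speed_doubleS (l : 'I_n) : rate l.*2.+1 = (a l)^-1.
Proof. by rewrite /clock_speed /= odd_double uphalf_double -(level_parameterE a). Qed.

(** In the two products over all positions the factors past the last particle are 1. *)
Lemma Lambda_lam (l : 'I_n) x y w :
  padded l.*2 x -> padded l.*2.+1 y -> padded l.*2.+2 w ->
  interlaced x y -> interlaced y w ->
  Lambda q (a l) l.+1 x y w = lam l.*2 x y * lam l.*2.+1 y w.
Proof.
move=> px py pw xy yw; have ln := ltn_ord l.
have x0 j : (l < j)%N -> ent x j = 0.
  by move=> h; apply: (paddedP _ _ px); rewrite /= uphalf_double.
have y0 j : (l.+1 < j)%N -> ent y j = 0.
  by move=> h; apply: (paddedP _ _ py); rewrite /= doubleK.
have w0 j : (l.+1 < j)%N -> ent w j = 0.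
  by move=> h; apply: (paddedP _ _ pw); rewrite /= uphalf_double.
have yge j : (1 <= j)%N -> (l < j)%N -> 0 <= ent y j.
  by move=> j1 h; have := interlaced_dec_lower xy j1; rewrite (y0 j.+1).
rewrite /level_weight px py !mul1r.
have al : a l != 0 by rewrite gt_eqF.
rewrite clock_speed_double clock_speed_doubleS exprz_inv opprB.
rewrite (@lace_product_trunc l) ?(ltnW ln) //; last first.
  by case=> // j hj /=; rewrite (x0 j.+1) // (y0 j.+2) // lace_top // yge.
rewrite (@lace_product_trunc l.+1) //; last first.
  by case=> // j hj /=; rewrite (w0 j.+1) // (y0 j.+1) // (w0 j.+2); [apply: lace_top|lia].
rewrite [X in _ * (_ * X)]big_nat_recr //= /Lambda big_split /=.
have -> : 2 * wt y - wt x - wt w = (wt y - wt x) + (wt y - wt w) by ring.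
rewrite expfzDr // -(lace_qbin q_gt0 q_lt1 (yw l.+1 isT)).
rewrite (w0 l.+2) // subr0.
have E (x1 y1 : ivec n) (h : interlaced x1 y1) : \prod_(1 <= j < l.+1) laceat x1 y1 j =
   \prod_(1 <= j < l.+1) qbin q (ent y1 j - ent y1 j.+1) (ent y1 j - ent x1 j).
  by apply: eq_big_nat => -[|j] // _; rewrite (lace_qbin q_gt0 q_lt1) //; exact: h.
rewrite !E //; ring.
Qed.

Lemma prod_double (F : nat -> R) l :
  \prod_(0 <= k < l.*2) F k = \prod_(0 <= j < l) (F j.*2 * F j.*2.+1).
Proof.
elim: l => [|l IHl]; first by rewrite !big_geq.
by rewrite doubleS !big_nat_recr //= IHl mulrA.
Qed.

Lemma sum_double (F : nat -> R) l :
  \sum_(0 <= k < l.*2) F k = \sum_(0 <= j < l) (F j.*2 + F j.*2.+1).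
Proof.
elim: l => [|l IHl]; first by rewrite !big_geq.
by rewrite doubleS !big_nat_recr //= IHl addrA.
Qed.

Lemma pattern_facts (v : pattern n) :
  (forall k, (k <= n.*2)%N -> padded k (lvl v k)) /\
  (forall k, (k < n.*2)%N -> interlaced (lvl v k) (lvl v k.+1)).
Proof. by apply/is_patternP; case: v => v /= /asboolP. Qed.

Lemma weightE (v : pattern n) : weight q a v = headweight v n.*2.
Proof.
have [hp hl] := pattern_facts v.
rewrite /head_weight prod_double big_mkord; apply: eq_bigr => l _.
have ln := ltn_ord l.
by apply: Lambda_lam; [apply: hp; lia|apply: hp; lia|apply: hp; lia|apply: hl; lia|apply: hl; lia].
Qed.

Lemma weight_gt0 (v : pattern n) : 0 < weight q a v.
Proof.
have [hp hl] := pattern_facts v.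
rewrite weightE /head_weight big_nat; apply: prodr_gt0 => k /andP[_ hk].
by apply: level_weight_gt0 => //; [apply: hp; exact: ltnW|apply: hl].
Qed.

Lemma head_weight_pattern v : headweight v n.*2 != 0 -> is_pattern v.
Proof.
rewrite /head_weight => h.
have hk k : (k < n.*2)%N -> padded k (lvl v k) /\ interlaced (lvl v k) (lvl v k.+1).
  move=> hk; apply: (level_weight_neq0 (a := a) q_gt0 q_lt1).
  apply: contraNneq h => h0; rewrite (bigD1_seq k) ?iota_uniq ?mem_index_iota //=.
  by rewrite h0 mul0r.
apply/is_patternP; split=> k; last by case/hk.
rewrite leq_eqVlt => /orP[/eqP ->|/hk[]//].
by apply/paddedP => i hi; apply: ent_out; move: hi; rewrite /= uphalf_double.
Qed.

End Weights.

(** * Sums over the patterns with a given bottom row *)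

Section Fibres.
Variable n : nat.

(** This makes the patterns with a given bottom row finite in number. *)
Lemma pattern_bound (v : pattern n) k i : (1 <= k <= n.*2)%N -> (1 <= i)%N ->
  0 <= ent (lvl v k) i <= ent (lvl v n.*2) 1.
Proof.
move=> hk hi; have [hp hl] := pattern_facts v.
have ge0 : 0 <= ent (lvl v k) i.
  case: (leqP i (k.+1)./2) => h; last by rewrite (paddedP _ _ (hp k _) i) //; lia.
  case: v {hp hl} => v /= /asboolP[_ h0 _ _]; apply: h0 => //; lia.
rewrite ge0 /=; apply: (@le_trans _ _ (ent (lvl v k) 1)).
  have hdec j : (1 <= j)%N -> ent (lvl v k) j.+1 <= ent (lvl v k) j.
    case: (ltnP k n.*2) => h; first exact: interlaced_dec_upper (hl k h).
    have -> : k = k.-1.+1 by lia.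
    by apply: interlaced_dec_lower (hl k.-1 _); lia.
  elim: i hi {ge0} => // -[|i] IHi _ //.
  by apply: le_trans (IHi isT); apply: hdec.
have [m] := ubnP (n.*2 - k); elim: m k hk {ge0} => // m IHm k hk hm.
case: (ltnP k n.*2) => h; last by have -> : k = n.*2 by lia.
by have /andP[_ h1] := hl k h 1%N isT; apply: le_trans h1 (IHm _ _ _); lia.
Qed.

(** An explicit list, obtained from the arrays with entries bounded as in
    [pattern_bound]. *)
Definition fibre (z : chamber n) : seq (pattern n) :=
  undup [seq v <- pmap insub
    [seq [ffun k => [ffun i => (f k i : nat)%:Z]]
      | f : {ffun 'I_n.*2 -> {ffun 'I_n -> 'I_(`|ent z 1|%N.+1)}}] | bottom_row v == z].

Lemma fibre_uniq z : uniq (fibre z).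
Proof. exact: undup_uniq. Qed.

Lemma mem_fibre z v : (v \in fibre z) = (bottom_row v == z).
Proof.
rewrite mem_undup mem_filter; case: eqP => //= vz.
rewrite mem_pmap_sub; apply/mapP.
pose N := `|ent z 1|%N.
exists [ffun k => [ffun i => inord (n' := N) `|(v : iarray n) k i|%N]]; first by rewrite mem_enum.
apply/ffunP => k; apply/ffunP => i; rewrite !ffunE.
have hk : (1 <= k.+1 <= n.*2)%N by have := ltn_ord k; lia.
have /andP[] := pattern_bound v hk (isT : (1 <= i.+1)%N).
rewrite lvlE entE => h1 h2; rewrite inordK ?gez0_abs //.
by rewrite /N -vz /= ltnS -lez_nat !gez0_abs //; exact: le_trans h1 h2.
Qed.

End Fibres.

Section MoveHeads.
Variables (R : realType) (n : nat) (q : R).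
Implicit Types (v c d : iarray n).
Notation e := (evec n).

(** A left jump in progress at level k no longer affects the levels above, and certainly
    moves particle i. *)
Lemma leftward_head v m k i c c' : (1 <= k)%N -> (m + k = n.*2)%N ->
  leftward q v m k i c c' != 0 ->
  (forall j, (j < k)%N -> lvl c j = lvl c' j) /\ lvl c' k = lvl c k - e i.
Proof.
elim: m k i c => [|m IHm] k i c k1 mk /=.
  rewrite /dirac_mass; case: (_ =P c') => [<- _|]; last by rewrite eqxx.
  split=> [j jk|]; rewrite lvlD lvlN lvl_earray ?eqxx //; try lia.
  by rewrite (ltn_eqF jk) subr0.
have key i' : leftward q v m k.+1 i' (c - earray n k i) c' != 0 ->
    (forall j, (j < k)%N -> lvl c j = lvl c' j) /\ lvl c' k = lvl c k - e i.
  move=> /IHm[||h _]; [by []|by lia|].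
  split=> [j jk|]; rewrite -h ?lvlD ?lvlN ?lvl_earray ?eqxx //; try lia.
  by rewrite (ltn_eqF jk) subr0.
rewrite /mix => h; have [h0|/key //] := eqVneq (leftward q v m k.+1 i.+1 (c - earray n k i) c') 0.
by apply: (key i); apply: contraNneq h => h1; rewrite h0 h1 !mulr0 addr0.
Qed.

Lemma rightward_head v m k i c c' : (1 <= k)%N -> (m + k = n.*2)%N ->
  rightward q v m k i c c' != 0 ->
  forall j, (j < k)%N -> lvl c j = lvl c' j.
Proof.
elim: m k i c => [|m IHm] k i c k1 mk /=.
  rewrite /dirac_mass; case: (_ =P c') => [<- _|]; last by rewrite eqxx.
  move=> j jk; rewrite lvlD lvl_earray ?eqxx //; try lia.
  by rewrite (ltn_eqF jk) addr0.
have key i' : rightward q v m k.+1 i' (c + earray n k i) c' != 0 ->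
    forall j, (j < k)%N -> lvl c j = lvl c' j.
  have mk' : (m + k.+1 = n.*2)%N by lia.
  move=> /(IHm k.+1 _ _ isT mk') h j jk; rewrite -h ?lvlD ?lvl_earray ?eqxx //; try lia.
  by rewrite (ltn_eqF jk) addr0.
rewrite /mix; case: ifP => _ h;
  have [h0|/key //] := eqVneq (rightward q v m k.+1 i (c + earray n k i) c') 0.
  have : leftward q v m k.+1 i c c' != 0.
    by apply: contraNneq h => h1; rewrite h0 h1 !mulr0 addr0.
  move=> /leftward_head[||h' _ j jk]; [by []|by lia|].
  by apply: h'; apply: ltnW.
by apply: (key i.+1); apply: contraNneq h => h1; rewrite h0 h1 !mulr0 addr0.
Qed.

(** The attempt is suppressed only at the last particle of an odd level. *)
Lemma rightward_head_level v m k i c c' : (1 <= k)%N -> (m + k = n.*2)%N ->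
  rightward q v m k i c c' != 0 ->
  lvl c' k = lvl c k + e i \/
  [/\ odd k, i = (k.+1)./2 & lvl c' k = lvl c k].
Proof.
case: m => [|m] k1 mk /=.
  rewrite /dirac_mass; case: (_ =P c') => [<- _|]; last by rewrite eqxx.
  by left; rewrite lvlD lvl_earray ?eqxx //; lia.
have mk' : (m + k.+1 = n.*2)%N by lia.
have key i' : rightward q v m k.+1 i' (c + earray n k i) c' != 0 ->
    lvl c' k = lvl c k + e i.
  move=> /(rightward_head (isT : (0 < k.+1)%N) mk')/(_ k (ltnSn k)) <-.
  by rewrite lvlD lvl_earray ?eqxx //; lia.
rewrite /mix; case: ifP => [/andP[ko /eqP ik]|_] h;
  have [h0|/key] := eqVneq (rightward q v m k.+1 i (c + earray n k i) c') 0; try by left.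
  right; split=> //.
  have : leftward q v m k.+1 i c c' != 0.
    by apply: contraNneq h => h1; rewrite h0 h1 !mulr0 addr0.
  by move=> /(leftward_head (isT : (0 < k.+1)%N) mk')[/(_ k (ltnSn k)) ->].
by left; apply: (key i.+1); apply: contraNneq h => h1; rewrite h0 h1 !mulr0 addr0.
Qed.

End MoveHeads.

Section FibreSums.
Variables (R : realType) (n : nat) (q : R) (a : 'I_n -> R).
Hypotheses (q_gt0 : 0 < q) (q_lt1 : q < 1) (a_gt0 : forall i, 0 < a i).
Implicit Types (v c d : iarray n).
Notation lam := (level_weight q a).
Notation headweight := (head_weight q a).
Notation rate := (clock_speed a).
Notation e := (evec n).

Section FixedTarget.
Variables (u : iarray n) (z : chamber n).

Lemma lvl_shift d k i j : (1 <= k <= n.*2)%N -> (forall j, (k <= j)%N -> lvl d j = 0) ->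
  lvl (u - (d + earray n k i)) j =
    if (j < k)%N then lvl (u - d) j else if j == k then lvl u k - e i else lvl u j.
Proof.
move=> hk hd; rewrite !lvlD !lvlN lvlD lvl_earray //.
case: ltngtP => [h|h|->]; first by rewrite addr0.
  by rewrite addr0 hd ?subr0 // ltnW.
by rewrite hd // add0r.
Qed.

Lemma head_weight_eq (v c : iarray n) k : (forall j, (j <= k)%N -> lvl v j = lvl c j) ->
  headweight v k = headweight c k.
Proof. by move=> h; apply: eq_big_nat => j /andP[_ hj]; rewrite !h // ltnW. Qed.

Lemma sum_fibre_dirac (v0 : iarray n) (G : ivec n -> R) :
  \sum_(v <- fibre z) weight q a v * G (lvl v n.*2) * dirac_mass R v v0 =
  headweight v0 n.*2 * G (lvl v0 n.*2) * (lvl v0 n.*2 == z)%:R.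
Proof.
have [h0|h0] := eqVneq (headweight v0 n.*2) 0.
  rewrite h0 !mul0r big1 // => v _; rewrite /dirac_mass; case: eqP => [vv|]; last by rewrite mulr0.
  by have := weight_gt0 q_gt0 q_lt1 a_gt0 v; rewrite weightE // vv h0 ltxx.
have hp : `[< is_pattern v0 >] by apply/asboolP; exact: (head_weight_pattern q_gt0 q_lt1 h0).
pose v1 : pattern n := Pattern hp.
have E (v : pattern n) : dirac_mass R v v0 = (v == v1)%:R by [].
have [hz|hz] := eqVneq (lvl v0 n.*2) z.
  rewrite mulr1 (bigD1_seq v1) ?fibre_uniq //=; last first.
    by rewrite mem_fibre; apply/eqP/val_inj.
  rewrite [dirac_mass R v0 v0]/dirac_mass eqxx mulr1 (weightE q_gt0 q_lt1 a_gt0) big1 ?addr0 // => v hv.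
  by rewrite E (negbTE hv) mulr0.
rewrite mulr0 big_seq big1 // => v; rewrite mem_fibre => /eqP vz.
rewrite E; case: eqP => [vv|]; last by rewrite mulr0.
by case/eqP: hz; rewrite -vz vv.
Qed.


Notation phiL := (left_paths q a u z).
Notation phiR := (right_paths q a u z).

(** One level of a path. Since u is fixed, row k before the jump is forced to be x0, and
    the probability of the choice at this level depends only on row k.+1 before the jump:
    it can be handed over to the sum for the next level. *)
Lemma fibre_step k x0 d d' (G : ivec n -> R) (G' : ivec n -> ivec n -> R)
    (f : pattern n -> R) (Phi : (ivec n -> R) -> R) : (1 <= k)%N ->
  lvl (u - d') k = x0 -> (forall j, (j < k)%N -> lvl (u - d') j = lvl (u - d) j) ->
  (forall v : pattern n, f v != 0 -> lvl v k = x0) ->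
  (forall (r : R) g, Phi (fun y => r * g y) = r * Phi g) ->
  (forall G0 : ivec n -> R, \sum_(v <- fibre z) weight q a v * G0 (lvl v k.+1) * f v =
    headweight (u - d') k * Phi (fun y => lam k (lvl (u - d') k) y * G0 y)) ->
  \sum_(v <- fibre z) weight q a v * G (lvl v k) * (G' (lvl v k) (lvl v k.+1) * f v) =
  headweight (u - d) k.-1 * (lam k.-1 (lvl (u - d) k.-1) x0 * G x0 *
    Phi (fun y => lam k x0 y * G' x0 y)).
Proof.
move=> k1 x0E hlow hf PhiZ IH.
transitivity (\sum_(v <- fibre z) weight q a v * (G x0 * G' x0 (lvl v k.+1)) * f v).
  apply: eq_bigr => v _; have [->|/hf ->] := eqVneq (f v) 0; first by rewrite !mulr0.
  by ring.
rewrite (IH (fun y => G x0 * G' x0 y)) x0E -[in headweight (u - d') k](prednK k1).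
rewrite head_weightS prednK // x0E hlow; last by rewrite prednK.
rewrite (head_weight_eq (c := u - d)); last by move=> j hj; rewrite hlow //; lia.
rewrite (_ : (fun y => _) = fun y => G x0 * (lam k x0 y * G' x0 y)).
  by rewrite PhiZ; ring.
by apply/funext => y; ring.
Qed.

(** Summing over the patterns before the jump amounts to summing over paths, because u and
    the path determine the pattern. Here d is the displacement of the levels above k, which
    have already moved. *)
Lemma fibre_leftward m k i (G : ivec n -> R) d : (1 <= k)%N -> (m + k = n.*2)%N ->
  (forall j, (k <= j)%N -> lvl d j = 0) ->
  \sum_(v <- fibre z) weight q a v * G (lvl v k) * leftward q v m k i ((v : iarray n) + d) u =
  headweight (u - d) k.-1 *
    phiL m k i (fun y => lam k.-1 (lvl (u - d) k.-1) y * G y).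
Proof.
elim: m k i G d => [|m IHm] k i G d k1 mk hd.
  rewrite add0n in mk; subst k.
  pose v0 := u - (d - earray n n.*2 i).
  have lv0 j : lvl v0 j = if (j < n.*2)%N then lvl (u - d) j
      else if j == n.*2 then lvl u n.*2 + e i else lvl u j.
    rewrite /v0 !lvlD !lvlN !lvlD lvlN lvl_earray ?k1 ?leqnn //.
    case: ltngtP => [h|h|->]; first by rewrite oppr0 addr0.
      by rewrite oppr0 addr0 hd ?subr0 // ltnW.
    by rewrite hd // add0r opprK.
  transitivity (\sum_(v <- fibre z) weight q a v * G (lvl v n.*2) * dirac_mass R v v0).
    apply: eq_bigr => v _; congr (_ * _); rewrite /= /dirac_mass /v0; congr (_%:R).
    by rewrite -addrA eq_sym -subr_eq eq_sym.
  rewrite sum_fibre_dirac /= lv0 ltnn eqxx -mulrA mulrA.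
  rewrite (_ : headweight v0 n.*2 = headweight (u - d) n.*2.-1 *
     lam n.*2.-1 (lvl (u - d) n.*2.-1) (lvl u n.*2 + e i)); first by rewrite -!mulrA.
  rewrite -{1}(prednK k1) head_weightS !lv0 prednK // ltnn eqxx leqnn.
  congr (_ * _); apply: head_weight_eq => j hj; rewrite lv0.
  by rewrite (leq_ltn_trans hj) // prednK.
pose x0 := lvl u k + e i.
have hk : (1 <= k <= n.*2)%N by lia.
have mk' : (m + k.+1 = n.*2)%N by lia.
pose d' := d - earray n k i.
have hd' j : (k.+1 <= j)%N -> lvl d' j = 0.
  by move=> h; rewrite /d' lvlD lvlN lvl_earray // (gtn_eqF h) subr0 hd // ltnW.
have x0E : lvl (u - d') k = x0.
  by rewrite /d' !lvlD !lvlN lvlD lvlN lvl_earray // eqxx hd // add0r opprK.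
have hlow j : (j < k)%N -> lvl (u - d') j = lvl (u - d) j.
  by move=> h; rewrite /d' !lvlD !lvlN lvlD lvlN lvl_earray // (ltn_eqF h) subr0.
have step (G' : ivec n -> ivec n -> R) i' :
  \sum_(v <- fibre z) weight q a v * G (lvl v k) *
     (G' (lvl v k) (lvl v k.+1) * leftward q v m k.+1 i' ((v : iarray n) + d - earray n k i) u) =
  headweight (u - d) k.-1 * (lam k.-1 (lvl (u - d) k.-1) x0 * G x0 *
    phiL m k.+1 i' (fun y => lam k x0 y * G' x0 y)).
  apply: (fibre_step (d' := d')) => //.
  - move=> v /(leftward_head (isT : (0 < k.+1)%N) mk')[/(_ k (ltnSn k))].
    rewrite !lvlD lvlN lvl_earray // eqxx hd // addr0 => /eqP.
    by rewrite subr_eq => /eqP ->.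
  - by move=> c g; rewrite !left_pathsE mulrA.
  - move=> G0; rewrite -(IHm k.+1 i' G0 d' isT mk' hd').
    by apply: eq_bigr => v _; rewrite /d' addrA.
rewrite [phiL _ _ _ _]/= -/x0 mulrDr mulrDr.
rewrite -(step (fun x y => lprob q y x i)) -(step (fun x y => 1 - lprob q y x i)).
rewrite -big_split /=.
by apply: eq_bigr => v _; rewrite /mix -mulrDr.
Qed.

Lemma fibre_rightward m k i (G : ivec n -> R) d : (1 <= k)%N -> (m + k = n.*2)%N ->
  (forall j, (k <= j)%N -> lvl d j = 0) ->
  \sum_(v <- fibre z) weight q a v * G (lvl v k) *
    rightward q v m k i ((v : iarray n) + d) u =
  headweight (u - d) k.-1 *
    phiR m k i (fun y => lam k.-1 (lvl (u - d) k.-1) y * G y).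
Proof.
elim: m k i G d => [|m IHm] k i G d k1 mk hd.
  rewrite add0n in mk; subst k.
  pose v0 := u - (d + earray n n.*2 i).
  have lv0 j : lvl v0 j = if (j < n.*2)%N then lvl (u - d) j
      else if j == n.*2 then lvl u n.*2 - e i else lvl u j.
    by rewrite /v0 lvl_shift ?k1 ?leqnn.
  transitivity (\sum_(v <- fibre z) weight q a v * G (lvl v n.*2) * dirac_mass R v v0).
    apply: eq_bigr => v _; congr (_ * _); rewrite /= /dirac_mass /v0; congr (_%:R).
    by rewrite -addrA eq_sym -subr_eq eq_sym.
  rewrite sum_fibre_dirac /= lv0 ltnn eqxx -mulrA mulrA.
  rewrite (_ : headweight v0 n.*2 = headweight (u - d) n.*2.-1 *
     lam n.*2.-1 (lvl (u - d) n.*2.-1) (lvl u n.*2 - e i)); first by rewrite -!mulrA.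
  rewrite -{1}(prednK k1) head_weightS !lv0 prednK // ltnn eqxx leqnn.
  congr (_ * _); apply: head_weight_eq => j hj; rewrite lv0.
  by rewrite (leq_ltn_trans hj) // prednK.
pose x0 := lvl u k - e i.
have hk : (1 <= k <= n.*2)%N by lia.
have mk' : (m + k.+1 = n.*2)%N by lia.
pose d' := d + earray n k i.
have hd' j : (k.+1 <= j)%N -> lvl d' j = 0.
  by move=> h; rewrite /d' lvlD lvl_earray // (gtn_eqF h) addr0 hd // ltnW.
have x0E : lvl (u - d') k = x0 by rewrite /d' lvl_shift // ltnn eqxx.
have hlow j : (j < k)%N -> lvl (u - d') j = lvl (u - d) j.
  by move=> h; rewrite /d' lvl_shift // h.
have step (G' : ivec n -> ivec n -> R) i' :
  \sum_(v <- fibre z) weight q a v * G (lvl v k) *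
     (G' (lvl v k) (lvl v k.+1) * rightward q v m k.+1 i' ((v : iarray n) + d + earray n k i) u) =
  headweight (u - d) k.-1 * (lam k.-1 (lvl (u - d) k.-1) x0 * G x0 *
    phiR m k.+1 i' (fun y => lam k x0 y * G' x0 y)).
  apply: (fibre_step (d' := d')) => //.
  - move=> v /(rightward_head (isT : (0 < k.+1)%N) mk')/(_ k (ltnSn k)).
    rewrite !lvlD lvl_earray // eqxx hd // addr0 => h.
    by rewrite /x0 -h addrK.
  - by move=> c g; rewrite right_pathsZ.
  - move=> G0; rewrite -(IHm k.+1 i' G0 d' isT mk' hd').
    by apply: eq_bigr => v _; rewrite /d' addrA.
have hdk j : (k.+1 <= j)%N -> lvl d j = 0 by move=> h; apply: hd; exact: ltnW.
have ud : lvl (u - d) k = lvl u k by rewrite lvlD lvlN hd // subr0.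
have stop (G' : ivec n -> ivec n -> R) i' :
  \sum_(v <- fibre z) weight q a v * G (lvl v k) *
     (G' (lvl v k) (lvl v k.+1) * leftward q v m k.+1 i' ((v : iarray n) + d) u) =
  headweight (u - d) k.-1 * (lam k.-1 (lvl (u - d) k.-1) (lvl u k) * G (lvl u k) *
    phiL m k.+1 i' (fun y => lam k (lvl u k) y * G' (lvl u k) y)).
  apply: (fibre_step (d' := d)) => //.
  - move=> v /(leftward_head (isT : (0 < k.+1)%N) mk')[/(_ k (ltnSn k))].
    by rewrite lvlD hd // addr0.
  - by move=> c g; rewrite !left_pathsE mulrA.
  - by move=> G0; rewrite -(fibre_leftward i' G0 (isT : (0 < k.+1)%N) mk' hdk).
rewrite right_pathsS -/x0 /=; case: ifP => _.
  rewrite mulrDr -(step (fun x y => rprob q y x i)) -(stop (fun x y => 1 - rprob q y x i)).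
  by rewrite -big_split /=; apply: eq_bigr => v _; rewrite /mix -mulrDr.
rewrite mulrDr mulrDr -(step (fun x y => rprob q y x i)) -(step (fun x y => 1 - rprob q y x i)).
by rewrite -big_split /=; apply: eq_bigr => v _; rewrite /mix -mulrDr.
Qed.

End FixedTarget.
End FibreSums.

(** * Intertwining of the generators *)

Section Intertwining.
Variables (R : realType) (n : nat) (q : R) (a : 'I_n -> R).
Hypotheses (n_gt0 : (1 <= n)%N) (q_gt0 : 0 < q) (q_lt1 : q < 1) (a_gt0 : forall i, 0 < a i).
Implicit Types (v u : pattern n) (z : chamber n).
Notation lam := (level_weight q a).
Notation headweight := (head_weight q a).
Notation rate := (clock_speed a).
Notation e := (evec n).

Lemma fibre_attempt z k u : (1 <= k <= n.*2)%N ->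
  \sum_(v <- fibre z) weight q a v * attempt q k v u =
  headweight u k.-1 * right_paths q a u z (n.*2 - k) k 1 (lam k.-1 (lvl u k.-1)).
Proof.
move=> /andP[k1 kn].
have := fibre_rightward q_gt0 q_lt1 a_gt0 u z 1 (fun=> 1) k1 (subnK kn)
  (fun j _ => lvl0 n j).
rewrite subr0 => h.
transitivity (headweight u k.-1 * right_paths q a u z (n.*2 - k) k 1
   (fun y => lam k.-1 (lvl u k.-1) y * 1)).
  by rewrite -h; apply: eq_bigr => v _; rewrite mulr1 addr0.
by congr (_ * right_paths _ _ _ _ _ _ _ _); apply/funext => y; rewrite mulr1.
Qed.

Definition clocks v u : R := \sum_(0 <= k < n.*2) rate k * attempt q k.+1 v u.
Definition clock_rate : R := \sum_(i < n) (a i + (a i)^-1).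

Lemma berele_rateE v u : berele_rate q a v u = clocks v u - clock_rate * (v == u)%:R.
Proof.
rewrite /berele_rate /clocks /clock_rate sum_double big_mkord mulr_suml -sumrB.
by apply: eq_bigr => l _; rewrite clock_speed_double clock_speed_doubleS; ring.
Qed.

Lemma evec_inj i j : (1 <= i <= n)%N -> (1 <= j <= n)%N -> e i = e j -> i = j.
Proof.
move=> hi hj /(congr1 (fun x : ivec n => ent x j)).
by rewrite !ent_evec // eqxx; case: eqP => // ->.
Qed.

Lemma evec_neqN i j : (1 <= i <= n)%N -> (1 <= j <= n)%N -> e i <> - e j.
Proof.
move=> hi hj /(congr1 (fun x : ivec n => ent x i)).
by rewrite entN !ent_evec // eqxx; case: eqP.
Qed.

(** At most one term is nonzero; the sum is the form in which the path sums produce the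
    rates. *)
Lemma frateE z z' : frate q z z' =
  \sum_(i < n) (right_rate q z i.+1 * ((z' : ivec n) - e i.+1 == z)%:R +
                left_rate q z i.+1 * ((z' : ivec n) + e i.+1 == z)%:R).
Proof.
have eR (i : 'I_n) : ((z' : ivec n) - e i.+1 == z) = ((z' : ivec n) - (z : ivec n) == e i.+1).
  by rewrite subr_eq addrC -subr_eq.
have eL (i : 'I_n) : ((z' : ivec n) + e i.+1 == z) = ((z' : ivec n) - (z : ivec n) == - e i.+1).
  by rewrite -subr_eq0 -[RHS]subr_eq0 opprK addrAC.
have hi (i : 'I_n) : (1 <= i.+1 <= n)%N by have := ltn_ord i.
rewrite (eq_bigr (fun i : 'I_n => right_rate q z i.+1 * ((z' : ivec n) - (z : ivec n) == e i.+1)%:R +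
                left_rate q z i.+1 * ((z' : ivec n) - (z : ivec n) == - e i.+1)%:R)); last first.
  by move=> i _; rewrite eR eL.
rewrite /frate; case: pickP => [i /eqP di|noR].
  rewrite (bigD1 i) //= di eqxx mulr1.
  rewrite (introF eqP (evec_neqN (hi i) (hi i))) mulr0 addr0 big1 ?addr0 // => j ji.
  rewrite (introF eqP (evec_neqN (hi i) (hi j))) mulr0 addr0.
  case: eqP => [/(evec_inj (hi i) (hi j))[ij]|]; last by rewrite mulr0.
  by case/eqP: ji; apply/val_inj.
case: pickP => [i /eqP di|noL].
  rewrite (bigD1 i) //= di eqxx mulr1.
  have N (j : 'I_n) : (- e i.+1 == e j.+1) = false.
    by apply/eqP => h; apply: (evec_neqN (hi j) (hi i)).
  rewrite N mulr0 add0r big1 ?addr0 // => j ji.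
  rewrite N mulr0 add0r.
  case: eqP => [/oppr_inj/(evec_inj (hi i) (hi j))[ij]|]; last by rewrite mulr0.
  by case/eqP: ji; apply/val_inj.
rewrite big1 // => i _; have /= -> := noR i; have /= -> := noL i.
by rewrite !mulr0 addr0.
Qed.

Lemma frate_diag z : frate q z z = 0.
Proof.
rewrite frateE big1 // => i _.
have hi : (1 <= i.+1 <= n)%N by have := ltn_ord i.
have e0 : e i.+1 <> 0.
  move=> /(congr1 (fun x : ivec n => ent x i.+1)); rewrite ent_evec // eqxx ent0 //.
have -> : ((z : ivec n) - e i.+1 == z) = false.
  by apply/eqP => h; apply: e0; apply/eqP; rewrite -oppr_eq0 -(inj_eq (addrI (z : ivec n))) h addr0.
have -> : ((z : ivec n) + e i.+1 == z) = false.
  by apply/eqP => h; apply: e0; apply/eqP; rewrite -(inj_eq (addrI (z : ivec n))) h addr0.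
by rewrite !mulr0 addr0.
Qed.

(** The intertwining before normalization. *)
Theorem weight_intertwining z u :
  \sum_(v <- fibre z) weight q a v * clocks v u =
  frate q z (bottom_row u) * weight q a u.
Proof.
have [hp hl] := pattern_facts u.
transitivity (\sum_(0 <= k < n.*2) rate k * (headweight u k *
    right_paths q a u z (n.*2 - k.+1) k.+1 1 (lam k (lvl u k)))).
  transitivity (\sum_(v <- fibre z) \sum_(0 <= k < n.*2)
      rate k * (weight q a v * attempt q k.+1 v u)).
    by apply: eq_bigr => v _; rewrite mulr_sumr; apply: eq_bigr => k _; ring.
  rewrite exchange_big /=; apply: eq_big_nat => k /andP[_ hk].
  by rewrite -mulr_sumr fibre_attempt.
have z_ch : in_chamber z by case: (z) => x /= /asboolP.
rewrite (clocks_row_flow q_gt0 q_lt1 a_gt0 z_ch hp hl) //.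
by rewrite row_flow_bottom frateE (weightE q_gt0 q_lt1 a_gt0) mulrC.
Qed.

Lemma calPE z : calP q a z = \sum_(v <- fibre z) weight q a v.
Proof.
have E : [set y | bottom_row y = z] = [set` fibre z].
  by apply/seteqP; split=> v /=; rewrite mem_fibre => /eqP.
by rewrite /calP E -fsbig_seq // fibre_uniq.
Qed.

(** Each row is the next one without its first entry. This pattern shows that no fibre is
    empty, hence that calP does not vanish. *)
Definition shifted_array (z : chamber n) : iarray n :=
  [ffun k : 'I_n.*2 => [ffun i : 'I_n => ent z (i.+1 + (n.*2 - k.+1))]].

Lemma ent_shifted_array z k i : (1 <= i)%N -> (1 <= k <= n.*2)%N ->
  ent (lvl (shifted_array z) k) i = ent z (i + (n.*2 - k)).
Proof.
case: k => // k; case: i => // i _ hk; case: (leqP i.+1 n) => hi; last first.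
  by rewrite !ent_out //; lia.
have hk' : (k < n.*2)%N by lia.
by rewrite (lvlE _ (Ordinal hk')) (entE _ (Ordinal hi)) !ffunE.
Qed.

Lemma shifted_array_pattern z : is_pattern (shifted_array z).
Proof.
have z_ch : in_chamber z by case: (z) => x /= /asboolP.
have zd := chamber_decreasing z_ch.
apply/is_patternP; split=> [[|k] hk|[|k] hk].
- by apply/paddedP => i _; rewrite ent0.
- apply/paddedP => i hi; rewrite ent_shifted_array //; last by lia.
  by rewrite ent_out //; have := odd_double_half k.+2; lia.
- by move=> j hj; rewrite ent0 !ent_shifted_array ?ent_out ?lexx //; lia.
- move=> j hj; rewrite !ent_shifted_array //; try lia.
  have -> : (n.*2 - k.+1 = (n.*2 - k.+2).+1)%N by lia.
  rewrite addSnnS lexx addnS; apply: zd; lia.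
Qed.

Lemma calP_gt0 z : 0 < calP q a z.
Proof.
have hp : `[< is_pattern (shifted_array z) >].
  by apply/asboolP; exact: shifted_array_pattern.
pose v : pattern n := Pattern hp.
have hv : v \in fibre z.
  rewrite mem_fibre; apply/eqP/val_inj/ent_eq => i hi /=.
  by rewrite ent_shifted_array ?subnn ?addn0 //; lia.
rewrite calPE (bigD1_seq v) ?fibre_uniq //= ltr_pwDl ?weight_gt0 //.
by apply: sumr_ge0 => u _; exact/ltW/weight_gt0.
Qed.

Lemma Mlaw_fibre z v : v \in fibre z -> Mlaw q a z v = weight q a v / calP q a z.
Proof. by rewrite mem_fibre /Mlaw => ->. Qed.

Lemma Mlaw_ge0 z v : 0 <= Mlaw q a z v.
Proof.
rewrite /Mlaw; case: ifP => // _; rewrite divr_ge0 //; apply/ltW; first exact: weight_gt0.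
exact: calP_gt0.
Qed.

Lemma Mlaw_out z v : bottom_row v != z -> Mlaw q a z v = 0.
Proof. by rewrite /Mlaw => /negbTE ->. Qed.

Lemma sum_Mlaw z : \sum_(v <- fibre z) Mlaw q a z v = 1.
Proof.
under eq_big_seq => v hv do rewrite (Mlaw_fibre hv).
by rewrite -mulr_suml -calPE divff // gt_eqF // calP_gt0.
Qed.

(** On the diagonal the intertwining holds because every clock that rings moves the bottom
    row. *)
Theorem generator_intertwining z u :
  \sum_(v <- fibre z) Mlaw q a z v * berele_rate q a v u =
  Qrate q a z (bottom_row u) * Mlaw q a (bottom_row u) u.
Proof.
have P0 := calP_gt0.
have zP : calP q a z != 0 by rewrite gt_eqF.
have -> : \sum_(v <- fibre z) Mlaw q a z v * berele_rate q a v u =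
    (frate q z (bottom_row u) * weight q a u) / calP q a z - clock_rate * Mlaw q a z u.
  under eq_bigr => v _ do rewrite berele_rateE mulrBr.
  rewrite sumrB -weight_intertwining; congr (_ - _).
    rewrite mulr_suml; apply: eq_big_seq => v hv; rewrite (Mlaw_fibre hv); ring.
  have [uz|uz] := boolP (u \in fibre z).
    rewrite (bigD1_seq u) ?fibre_uniq //= eqxx mulr1 big1 ?addr0 1?mulrC // => v vu.
    by rewrite (negbTE vu) !mulr0.
  rewrite mem_fibre in uz; rewrite Mlaw_out // mulr0 big_seq big1 // => v.
  by rewrite mem_fibre => vz; case: eqP => [vu|]; rewrite ?mulr0 //; rewrite -vu vz in uz.
rewrite /Qrate; have [->|uz] := eqVneq (bottom_row u) z.
  by rewrite frate_diag !mul0r add0r mulNr.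
rewrite Mlaw_out // mulr0 subr0 /Mlaw eqxx; field.
by rewrite zP gt_eqF.
Qed.

End Intertwining.

(** * The dynamics stays among patterns and conserves mass *)

(** Interlacing after a move of particle i of x and the move of y that it triggers. The strict
    inequalities are those that follow from the choice having positive probability. *)
Section LacedMoves.
Variables (n : nat) (x y : ivec n).
Hypothesis xy : interlaced x y.
Variable i : nat.
Hypothesis hi : (1 <= i <= n)%N.
Notation e := (evec n).

Lemma laced_left_same : ent y i.+1 < ent x i -> interlaced (x - e i) (y - e i).
Proof.
move=> h j hj; rewrite !ent_subE //; have /andP[h1 h2] := xy hj.
by case: (j =P i) => [E|_]; case: (j.+1 =P i) => [E'|_]; rewrite ?E ?E' in h1 h2 *; lia.
Qed.

Lemma laced_left_next : (i < n)%N -> ent x i.+1 < ent y i.+1 ->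
  interlaced (x - e i) (y - e i.+1).
Proof.
move=> hin h j hj; rewrite !ent_subE //; have /andP[h1 h2] := xy hj.
by rewrite eqSS; case: (j =P i) => [E|_]; case: (j =P i.+1) => [E'|_]; rewrite ?E ?E' in h1 h2 *; lia.
Qed.

Lemma laced_right_same : ((1 < i)%N -> ent y i < ent x i.-1) ->
  interlaced (x + e i) (y + e i).
Proof.
move=> h j hj; rewrite !ent_addE //; have /andP[h1 h2] := xy hj.
case: (j =P i) => [E|_]; case: (j.+1 =P i) => [E'|_]; try lia.
have h' : ent y i < ent x i.-1 by apply: h; lia.
by move: h'; rewrite -E' /=; lia.
Qed.

Lemma laced_right_next : (i < n)%N -> ent x i < ent y i ->
  interlaced (x + e i) (y + e i.+1).
Proof.
move=> hin h j hj; rewrite !ent_addE //; have /andP[h1 h2] := xy hj.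
by rewrite eqSS; case: (j =P i) => [E|_]; case: (j =P i.+1) => [E'|_]; rewrite ?E ?E' in h1 h2 *; lia.
Qed.

Lemma laced_right_fixed : ent x i < ent y i -> interlaced (x + e i) y.
Proof.
move=> h j hj; rewrite !ent_addE //; have /andP[h1 h2] := xy hj.
by case: (j =P i) => [E|_]; rewrite ?E in h1 h2 *; lia.
Qed.

Lemma laced_right_first : i = 1 -> interlaced x (y + e i).
Proof.
move=> i1 j hj; rewrite !ent_addE //; have /andP[h1 h2] := xy hj.
by case: (j =P i) => [E|_]; case: (j.+1 =P i) => [E'|_]; lia.
Qed.

Lemma laced_stop : ent x i < ent y i -> interlaced x (y - e i).
Proof.
move=> h j hj; rewrite !ent_subE //; have /andP[h1 h2] := xy hj.
by case: (j =P i) => [E|_]; case: (j.+1 =P i) => [E'|_]; rewrite ?E ?E' in h1 h2 *; lia.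
Qed.

End LacedMoves.

Section Conservative.
Variables (R : realType) (n : nat) (q : R) (a : 'I_n -> R).
Hypotheses (n_gt0 : (1 <= n)%N) (q_gt0 : 0 < q) (q_lt1 : q < 1) (a_gt0 : forall i, 0 < a i).
Implicit Types (c d : iarray n).
Notation e := (evec n).

(** Finite support and total mass 1, in a form that is stable under mixtures. *)
Definition finite_law (f : iarray n -> R) := exists s0 : seq (iarray n),
  (forall c, f c != 0 -> c \in s0) /\
  (forall s, uniq s -> {subset s0 <= s} -> \sum_(c <- s) f c = 1).

Lemma finite_law_dirac c : finite_law (dirac_mass R c).
Proof.
exists [:: c]; split=> [c'|s us hs].
  by rewrite /dirac_mass inE [c == c']eq_sym; case: (c' == c) => //=; rewrite eqxx.
have cs : c \in s by apply: hs; rewrite inE.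
rewrite (bigD1_seq c) //= /dirac_mass eqxx big1 ?addr0 // => c' h.
by rewrite eq_sym (negbTE h).
Qed.

Lemma finite_law_mix p f g : finite_law f -> finite_law g -> finite_law (mix p f g).
Proof.
move=> [s0 [f0 f1]] [s1 [g0 g1]]; exists (s0 ++ s1); split=> [c|s us hs].
  rewrite mem_cat; apply: contraNT; rewrite negb_or => /andP[h0 h1].
  rewrite /mix; apply/eqP.
  have -> : f c = 0 by apply/eqP; apply: contraNT h0; apply: f0.
  have -> : g c = 0 by apply/eqP; apply: contraNT h1; apply: g0.
  by rewrite !mulr0 addr0.
rewrite /mix big_split /= -!mulr_sumr f1 ?g1 //; first by ring.
- by move=> c hc; apply: hs; rewrite mem_cat hc orbT.
- by move=> c hc; apply: hs; rewrite mem_cat hc.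
Qed.

Lemma leftward_law v m k i c : finite_law (leftward q v m k i c).
Proof.
elim: m k i c => [|m IHm] k i c /=; first exact: finite_law_dirac.
exact: finite_law_mix.
Qed.

Lemma rightward_law v m k i c : finite_law (rightward q v m k i c).
Proof.
elim: m k i c => [|m IHm] k i c /=; first exact: finite_law_dirac.
by case: ifP => _; apply: finite_law_mix => //; exact: leftward_law.
Qed.

Section FixedSource.
Variable v : pattern n.
Let v_pad k : (k <= n.*2)%N -> padded k (lvl v k).
Proof. by have [hp _] := pattern_facts v; apply: hp. Qed.
Let v_lace k : (k < n.*2)%N -> interlaced (lvl v k) (lvl v k.+1).
Proof. by have [_ hl] := pattern_facts v; apply: hl. Qed.

(** The part of the pattern conditions that is settled by the moves from level k on. *)
Definition laced_from k c := forall j, (k <= j < n.*2)%N ->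
  padded j (lvl c j) /\ interlaced (lvl c j) (lvl c j.+1).

Section Probabilities.
Variables (k : nat) (kn : (k < n.*2)%N).
Let x := lvl v k.
Let y := lvl v k.+1.
Let xy : interlaced x y. Proof. exact: v_lace. Qed.
Let exp_neq1 (m : int) : m != 0 -> 1 - q ^ m != 0.
Proof. by move=> h; rewrite subr_eq0 eq_sym qpow_eq1. Qed.

(** This and the next three lemmas: a choice that would break the interlacing has probability
    0, by the zeros of the numerators and by q^0 = 1. *)
Lemma lprob_neq0 i : (1 <= i)%N -> lprob q y x i != 0 -> ent x i.+1 < ent y i.+1.
Proof.
case: i => // i _ h; have /andP[_ h1] := xy (j := i.+2) isT.
rewrite lt_neqAle h1 andbT; apply: contraNneq h => h2.
by rewrite /lprob /= h2 subrr expr0z subrr mulr0 mul0r.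
Qed.

Lemma lprob_neq1 i : (1 <= i)%N -> ent x i.+1 < ent x i -> 1 - lprob q y x i != 0 ->
  ent y i.+1 < ent x i.
Proof.
case: i => // i _ hx h; have /andP[h1 _] := xy (j := i.+1) isT.
rewrite lt_neqAle h1 andbT; apply: contraNneq h => h2.
rewrite /lprob /= h2 subrr expr0z mul1r divff ?subrr //.
by apply: exp_neq1; rewrite subr_eq0 gt_eqF.
Qed.

Lemma rprob_neq0 i : (1 < i)%N -> rprob q y x i != 0 -> ent y i < ent x i.-1.
Proof.
case: i => // -[|i] // _ h; have /andP[h1 _] := xy (j := i.+1) isT.
rewrite lt_neqAle h1 andbT; apply: contraNneq h => h2.
by rewrite /rprob /= h2 subrr expr0z subrr mulr0 mul0r.
Qed.

Lemma rprob_neq1 i : (1 <= i)%N -> ((1 < i)%N -> ent x i < ent x i.-1) ->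
  1 - rprob q y x i != 0 -> ent x i < ent y i.
Proof.
case: i => // i _ hx h; have /andP[_ h1] := xy (j := i.+1) isT.
rewrite lt_neqAle h1 andbT; apply: contraNneq h => h2.
case: i hx h1 h2 => [|i] hx h1 h2; rewrite /rprob /= h2 subrr expr0z mul1r.
  by rewrite subr0 divr1 subrr.
rewrite -h2 divff ?subrr //.
by apply: exp_neq1; rewrite subr_eq0 gt_eqF // hx.
Qed.

End Probabilities.

Lemma mix_neq0 p (f g : iarray n -> R) c : mix p f g c != 0 ->
  (p != 0 /\ f c != 0) \/ (1 - p != 0 /\ g c != 0).
Proof.
rewrite /mix => h; have [h0|h0] := eqVneq (p * f c) 0.
  right; apply/andP; rewrite -negb_or -mulf_eq0.
  by apply: contraNneq h => h1; rewrite h0 h1 addr0.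
by left; apply/andP; rewrite -negb_or -mulf_eq0.
Qed.

(** The hypothesis that particle i is strictly to the right of particle i.+1 is handed on
    from level to level. *)
Lemma leftward_laced m k i c c' : (1 <= k)%N -> (m + k = n.*2)%N ->
  (forall j, (k <= j)%N -> lvl c j = lvl v j) -> (1 <= i <= (k.+1)./2)%N ->
  ent (lvl v k) i.+1 < ent (lvl v k) i ->
  leftward q v m k i c c' != 0 -> laced_from k c'.
Proof.
elim: m k i c => [|m IHm] k i c k1 mk hc hi hx /=.
  by move=> _ j hj; exfalso; lia.
have hk : (1 <= k <= n.*2)%N by lia.
have kn : (k < n.*2)%N by lia.
have mk' : (m + k.+1 = n.*2)%N by lia.
have hin : (1 <= i <= n)%N by lia.
pose c1 := c - earray n k i.
have hc1 j : (k.+1 <= j)%N -> lvl c1 j = lvl v j.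
  by move=> h; rewrite /c1 lvlD lvlN lvl_earray // (gtn_eqF h) subr0 hc // ltnW.
have c1k : lvl c1 k = lvl v k - e i.
  by rewrite /c1 lvlD lvlN lvl_earray // eqxx hc.
have pk : padded k (lvl v k - e i) by apply: padded_sub => //; [apply: v_pad; lia|lia].
have xy := v_lace kn.
have key i' : (1 <= i' <= (k.+2)./2)%N ->
    ent (lvl v k.+1) i'.+1 < ent (lvl v k.+1) i' ->
    interlaced (lvl v k - e i) (lvl v k.+1 - e i') ->
    leftward q v m k.+1 i' c1 c' != 0 -> laced_from k c'.
  move=> hi' hy hl h j /andP[kj jn].
  have [h1 h2] := leftward_head (isT : (0 < k.+1)%N) mk' h.
  move: kj; rewrite leq_eqVlt => /orP[/eqP <-|kj].
    by rewrite h2 -h1 // c1k hc1.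
  by apply: (IHm k.+1 i' c1) => //; rewrite kj.
rewrite -/c1 => /mix_neq0[[p h]|[p h]].
  have hx' := lprob_neq0 kn (proj1 (andP hi)) p.
  have hi' : (1 <= i.+1 <= (k.+2)./2)%N.
    rewrite /= leqNgt; apply/negP => hlt.
    rewrite (paddedP _ _ (v_pad kn) i.+1) // in hx'.
    rewrite (paddedP _ _ (v_pad (ltnW kn)) i.+1) ?ltxx // in hx'.
    by move: hlt; rewrite /= uphalf_half; lia.
  apply: (key i.+1) => //.
    by have /andP[] := xy i.+1 isT; lia.
  by apply: laced_left_next => //; lia.
have hx' := lprob_neq1 kn (proj1 (andP hi)) hx p.
apply: (key i) => //; first by move: hi; rewrite /= uphalf_half; lia.
  by have /andP[] := xy i (proj1 (andP hi)); lia.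
exact: laced_left_same.
Qed.

(** The hypothesis that particle i is strictly to the left of particle i.-1 is handed on from
    level to level; a suppressed jump turns it into the hypothesis of [leftward_laced]. *)
Lemma rightward_laced m k i c c' : (1 <= k)%N -> (m + k = n.*2)%N ->
  (forall j, (k <= j)%N -> lvl c j = lvl v j) -> (1 <= i <= (k.+1)./2)%N ->
  ((1 < i)%N -> ent (lvl v k) i < ent (lvl v k) i.-1) ->
  rightward q v m k i c c' != 0 -> laced_from k c'.
Proof.
elim: m k i c => [|m IHm] k i c k1 mk hc hi hx /=.
  by move=> _ j hj; exfalso; lia.
have hk : (1 <= k <= n.*2)%N by lia.
have kn : (k < n.*2)%N by lia.
have mk' : (m + k.+1 = n.*2)%N by lia.
have hin : (1 <= i <= n)%N by lia.
pose c1 := c + earray n k i.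
have hc1 j : (k.+1 <= j)%N -> lvl c1 j = lvl v j.
  by move=> h; rewrite /c1 lvlD lvl_earray // (gtn_eqF h) addr0 hc // ltnW.
have c1k : lvl c1 k = lvl v k + e i by rewrite /c1 lvlD lvl_earray // eqxx hc.
have pk : padded k (lvl v k + e i) by apply: padded_add => //; [apply: v_pad; lia|lia].
have xy := v_lace kn.
have key i' : (1 <= i' <= (k.+2)./2)%N ->
    ((1 < i')%N -> ent (lvl v k.+1) i' < ent (lvl v k.+1) i'.-1) ->
    interlaced (lvl v k + e i) (lvl v k.+1 + e i') ->
    (odd k.+1 -> i' = (k.+2)./2 -> interlaced (lvl v k + e i) (lvl v k.+1)) ->
    rightward q v m k.+1 i' c1 c' != 0 -> laced_from k c'.
  move=> hi' hy hl hl' h j /andP[kj jn].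
  have h1 := rightward_head (isT : (0 < k.+1)%N) mk' h.
  have h2 := rightward_head_level (isT : (0 < k.+1)%N) mk' h.
  move: kj; rewrite leq_eqVlt => /orP[/eqP <-|kj].
    rewrite -h1 // c1k; split=> //.
    by case: h2 => [->|[h3 h4 ->]]; rewrite hc1 //; exact: hl'.
  by apply: (IHm k.+1 i' c1) => //; rewrite kj.
have right_same : rprob q (lvl v k.+1) (lvl v k) i != 0 ->
    rightward q v m k.+1 i c1 c' != 0 -> laced_from k c'.
  move=> p h; have hy : (1 < i)%N -> ent (lvl v k.+1) i < ent (lvl v k) i.-1.
    by move=> i1; exact: rprob_neq0 p.
  apply: (key i) => //; first by move: hi; rewrite /= uphalf_half; lia.
  - by move=> i1; have /andP[_] := xy i.-1 (ltac:(lia)); apply: lt_le_trans; exact: hy.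
  - exact: laced_right_same.
  - by move=> /= ko ik; move: hi; rewrite ik /= uphalf_half (negbTE ko); lia.
rewrite -/c1; case: ifP => [/andP[ko /eqP ik]|last] /mix_neq0[[p h]|[p h]].
- exact: right_same p h.
- have hx' := rprob_neq1 kn (proj1 (andP hi)) hx p.
  have [h1 h2] := leftward_head (isT : (0 < k.+1)%N) mk' h.
  move=> j /andP[kj jn]; move: kj; rewrite leq_eqVlt => /orP[/eqP <-|kj].
    rewrite h2 -h1 // !hc //; split; first by apply: v_pad; lia.
    exact: laced_stop.
  apply: (leftward_laced (isT : (0 < k.+1)%N) mk' _ _ _ h) => //; last by rewrite kj.
  + by move=> j' hj'; apply: hc; exact: ltnW.
  + by move: hi; rewrite /= uphalf_half; lia.
  + by have /andP[] := xy i (proj1 (andP hi)); lia.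
- exact: right_same p h.
- have hx' := rprob_neq1 kn (proj1 (andP hi)) hx p.
  have hin' : (1 <= i.+1 <= (k.+2)./2)%N.
    move: hi last; rewrite /= uphalf_half; case: (boolP (odd k)) => /= ko; last by lia.
    by move=> h1 /negbT h2; lia.
  apply: (key i.+1) => //.
  + by move=> _ /=; have /andP[] := xy i (proj1 (andP hi)); lia.
  + by apply: laced_right_next => //; lia.
  + move=> _ _; exact: laced_right_fixed.
Qed.

Lemma attempt_pattern k c' : (1 <= k <= n.*2)%N ->
  rightward q v (n.*2 - k) k 1 v c' != 0 -> is_pattern c'.
Proof.
move=> /andP[k1 kn] h; have mk := subnK kn.
have h1 := rightward_head k1 mk h.
have h2 := rightward_head_level k1 mk h.
have h3 : laced_from k c'.
  have hk1 : (1 <= 1 <= (k.+1)./2)%N by case: (k) k1.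
  by apply: (rightward_laced k1 mk _ hk1 _ h).
have hj j : (j < n.*2)%N -> padded j (lvl c' j) /\ interlaced (lvl c' j) (lvl c' j.+1).
  move=> hj; case: (ltnP j k) => jk; last by apply: h3; rewrite jk.
  rewrite -h1 //; split; first exact/v_pad/ltnW.
  case: (ltngtP j.+1 k) => [jk1|jk1|jk1].
  - by rewrite -h1 //; exact: v_lace.
  - by lia.
  - rewrite jk1; have xy := v_lace hj; rewrite jk1 in xy.
    by case: h2 => [->|[_ _ ->]] //; apply: laced_right_first.
apply/is_patternP; split=> j; last by case/hj.
rewrite leq_eqVlt => /orP[/eqP ->|/hj[] //].
by apply/paddedP => i hi; apply: ent_out; move: hi; rewrite /= uphalf_double.
Qed.

Lemma attempt_row k : (1 <= k <= n.*2)%N -> exists F0 : seq (pattern n),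
  forall F, uniq F -> {subset F0 <= F} ->
    (forall u, u \notin F -> attempt q k v u = 0) /\ \sum_(u <- F) attempt q k v u = 1.
Proof.
move=> hk; have [s0 [h0 h1]] := rightward_law v (n.*2 - k) k 1 v.
exists (pmap insub s0) => F uF hF.
have hin (u : pattern n) : attempt q k v u != 0 -> u \in F.
  by move=> /h0 us; apply: hF; rewrite mem_pmap_sub.
split=> [u|]; first by move=> uF'; apply/eqP; apply: contraNT uF'; exact: hin.
pose s := undup (s0 ++ map val F).
have us : uniq s by exact: undup_uniq.
rewrite -(h1 s us) => [|c cs]; last by rewrite mem_undup mem_cat cs.
rewrite [RHS](bigID [pred c | c \in map val F]) /= [X in _ = _ + X]big1 ?addr0.
  rewrite -[RHS]big_filter; transitivity (\sum_(c <- map val F) rightward q v (n.*2 - k) k 1 v c).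
    by rewrite big_map.
  apply: perm_big; apply: uniq_perm; rewrite ?filter_uniq //.
    by rewrite map_inj_uniq //; exact: val_inj.
  by move=> c; rewrite mem_filter mem_undup mem_cat /=; case: (c \in map val F); rewrite ?orbT.
move=> c cF; apply/eqP; apply: contraNT cF => hc.
have cp : `[< is_pattern c >] by apply/asboolP; exact: attempt_pattern hc.
by apply/mapP; exists (Pattern cp) => //; apply: hin.
Qed.

(** Finitely many targets, and conservation of mass. *)
Theorem berele_row : exists F : seq (pattern n),
  [/\ uniq F, v \in F, forall u, u \notin F -> berele_rate q a v u = 0 &
      \sum_(u <- F) berele_rate q a v u = 0].
Proof.
have [F0 hF0] : exists F0 : seq (pattern n), forall F, uniq F -> {subset F0 <= F} ->
    forall k, (k < n.*2)%N -> (forall u, u \notin F -> attempt q k.+1 v u = 0) /\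
      \sum_(u <- F) attempt q k.+1 v u = 1.
  have : forall m, (m <= n.*2)%N -> exists F0 : seq (pattern n),
      forall F, uniq F -> {subset F0 <= F} ->
      forall k, (k < m)%N -> (forall u, u \notin F -> attempt q k.+1 v u = 0) /\
        \sum_(u <- F) attempt q k.+1 v u = 1; last by apply.
  elim=> [|m IHm] hm; first by exists [::].
  have [F1 h1] := IHm (ltnW hm).
  have [F2 h2] := @attempt_row m.+1 hm.
  exists (F1 ++ F2) => F uF hF k; rewrite ltnS leq_eqVlt => /orP[/eqP ->|hk].
    by apply: h2 => // u hu; apply: hF; rewrite mem_cat hu orbT.
  by apply: h1 => // u hu; apply: hF; rewrite mem_cat hu.
pose F := undup (v :: F0).
have vF : v \in F by rewrite mem_undup mem_head.
have hF k : (k < n.*2)%N -> (forall u, u \notin F -> attempt q k.+1 v u = 0) /\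
      \sum_(u <- F) attempt q k.+1 v u = 1.
  apply: hF0; first exact: undup_uniq.
  by move=> u hu; rewrite mem_undup inE hu orbT.
exists F; split=> //; first exact: undup_uniq.
- move=> u uF; rewrite berele_rateE /clocks big_nat big1 ?sub0r => [|k /andP[_ hk]].
    by case: eqP => [vu|]; rewrite ?mulr0 ?oppr0 // -vu vF in uF *.
  by have [-> //] := hF k hk; rewrite mulr0.
- under eq_bigr => u _ do rewrite berele_rateE.
  rewrite sumrB exchange_big /= -mulr_sumr.
  rewrite (bigD1_seq v) ?undup_uniq //= eqxx [X in _ - _ * (1 + X)]big1 ?addr0; last first.
    by move=> u uv; rewrite eq_sym (negbTE uv).
  rewrite mulr1; apply/eqP; rewrite subr_eq0; apply/eqP.
  transitivity (\sum_(0 <= k < n.*2) clock_speed a k).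
    apply: eq_big_nat => k /andP[_ hk]; rewrite -mulr_sumr.
    by have [_ ->] := hF k hk; rewrite mulr1.
  rewrite sum_double big_mkord; apply: eq_bigr => l _.
  by rewrite clock_speed_double clock_speed_doubleS.
Qed.

End FixedSource.
End Conservative.

(** * Nonnegative sums and transition functions *)

Section NonnegativeSums.
Variables (R : realType) (S : choiceType).
Implicit Types f : S -> \bar R.
Local Open Scope ereal_scope.

Lemma esum_seq (r : seq S) f : uniq r -> (forall x, 0 <= f x) ->
  \esum_(x in [set` r]) f x = \sum_(x <- r) f x.
Proof.
move=> ur f0; rewrite esum_fset // -fsbig_seq //.
Qed.

Let esumZ_le (c : R) f : (0 <= c)%R -> (forall x, 0 <= f x) ->
  \esum_(x in [set: S]) (c%:E * f x) <= c%:E * \esum_(x in [set: S]) f x.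
Proof.
move=> c0 f0; apply: ge_ereal_sup => _ [X [finX _] <-].
rewrite -ge0_mule_fsumr // lee_wpmul2l ?lee_fin //.
by apply: ereal_sup_ubound; exists X.
Qed.

Lemma esumZ (c : R) f : (0 <= c)%R -> (forall x, 0 <= f x) ->
  \esum_(x in [set: S]) (c%:E * f x) = c%:E * \esum_(x in [set: S]) f x.
Proof.
move=> c0 f0; apply/eqP; rewrite eq_le esumZ_le //=.
have [->|cN0] := eqVneq c 0%R.
  by rewrite mul0e; apply: esum_ge0 => x _; rewrite mul0e.
have cp : (0 < c)%R by rewrite lt0r cN0.
have g0 x : 0 <= c%:E * f x by rewrite mule_ge0 ?lee_fin.
have ci : (0 <= c^-1)%R by rewrite invr_ge0.
have := esumZ_le ci g0.
under eq_esum => x _ do rewrite muleA -EFinM mulVf // mul1e.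
move=> h; have := lee_wpmul2l (_ : 0 <= c%:E) h; rewrite lee_fin => /(_ c0).
by rewrite muleA -EFinM mulfV // mul1e.
Qed.

Variables (T : choiceType) (phi : S -> T) (fib : T -> seq S).
Hypotheses (fib_uniq : forall z, uniq (fib z)).
Hypothesis mem_fib : forall z x, (x \in fib z) = (phi x == z).

(** Summation by fibres of phi. *)
Lemma esum_fibres f : (forall x, 0 <= f x) ->
  \esum_(x in [set: S]) f x = \esum_(z in [set: T]) \sum_(x <- fib z) f x.
Proof.
move=> f0.
rewrite (eq_esum (b := fun z => \esum_(x in [set x | phi x = z]) f x)); last first.
  move=> z _; rewrite -esum_seq //; congr esum.
  by apply/seteqP; split=> x /=; rewrite mem_fib => /eqP.
rewrite esum_esum //.
rewrite (reindex_esum [set: S] _ (fun x => (phi x, x))) //=.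
split=> [x _ //=|x y _ _ [] //|[z x] [_ /= <-]].
by exists x.
Qed.

End NonnegativeSums.

Section TransitionFunctions.
Variables (R : realType) (S : choiceType) (p : R -> S -> S -> R).
Hypothesis tf : transition_function p.

Lemma tf_sum_le1 t x F : 0 <= t -> uniq F -> \sum_(y <- F) p t x y <= 1.
Proof.
move=> t0 uF; rewrite -lee_fin -(tf_mass1 tf x t0) -sumEFin.
rewrite -esum_seq //; last by move=> y; rewrite lee_fin (tf_ge0 tf).
rewrite (esumID [set` F] [set: S]) ?setTI //; last by move=> y _; rewrite lee_fin (tf_ge0 tf).
by rewrite leeDl // esum_ge0 // => y _; rewrite lee_fin (tf_ge0 tf).
Qed.

Lemma tf_le1 t x y : 0 <= t -> p t x y <= 1.
Proof.
by move=> t0; have := @tf_sum_le1 t x [:: y] t0 isT; rewrite big_seq1.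
Qed.

(** Chapman-Kolmogorov restricted to a finite set F of intermediate states: what is left out
    is at most the probability of not being in F. *)
Lemma tf_split s t x y F : 0 <= s -> 0 <= t -> uniq F ->
  \sum_(u <- F) p s x u * p t u y <= p (s + t) x y <=
  \sum_(u <- F) p s x u * p t u y + (1 - \sum_(u <- F) p s x u).
Proof.
move=> s0 t0 uF.
have g0 u : (0 <= (p s x u * p t u y)%:E)%E by rewrite lee_fin mulr_ge0 ?(tf_ge0 tf).
have h0 u : (0 <= (p s x u)%:E)%E by rewrite lee_fin (tf_ge0 tf).
have E := tf_chapman_kolmogorov tf x y s0 t0.
rewrite (esumID [set` F]) ?setTI // esum_seq // sumEFin in E.
have M := tf_mass1 tf x s0.
rewrite (esumID [set` F]) ?setTI // esum_seq // sumEFin in M.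
set A := (\esum_(i in _) _)%E in E; set B := (\esum_(i in _) _)%E in M.
have A0 : (0 <= A)%E by exact: esum_ge0.
have AB : (A <= B)%E.
  by apply: le_esum => u _; rewrite lee_fin ler_piMr ?(tf_ge0 tf) ?tf_le1.
apply/andP; split; first by rewrite -lee_fin E leeDl.
have BE : B = (1 - \sum_(u <- F) p s x u)%:E.
  by rewrite EFinB -M addeAC -EFinB subrr add0e.
by rewrite -lee_fin E EFinD leeD2l // -BE.
Qed.

End TransitionFunctions.

(** * The backward equation *)

Section RightLimits.
Variable R : realType.

Lemma at_right0P (P : R -> Prop) : (\forall h \near 0^'+, P h) ->
  exists2 dl : R, 0 < dl & forall h, 0 < h -> h < dl -> P h.
Proof.
move=> /nbhs_ballP[dl /= dl0 hdl]; exists dl => // h h0 hd.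
have hb : ball (0 : R) dl h by rewrite -ball_normE /= sub0r normrN gtr0_norm.
exact: hdl hb h0.
Qed.

Lemma rates_uniform (S : choiceType) (p : R -> S -> S -> R) (Q : S -> S -> R) x F ep :
  has_rates p Q -> 0 < ep ->
  exists2 dl : R, 0 < dl & forall h, 0 < h -> h < dl ->
    \sum_(u <- F) `|p h x u - (x == u)%:R - h * Q x u| <= ep * h.
Proof.
move=> hr; elim: F ep => [|u F IHF] ep ep0.
  by exists 1 => // h h0 _; rewrite big_nil mulr_ge0 // ltW.
have ep2 : 0 < ep / 2 by rewrite divr_gt0.
have [d1 d10 h1] := IHF _ ep2.
have /cvgrPdist_le/(_ _ ep2)/at_right0P[d2 d20 h2] := hr x u.
exists (Num.min d1 d2); first by rewrite lt_min d10.
move=> h h0; rewrite lt_min => /andP[hd1 hd2]; rewrite big_cons.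
have -> : ep * h = ep / 2 * h + ep / 2 * h by field.
apply: lerD; last exact: h1.
have hN0 : h != 0 by rewrite gt_eqF.
have -> : p h x u - (x == u)%:R - h * Q x u = - (h * (Q x u - (p h x u - (x == u)%:R) / h)).
  by field.
by rewrite normrN normrM gtr0_norm // mulrC ler_pM2r // h2.
Qed.

End RightLimits.

Section BackwardEquation.
Variables (R : realType) (S : choiceType) (p : R -> S -> S -> R) (Q : S -> S -> R).
Hypotheses (tf : transition_function p) (hr : has_rates p Q).

(** Uniform in t and y, because only finitely many rates out of x enter: as these sum to 0,
    the process is outside F at time h with probability o(h). *)
Lemma backward_estimate x F ep : uniq F -> x \in F ->
  \sum_(u <- F) Q x u = 0 -> 0 < ep ->
  exists2 dl : R, 0 < dl & forall h t y, 0 < h -> h < dl -> 0 <= t ->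
    `|p (h + t) x y - p t x y - h * \sum_(u <- F) Q x u * p t u y| <= ep * h.
Proof.
move=> uF xF Q0 ep0.
have ep2 : 0 < ep / 2 by rewrite divr_gt0.
have [dl dl0 hdl] := rates_uniform x F hr ep2.
exists dl => // h t y h0 hd t0.
have {hdl} := hdl h h0 hd; set E := \sum_(u <- F) _ => hE.
have /andP[lo up] := tf_split tf x y (ltW h0) t0 uF.
have xE : p t x y = \sum_(u <- F) (x == u)%:R * p t u y.
  rewrite (bigD1_seq x) //= eqxx mul1r big1 ?addr0 // => u ux.
  by rewrite eq_sym (negbTE ux) mul0r.
have oneE : 1 = \sum_(u <- F) (x == u)%:R :> R.
  rewrite (bigD1_seq x) //= eqxx big1 ?addr0 // => u ux.
  by rewrite eq_sym (negbTE ux).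
set A := \sum_(u <- F) p h x u * p t u y in lo up.
set B := 1 - _ in up.
have hA : `|A - p t x y - h * \sum_(u <- F) Q x u * p t u y| <= E.
  rewrite {1}xE /A mulr_sumr -sumrB -sumrB; apply: (le_trans (ler_norm_sum _ _ _)).
  apply: ler_sum => u _.
  have -> : p h x u * p t u y - (x == u)%:R * p t u y - h * (Q x u * p t u y) =
    (p h x u - (x == u)%:R - h * Q x u) * p t u y by ring.
  rewrite normrM ler_piMr // ger0_norm ?(tf_ge0 tf) //; exact: tf_le1.
have hB : B <= E.
  have -> : B = - \sum_(u <- F) (p h x u - (x == u)%:R - h * Q x u).
    by rewrite !sumrB -mulr_sumr Q0 mulr0 subr0 -oneE opprB.
  by apply: (le_trans (ler_norm _)); rewrite normrN; exact: ler_norm_sum.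
have : `|p (h + t) x y - A| <= E.
  by rewrite ger0_norm ?subr_ge0 // lerBlDl (le_trans up) // lerD2l.
move: hA; set W := \sum_(u <- F) _ => hA hA'.
have -> : p (h + t) x y - p t x y - h * W = (p (h + t) x y - A) + (A - p t x y - h * W).
  by ring.
apply: (le_trans (ler_normD _ _)); apply: (le_trans (lerD hA' hA)).
have -> : ep * h = ep / 2 * h + ep / 2 * h by field.
exact: lerD.
Qed.

End BackwardEquation.

Section BoundedSolutions.
Variables (R : realType) (T : Type) (N : T -> seq T) (Q : T -> T -> R) (C : R).
Hypothesis C_gt0 : 0 < C.
Hypothesis Q_bounded : forall z, \sum_(z' <- N z) `|Q z z'| <= C.

(** The equation dD/dt = Q D as a statement on increments over short time intervals, uniform
    in the time; N z contains the states that z can jump to. *)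
Definition backward_solution (D : R -> T -> R) : Prop :=
  forall z ep, 0 < ep -> exists2 dl : R, 0 < dl & forall h t, 0 < h -> h < dl -> 0 <= t ->
    `|D (h + t) z - D t z - h * \sum_(z' <- N z) Q z z' * D t z'| <= ep * h.

(** The mean value inequality: cut the interval into short pieces. *)
Lemma backward_growth D (K T0 : R) : backward_solution D -> (forall z, D 0 z = 0) ->
  (forall t z, 0 <= t -> t <= T0 -> `|D t z| <= K) ->
  forall t z, 0 <= t -> t <= T0 -> `|D t z| <= C * K * t.
Proof.
move=> hD D0 DK t z t0 tT.
have K0 : 0 <= K by apply: le_trans (DK 0 z _ _); rewrite ?lexx // (le_trans t0).
have [->|tN0] := eqVneq t 0; first by rewrite D0 normr0 mulr0.
have tp : 0 < t by rewrite lt0r tN0.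
apply/ler_addgt0Pr => ep ep0.
have ept : 0 < ep / t by rewrite divr_gt0.
have [dl dl0 hdl] := hD z (ep / t) ept.
have [m hm] : exists m : nat, t / m.+1%:R < dl.
  exists (Num.truncn (t / dl)); rewrite ltr_pdivrMr ?ltr0n // mulrC -ltr_pdivrMr //.
  by rewrite truncnS_gt.
set h := t / m.+1%:R in hm.
have h0 : 0 < h by rewrite divr_gt0 ?ltr0n.
have htE : h * m.+1%:R = t by rewrite /h divfK // pnatr_eq0.
have step j : (j <= m.+1)%N -> `|D (h * j%:R) z| <= (h * j%:R) * (C * K + ep / t).
  elim: j => [|j IHj] hj; first by rewrite !mulr0 D0 normr0 mul0r.
  have hj0 : 0 <= h * j%:R by rewrite mulr_ge0 ?ler0n // ltW.
  have hjT : h * j%:R <= T0.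
    by apply: le_trans tT; rewrite -htE ler_pM2l // ler_nat ltnW.
  have := hdl h (h * j%:R) h0 hm hj0.
  have -> : h + h * j%:R = h * j.+1%:R by rewrite -natr1; ring.
  set W := \sum_(z' <- _) _ => hW.
  have WK : `|W| <= C * K.
    apply: (le_trans (ler_norm_sum _ _ _)); apply: (le_trans (y := \sum_(z' <- N z) `|Q z z'| * K)).
      by apply: ler_sum => z' _; rewrite normrM ler_wpM2l // DK.
    by rewrite -mulr_suml ler_wpM2r.
  have -> : D (h * j.+1%:R) z = (D (h * j.+1%:R) z - D (h * j%:R) z - h * W) +
     (D (h * j%:R) z + h * W) by ring.
  apply: (le_trans (ler_normD _ _)).
  have -> : h * j.+1%:R * (C * K + ep / t) = ep / t * h + (h * j%:R * (C * K + ep / t) + h * (C * K)).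
    by rewrite -natr1; ring.
  apply: lerD => //; apply: (le_trans (ler_normD _ _)); apply: lerD; first exact/IHj/ltnW.
  by rewrite normrM gtr0_norm // ler_pM2l.
have := step m.+1 (leqnn _); rewrite htE => /le_trans; apply.
by rewrite mulrDr [t * (ep / t)]mulrC divfK // mulrC.
Qed.

(** On an interval of length 1 / (2 * C) the growth estimate halves any bound of D, so D
    vanishes there; then start again from the end of the interval. *)
Lemma backward_unique D (K : R) : backward_solution D -> (forall z, D 0 z = 0) ->
  (forall t z, 0 <= t -> `|D t z| <= K) -> forall t z, 0 <= t -> D t z = 0.
Proof.
move=> hD D0 DK.
pose T0 := (2 * C)^-1; have T00 : 0 < T0 by rewrite invr_gt0 mulr_gt0.
have local E : backward_solution E -> (forall z, E 0 z = 0) ->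
    (forall t z, 0 <= t -> `|E t z| <= K) -> forall t z, 0 <= t -> t <= T0 -> E t z = 0.
  move=> hE E0 EK t z t0 tT.
  have half m : forall t z, 0 <= t -> t <= T0 -> `|E t z| <= K / 2 ^+ m.
    elim: m => [|m IHm] t' z' t0' tT'; first by rewrite expr0 divr1 EK.
    have K0 : 0 <= K / 2 ^+ m by apply: le_trans (IHm 0 z' _ _); rewrite ?lexx // ltW.
    apply: (le_trans (backward_growth hE E0 IHm z' t0' tT')).
    apply: (le_trans (ler_wpM2l (mulr_ge0 (ltW C_gt0) K0) tT')).
    have C0 : C != 0 by rewrite gt_eqF.
    have pow0 : (2 : R) ^+ m != 0 by rewrite expf_neq0.
    rewrite /T0 exprS (_ : C * (K / 2 ^+ m) * (2 * C)^-1 = K / (2 * 2 ^+ m)) //.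
    by field; rewrite C0 pow0.

  apply/eqP; rewrite -normr_le0; apply/ler_addgt0Pr => ep ep0; rewrite add0r.
  have [m hm] : exists m : nat, K / 2 ^+ m <= ep.
    exists (Num.truncn (K / ep)); rewrite ler_pdivrMr ?exprn_gt0 // mulrC -ler_pdivrMr //.
    apply: (le_trans (ltW (truncnS_gt _))); rewrite -natrX ler_nat; exact: ltn_expl.
  exact: le_trans (half m t z t0 tT) hm.
have blocks m : forall t z, 0 <= t -> t <= T0 * m%:R -> D t z = 0.
  elim: m => [|m IHm] t z t0 tT.
    by have -> : t = 0 by apply/eqP; rewrite eq_le t0 andbT -(mulr0 T0).
  case: (leP t (T0 * m%:R)) => ht; first exact: IHm.
  have Tm : 0 <= T0 * m%:R by rewrite mulr_ge0 ?ler0n // ltW.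
  pose E s z := D (s + T0 * m%:R) z.
  have -> : D t z = E (t - T0 * m%:R) z by rewrite /E subrK.
  apply: local.
  - move=> z' ep ep0; have [dl dl0 hdl] := hD z' ep ep0; exists dl => // h s h0 hd s0.
    by rewrite /E -[h + s + _]addrA; apply: hdl => //; rewrite addr_ge0.
  - by move=> z'; rewrite /E add0r IHm.
  - by move=> s z' s0; rewrite DK // addr_ge0.
  - by rewrite subr_ge0 ltW.
  - by rewrite lerBlDr; move: tT; rewrite -natr1 mulrDr mulr1 addrC.
move=> t z t0; apply: (blocks (Num.truncn (t / T0)).+1) => //.
by rewrite mulrC -ler_pdivrMr // ltW // truncnS_gt.
Qed.

Lemma backward_solution_sum (I : Type) (r : seq I) (c : I -> R) (D : I -> R -> T -> R) :
  (forall i, backward_solution (D i)) ->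
  backward_solution (fun t z => \sum_(i <- r) c i * D i t z).
Proof.
move=> hD z; elim: r => [|i r IHr] ep ep0.
  exists 1 => // h t h0 _ t0; rewrite !big_nil subrr sub0r big1; last by move=> *; rewrite big_nil mulr0.
  by rewrite mulr0 oppr0 normr0 mulr_ge0 // ltW.
have ep2 : 0 < ep / 2 by rewrite divr_gt0.
have [d1 d10 h1] := IHr _ ep2.
pose b := `|c i| + 1; have b0 : 0 < b by rewrite ltr_wpDl.
have epb : 0 < ep / 2 / b by rewrite divr_gt0.
have [d2 d20 h2] := hD i z _ epb.
exists (Num.min d1 d2); first by rewrite lt_min d10.
move=> h t h0; rewrite lt_min => /andP[hd1 hd2] t0.
have {h1} := h1 h t h0 hd1 t0; have {h2} := h2 h t h0 hd2 t0.
set A := \sum_(_ <- N z) Q z _ * D i t _; set B := \sum_(_ <- N z) _.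
have -> : \sum_(z' <- N z) Q z z' * (\sum_(j <- i :: r) c j * D j t z') = c i * A + B.
  rewrite /A mulr_sumr -big_split; apply: eq_bigr => z' _.
  by rewrite big_cons /=; ring.
rewrite !big_cons.
set U := \sum_(_ <- r) c _ * D _ (h + t) z; set V := \sum_(_ <- r) c _ * D _ t z.
move=> h2 h1.
have -> : c i * D i (h + t) z + U - (c i * D i t z + V) - h * (c i * A + B) =
  c i * (D i (h + t) z - D i t z - h * A) + (U - V - h * B) by ring.
apply: (le_trans (ler_normD _ _)).
have -> : ep * h = ep / 2 * h + ep / 2 * h by field.
apply: lerD => //; rewrite normrM.
apply: (le_trans (ler_wpM2l (normr_ge0 _) h2)).
rewrite mulrA ler_pM2r // mulrCA -[leRHS]mulr1 ler_pM2l // ler_pdivrMr // mul1r.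
by rewrite lerDl.
Qed.

End BoundedSolutions.

(** * Lumping a transition function *)

Section Lumping.
Variables (R : realType) (S T : choiceType) (phi : S -> T) (fib : T -> seq S).
Hypotheses (fib_uniq : forall z, uniq (fib z)).
Hypothesis mem_fib : forall z x, (x \in fib z) = (phi x == z).

Lemma sum_fibres (F : seq S) (N : seq T) (g : S -> R) : uniq F -> uniq N ->
  (forall u, u \in F -> phi u \in N) -> (forall u, u \notin F -> g u = 0) ->
  \sum_(z <- N) \sum_(u <- fib z) g u = \sum_(u <- F) g u.
Proof.
move=> uF uN FN gF.
transitivity (\sum_(u <- F) \sum_(z <- N) (if phi u == z then g u else 0)); last first.
  apply: eq_big_seq => u uF'; rewrite (bigD1_seq (phi u)) ?FN //= eqxx big1 ?addr0 // => z zu.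
  by rewrite eq_sym (negbTE zu).
rewrite exchange_big /=; apply: eq_bigr => z _.
rewrite -big_mkcond -[RHS]big_filter [LHS](bigID [pred u | u \in F]) /= [X in _ + X]big1 ?addr0.
  rewrite -[LHS]big_filter; apply: perm_big; apply: uniq_perm; rewrite ?filter_uniq // => u.
  by rewrite !mem_filter mem_fib andbC.
by move=> u; exact: gF.
Qed.

Variables (M : T -> S -> R) (Q : S -> S -> R) (Qh : T -> T -> R) (F : S -> seq S) (c : R).
Hypotheses (M_ge0 : forall z x, 0 <= M z x) (M_out : forall z x, phi x != z -> M z x = 0).
Hypothesis sum_M : forall z, \sum_(x <- fib z) M z x = 1.
Hypotheses (F_uniq : forall x, uniq (F x)) (F_self : forall x, x \in F x).
Hypothesis Q_out : forall x u, u \notin F x -> Q x u = 0.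
Hypothesis Q_conservative : forall x, \sum_(u <- F x) Q x u = 0.
Hypothesis Q_intertwine : forall z u,
  \sum_(x <- fib z) M z x * Q x u = Qh z (phi u) * M (phi u) u.
Hypotheses (c_gt0 : 0 < c) (Qh_diag : forall z, - c <= Qh z z).
Variable p : R -> S -> S -> R.
Hypotheses (tf : transition_function p) (hr : has_rates p Q).

Definition targets z : seq T := undup [seq phi u | u <- flatten [seq F x | x <- fib z]].

Lemma mem_targets z x u : phi x = z -> u \in F x -> phi u \in targets z.
Proof.
move=> xz uF; rewrite mem_undup; apply: map_f; apply/flattenP; exists (F x) => //.
by apply: map_f; rewrite mem_fib xz.
Qed.

(** Averaging Q over a fibre gives the operator Qh applied to the fibre averages. *)
Lemma lump_generator z (g : S -> R) :
  \sum_(x <- fib z) M z x * (\sum_(u <- F x) Q x u * g u) =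
  \sum_(z' <- targets z) Qh z z' * (\sum_(u <- fib z') M z' u * g u).
Proof.
transitivity (\sum_(z' <- targets z) \sum_(u <- fib z') \sum_(x <- fib z)
    M z x * Q x u * g u).
  under [RHS]eq_bigr => z' _ do rewrite exchange_big /=.
  rewrite exchange_big /=; apply: eq_big_seq => x; rewrite mem_fib => /eqP xz.
  rewrite (@sum_fibres (F x)) ?undup_uniq //.
  - by rewrite mulr_sumr; apply: eq_bigr => u _; rewrite mulrA.
  - by move=> u; exact: mem_targets.
  - by move=> u /Q_out ->; rewrite mulr0 mul0r.
apply: eq_bigr => z' _; rewrite mulr_sumr; apply: eq_big_seq => u; rewrite mem_fib => /eqP uz'.
by rewrite -mulr_suml Q_intertwine uz' mulrA.
Qed.

(** The law at time t of the process started from M z. *)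
Definition mixed_kernel t z y : R := \sum_(x <- fib z) M z x * p t x y.
Definition lumped_kernel t z z' : R := \sum_(y <- fib z') mixed_kernel t z y.

Lemma mixed_kernel_ge0 t z y : 0 <= t -> 0 <= mixed_kernel t z y.
Proof. by move=> t0; apply: sumr_ge0 => x _; rewrite mulr_ge0 // (tf_ge0 tf). Qed.

Lemma lumped_kernel_ge0 t z z' : 0 <= t -> 0 <= lumped_kernel t z z'.
Proof. by move=> t0; apply: sumr_ge0 => y _; exact: mixed_kernel_ge0. Qed.

Lemma mixed_kernel_le1 t z y : 0 <= t -> mixed_kernel t z y <= 1.
Proof.
move=> t0; rewrite -(sum_M z); apply: ler_sum => x _.
by rewrite ler_piMr // tf_le1.
Qed.

Lemma mixed_kernel0 z y : mixed_kernel 0 z y = M z y.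
Proof.
rewrite /mixed_kernel; have [yz|yz] := boolP (y \in fib z).
  rewrite (bigD1_seq y) //= (tf_id tf) eqxx mulr1 big1 ?addr0 // => x xy.
  by rewrite (tf_id tf) (negbTE xy) mulr0.
rewrite mem_fib in yz; rewrite M_out // big_seq big1 // => x; rewrite mem_fib => xz.
by rewrite (tf_id tf); case: eqP => [xy|]; rewrite ?mulr0 //; rewrite -xy xz in yz.
Qed.

Lemma lumped_kernel0 z z' : lumped_kernel 0 z z' = (z == z')%:R.
Proof.
rewrite /lumped_kernel; under eq_bigr => y _ do rewrite mixed_kernel0.
have [<-|zz] := eqVneq z z'; first by rewrite sum_M.
rewrite big_seq big1 // => y; rewrite mem_fib => /eqP yz'.
by rewrite M_out // yz' eq_sym.
Qed.

(** The finite sums over fibres can be exchanged with the limit, and the intertwining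
    identifies it. *)
Lemma lumped_kernel_rates : has_rates lumped_kernel Qh.
Proof.
move=> z z'.
have E : Qh z z' = \sum_(y <- fib z') \sum_(x <- fib z) M z x * Q x y.
  rewrite -[LHS]mulr1 -(sum_M z') mulr_sumr; apply: eq_big_seq => y; rewrite mem_fib => /eqP <-.
  by rewrite Q_intertwine.
rewrite E.
have -> : (fun h => (lumped_kernel h z z' - (z == z')%:R) / h) =
   (fun h => \sum_(y <- fib z') \sum_(x <- fib z) M z x * ((p h x y - (x == y)%:R) / h)).
  apply/funext => h; rewrite -lumped_kernel0 /lumped_kernel -sumrB mulr_suml; apply: eq_bigr => y _.
  rewrite /mixed_kernel -sumrB mulr_suml; apply: eq_bigr => x _.
  by rewrite (tf_id tf) -mulrBr mulrA.
apply: cvg_big => [|y _]; first exact: add_continuous.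
apply: cvg_big => [|x _]; first exact: add_continuous.
by apply: cvgMr; exact: hr.
Qed.

(** The rates are limits of transition probabilities divided by the time. *)
Lemma Qh_offdiag z z' : z != z' -> 0 <= Qh z z'.
Proof.
move=> zz; rewrite leNgt; apply/negP => Q0.
have ep0 : 0 < - Qh z z' / 2 by rewrite divr_gt0 // oppr_gt0.
have /cvgrPdist_le/(_ _ ep0)/at_right0P[d d0 hd] := @lumped_kernel_rates z z'.
have h0 : 0 < d / 2 by rewrite divr_gt0.
have hd2 : d / 2 < d by rewrite ltr_pdivrMr // ltr_pMr // ltr1n.
have := hd _ h0 hd2; rewrite (negbTE zz) subr0 => /ler_normlP[h1 _].
have : 0 <= lumped_kernel (d / 2) z z' / (d / 2) by rewrite divr_ge0 ?lumped_kernel_ge0 // ltW.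
lra.
Qed.

Lemma targets_self z : z \in targets z.
Proof.
have [x xz] : exists x, x \in fib z.
  case E : (fib z) => [|x s]; last by exists x; rewrite mem_head.
  by have := sum_M z; rewrite E big_nil => /eqP; rewrite eq_sym oner_eq0.
by have := xz; rewrite mem_fib => /eqP <-; apply: mem_targets (F_self x).
Qed.

Lemma Qh_conservative z : \sum_(z' <- targets z) Qh z z' = 0.
Proof.
have := lump_generator z (fun=> 1).
under eq_bigr => x _ do under eq_bigr => u _ do rewrite mulr1.
under eq_bigr => x _ do rewrite Q_conservative mulr0.
rewrite big1_eq => E; rewrite [RHS]E; apply: eq_bigr => z' _.
by under eq_bigr => u _ do rewrite mulr1; rewrite sum_M mulr1.
Qed.

Lemma Qh_bounded z : \sum_(z' <- targets z) `|Qh z z'| <= 2 * c.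
Proof.
have zt := targets_self z; have ut : uniq (targets z) by exact: undup_uniq.
have := Qh_conservative z; rewrite !(bigD1_seq z zt ut) /=.
have -> : \sum_(z' <- targets z | z' != z) `|Qh z z'| = \sum_(z' <- targets z | z' != z) Qh z z'.
  by apply: eq_bigr => z' zz; rewrite ger0_norm // Qh_offdiag // eq_sym.
set W := \sum_(_ <- _ | _) _ => E.
have W0 : 0 <= W by apply: sumr_ge0 => z' zz; rewrite Qh_offdiag // eq_sym.
have Qz : Qh z z <= 0 by lra.
rewrite ler0_norm //; have := Qh_diag z; lra.
Qed.

Lemma mixed_kernel_backward y : backward_solution targets Qh (fun t z => mixed_kernel t z y).
Proof.
move=> z ep ep0.
have [d d0 hd] : exists2 d : R, 0 < d & forall x h t, x \in fib z -> 0 < h -> h < d -> 0 <= t ->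
    `|p (h + t) x y - p t x y - h * \sum_(u <- F x) Q x u * p t u y| <= ep * h.
  elim: (fib z) => [|x s [d d0 hd]]; first by exists 1.
  have [d' d'0 hd'] := backward_estimate tf hr (F_uniq x) (F_self x) (Q_conservative x) ep0.
  exists (Num.min d d'); first by rewrite lt_min d0.
  move=> x' h t; rewrite inE lt_min => /orP[/eqP ->|xs] h0 /andP[h1 h2] t0.
    exact: hd'.
  exact: hd.
exists d => // h t h0 hd' t0.
have -> : \sum_(z' <- targets z) Qh z z' * mixed_kernel t z' y =
    \sum_(x <- fib z) M z x * (\sum_(u <- F x) Q x u * p t u y).
  by rewrite lump_generator.
rewrite /mixed_kernel -sumrB mulr_sumr -sumrB.
apply: (le_trans (ler_norm_sum _ _ _)).
rewrite -[leRHS]mul1r -(sum_M z) mulr_suml big_seq [leRHS]big_seq; apply: ler_sum => x xz.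
have -> : M z x * p (h + t) x y - M z x * p t x y - h * (M z x * \sum_(u <- F x) Q x u * p t u y) =
  M z x * (p (h + t) x y - p t x y - h * (\sum_(u <- F x) Q x u * p t u y)) by ring.
by rewrite normrM ger0_norm // ler_wpM2l // hd.
Qed.

(** As functions of t and z, for y fixed, the two sides are combinations of solutions of the
    backward equation of Qh. Their difference is bounded and vanishes at time 0. *)
Theorem mixed_kernel_lumped t z y : 0 <= t ->
  mixed_kernel t z y = lumped_kernel t z (phi y) * M (phi y) y.
Proof.
pose w := phi y; pose k y' : R := (y' == y)%:R - M w y.
pose D t z := \sum_(y' <- fib w) k y' * mixed_kernel t z y'.
have DE t' z' : D t' z' = mixed_kernel t' z' y - M w y * lumped_kernel t' z' w.
  rewrite /D /lumped_kernel mulr_sumr.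
  under eq_bigr => y' _ do rewrite /k mulrBl.
  rewrite sumrB; congr (_ - _); rewrite (bigD1_seq y) ?mem_fib //= eqxx mul1r big1 ?addr0 //.
  by move=> y' /negbTE ->; rewrite mul0r.
have K1 : forall t z, 0 <= t -> `|D t z| <= \sum_(y' <- fib w) `|k y'|.
  move=> t' z' t0; apply: (le_trans (ler_norm_sum _ _ _)); apply: ler_sum => y' _.
  by rewrite normrM ler_piMr // ger0_norm ?mixed_kernel_ge0 // mixed_kernel_le1.
have D0 z' : D 0 z' = 0.
  rewrite DE mixed_kernel0 lumped_kernel0; have [->|zw] := eqVneq z' w; first by rewrite mulr1 subrr.
  by rewrite mulr0 subr0 M_out // eq_sym.
have c2 : 0 < 2 * c by rewrite mulr_gt0.
move=> t0; apply/eqP; rewrite -subr_eq0 mulrC -/w -DE; apply/eqP.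
apply: (backward_unique c2 Qh_bounded _ D0 K1) => //.
exact: (@backward_solution_sum _ _ targets Qh _ _ k (fun y' t z => mixed_kernel t z y')) (fun y' => mixed_kernel_backward y').
Qed.

(** For the Chapman-Kolmogorov equation, split the sum over intermediate states by fibres and
    use [mixed_kernel_lumped] on each of them. *)
Lemma lumped_kernel_transition : transition_function lumped_kernel.
Proof.
split.
- by move=> t z z' t0; exact: lumped_kernel_ge0.
- move=> t z t0.
  transitivity (\esum_(y in [set: S]) (mixed_kernel t z y)%:E)%E.
    rewrite (esum_fibres fib_uniq mem_fib) => [|y]; last by rewrite lee_fin mixed_kernel_ge0.
    by apply: eq_esum => z' _; rewrite sumEFin.
  transitivity (\esum_(y in [set: S]) \sum_(x <- fib z) ((M z x)%:E * (p t x y)%:E))%E.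
    by apply: eq_esum => y _; rewrite -sumEFin; apply: eq_bigr => x _; rewrite EFinM.
  rewrite esum_sum => [|y x _ _]; last first.
    by apply: mule_ge0; rewrite lee_fin ?M_ge0 // (tf_ge0 tf).
  transitivity (\sum_(x <- fib z) (M z x)%:E)%E; last by rewrite sumEFin sum_M.
  apply: eq_bigr => x _; rewrite esumZ //; last by move=> y; rewrite lee_fin (tf_ge0 tf).
  by rewrite (tf_mass1 tf) // mule1.
- exact: lumped_kernel0.
- move=> s t z z' s0 t0.
  have st0 : 0 <= s + t by rewrite addr_ge0.
  pose g u : R := \sum_(y <- fib z') p t u y.
  have g0 u : 0 <= g u by apply: sumr_ge0 => y _; rewrite (tf_ge0 tf).
  transitivity (\esum_(u in [set: S]) (mixed_kernel s z u * g u)%:E)%E.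
    rewrite /lumped_kernel -sumEFin.
    transitivity (\sum_(y <- fib z') \esum_(u in [set: S]) (mixed_kernel s z u * p t u y)%:E)%E.
      apply: eq_bigr => y _; rewrite /mixed_kernel -sumEFin.
      transitivity (\sum_(x <- fib z) \esum_(u in [set: S]) ((M z x)%:E * (p s x u * p t u y)%:E))%E.
        apply: eq_bigr => x _; rewrite EFinM (tf_chapman_kolmogorov tf) // esumZ // => u.
        by rewrite lee_fin mulr_ge0 ?(tf_ge0 tf).
      rewrite -esum_sum => [|u x _ _]; last first.
        by apply: mule_ge0; rewrite lee_fin ?M_ge0 // mulr_ge0 ?(tf_ge0 tf).
      apply: eq_esum => u _; rewrite mulr_suml -sumEFin; apply: eq_bigr => x _.
      by rewrite -EFinM mulrA.
    rewrite -esum_sum => [|u y _ _]; last by rewrite lee_fin mulr_ge0 ?mixed_kernel_ge0 ?(tf_ge0 tf).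
    by apply: eq_esum => u _; rewrite mulr_sumr sumEFin.
  rewrite (esum_fibres fib_uniq mem_fib) => [|u]; last by rewrite lee_fin mulr_ge0 ?mixed_kernel_ge0.
  apply: eq_esum => w _; rewrite sumEFin; congr (_%:E).
  rewrite {2}/lumped_kernel /mixed_kernel exchange_big /= mulr_sumr; apply: eq_big_seq => u.
  rewrite mem_fib => /eqP uw; rewrite -/(mixed_kernel s z u) mixed_kernel_lumped // uw -mulrA.
  by rewrite mulr_sumr.
Qed.

End Lumping.

(** * Discrete random variables and past sigma-algebras *)

Section SigmaAlgebras.
Context (R : realType) d (Omega : measurableType d).

(** The state space is countable. *)
Lemma discrete_preimage (S : countType) (G : set (set Omega)) (X : Omega -> S) (B : set S) :
  (forall x, <<s G>> (X @^-1` [set x])) -> <<s G>> (X @^-1` B).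
Proof.
move=> hX.
have -> : X @^-1` B = \bigcup_k
    (if @unpickle S k is Some x then if x \in B then X @^-1` [set x] else set0 else set0).
  apply/seteqP; split=> [w /= Bw|w [k _]].
    by exists (pickle (X w)) => //; rewrite pickleK; case: ifPn => //; rewrite notin_setE.
  case: unpickle => // x; case: ifPn => // xB /= ->; by rewrite inE in xB.
apply: sigma_algebra_bigcup => k; case: unpickle => [x|]; last exact: sigma_algebra0.
by case: ifP => _ //; exact: sigma_algebra0.
Qed.

Lemma past_mono (S : choiceType) (X : R -> Omega -> S) s t : s <= t ->
  past X s `<=` past X t.
Proof.
move=> st; apply: smallest_sub; first exact: smallest_sigma_algebra.
move=> A [u [x [u0 us ->]]]; apply: sub_sigma_algebra.
by exists u, x; split=> //; exact: le_trans us st.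
Qed.

Lemma past_current (S : choiceType) (X : R -> Omega -> S) t x : 0 <= t ->
  past X t (X t @^-1` [set x]).
Proof. by move=> t0; apply: sub_sigma_algebra; exists t, x. Qed.

Lemma past_lump (S : countType) (T : choiceType) (X : R -> Omega -> S) (phi : S -> T) t :
  past (fun s w => phi (X s w)) t `<=` past X t.
Proof.
apply: smallest_sub; first exact: smallest_sigma_algebra.
move=> A [s [z [s0 st ->]]].
rewrite (_ : _ @^-1` _ = X s @^-1` [set x | phi x = z]) //.
apply: (@discrete_preimage S) => x.
by apply: (past_mono st); exact: past_current.
Qed.

End SigmaAlgebras.

Section DiscreteIntegrals.
Context d (Omega : measurableType d) (R : realType) (P : probability Omega R).

Lemma integral_indicZ (A B : set Omega) (c : R) : measurable A -> measurable B -> 0 <= c ->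
  (\int[P]_(w in A) (c * \1_B w)%:E = c%:E * P (A `&` B))%E.
Proof.
move=> mA mB c0.
under eq_integral => w _ do rewrite EFinM.
rewrite ge0_integralZl_EFin //; first by rewrite integral_indic // setIC.
by apply/measurable_EFinP; exact: measurable_indic.
Qed.

Variables (S : countType) (X : Omega -> S).
Hypothesis mX : forall x, measurable (X @^-1` [set x]).

Lemma measurable_discrete (B : set S) : measurable (X @^-1` B).
Proof.
have h x : <<s d.-measurable>> (X @^-1` [set x]) by apply: sub_sigma_algebra; exact: mX.
have := discrete_preimage B h; rewrite sigma_algebra_id //.
exact: sigma_algebra_measurable.
Qed.

Lemma measurable_fun_discrete (A : set Omega) (f : S -> R) : 
  measurable_fun A (fun w => (f (X w))%:E).
Proof.
move=> mA B mB; apply: measurableI => //.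
exact: (measurable_discrete ((fun x => (f x)%:E) @^-1` B)).
Qed.

(** Equality on the countably many level sets of X is enough. *)
Lemma integral_discrete_eq (A : set Omega) (f g : Omega -> \bar R) : measurable A ->
  measurable_fun A f -> measurable_fun A g ->
  (forall w, 0 <= f w)%E -> (forall w, 0 <= g w)%E ->
  (forall x, \int[P]_(w in A `&` X @^-1` [set x]) f w =
             \int[P]_(w in A `&` X @^-1` [set x]) g w)%E ->
  (\int[P]_(w in A) f w = \int[P]_(w in A) g w)%E.
Proof.
move=> mA mf mg f0 g0 fg.
pose E k := A `&` X @^-1` [set x | pickle x = k].
have mE k : measurable (E k) by apply: measurableI => //; exact: measurable_discrete.
have tE : trivIset setT E.
  apply/trivIsetP => i j _ _ ij; rewrite -subset0 => w [[_ /= h1] [_ /= h2]].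
  by case/eqP: ij; rewrite -h1 -h2.
have AE : A = \bigcup_k E k.
  by apply/seteqP; split=> [w Aw|w [k _ []]] //; exists (pickle (X w)).
rewrite AE !ge0_integral_bigcup -?AE //.
apply: eq_eseriesr => k _.
have [[w0 [_ /= w0k]]|E0] := pselect (E k !=set0); last first.
  have -> : E k = set0 by apply/seteqP; split=> // w Ew; apply: E0; exists w.
  by rewrite !integral_set0.
have -> : E k = A `&` X @^-1` [set X w0]; last exact: fg.
rewrite /E; congr (_ `&` _); apply/seteqP; split=> w /=; last by move->.
by rewrite -w0k => /(pcan_inj pickleK).
Qed.

Lemma integral_discrete_finite (A : set Omega) (f : S -> R) (r : seq S) : measurable A ->
  uniq r -> (forall x, 0 <= f x) -> (forall w, A w -> X w \in r) ->
  (\int[P]_(w in A) (f (X w))%:E =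
   \sum_(x <- r) (f x)%:E * P (A `&` X @^-1` [set x]))%E.
Proof.
move=> mA ur f0 Ar.
transitivity (\int[P]_(w in A) \sum_(x <- r) (f x * \1_(X @^-1` [set x]) w)%:E)%E.
  apply: eq_integral => w; rewrite inE => /Ar wr.
  rewrite sumEFin (bigD1_seq (X w)) //= indicE mem_set // mulr1 big1 ?addr0 // => x xw.
  by rewrite indicE memNset ?mulr0 // => /= h; rewrite h eqxx in xw.
rewrite ge0_integral_sum //.
- by apply: eq_bigr => x _; rewrite integral_indicZ.
- move=> x; apply/measurable_EFinP; apply: measurable_funM; first exact: measurable_cst.
  apply: measurable_indic; exact: mX.
- by move=> x w _; rewrite lee_fin mulr_ge0.
Qed.

End DiscreteIntegrals.

(** * Markov functions *)

Section MarkovFunctions.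
Context d (Omega : measurableType d) (R : realType) (P : probability Omega R).
Variables (S T : countType) (phi : S -> T) (fib : T -> seq S) (M : T -> S -> R).
Hypotheses (fib_uniq : forall z, uniq (fib z)).
Hypothesis mem_fib : forall z x, (x \in fib z) = (phi x == z).
Hypotheses (M_ge0 : forall z x, 0 <= M z x) (M_out : forall z x, phi x != z -> M z x = 0).
Hypothesis sum_M : forall z, \sum_(x <- fib z) M z x = 1.
Variable p : R -> S -> S -> R.
Hypothesis tf : transition_function p.
(* The intertwining of the transition functions. *)
Hypothesis mixed_kernel_lumped : forall t z y, 0 <= t ->
  mixed_kernel fib M p t z y = lumped_kernel fib M p t z (phi y) * M (phi y) y.
Variable X : R -> Omega -> S.
Hypothesis X_markov : markov_process P X p.
Variable z0 : T.
Hypothesis X_init : forall y, P (X 0 @^-1` [set y]) = (M z0 y)%:E.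

Definition lumped_path (t : R) (w : Omega) : T := phi (X t w).
Notation Y := lumped_path.
Notation lumped := (lumped_kernel fib M p).
Notation mixed := (mixed_kernel fib M p).

Let mX t x : 0 <= t -> measurable (X t @^-1` [set x]).
Proof. by move=> t0; exact: X_markov.1. Qed.

Lemma measurable_lumped_path t z : 0 <= t -> measurable (Y t @^-1` [set z]).
Proof.
move=> t0.
exact: (measurable_discrete (fun x => mX x t0) [set x | phi x = z]).
Qed.

Lemma past_measurable (U : choiceType) (W : R -> Omega -> U) t :
  (forall s x, 0 <= s -> measurable (W s @^-1` [set x])) -> past W t `<=` measurable.
Proof.
move=> mW; apply: smallest_sub; first exact: sigma_algebra_measurable.
by move=> A [s [x [s0 _ ->]]]; exact: mW.
Qed.

Lemma prob_fibre A t z : measurable A -> 0 <= t ->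
  P (A `&` Y t @^-1` [set z]) = (\sum_(y <- fib z) P (A `&` X t @^-1` [set y]))%E.
Proof.
move=> mA t0; have mY := measurable_lumped_path z t0.
have mAY : measurable (A `&` Y t @^-1` [set z]) by exact: measurableI.
have h w : (A `&` Y t @^-1` [set z]) w -> X t w \in fib z.
  by move=> [_ /= yz]; rewrite mem_fib; apply/eqP.
have := integral_discrete_finite P (f := fun=> 1) (fun x => mX x t0) mAY (fib_uniq z)
  (fun=> ler01) h.
rewrite integral_cst // mul1e => ->; apply: eq_big_seq => y; rewrite mem_fib => /eqP yz.
rewrite mul1e; congr (P _); apply/seteqP; split=> w [].
  by move=> [Aw _].
by move=> Aw /= Xy; split=> //; split=> //=; rewrite /Y Xy.
Qed.

(** On the event A, given the value of phi at time t, the state at time t has law M. *)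
Definition M_distributed t A := forall y,
  P (A `&` X t @^-1` [set y]) = ((M (phi y) y)%:E * P (A `&` Y t @^-1` [set phi y]))%E.

(** On the part of A where the lumped process is at z at time s, the state is a mixture
    according to M z, so the transition to time t is given by the mixed kernel at z, which
    factorizes. *)
Lemma propagate s t A : 0 <= s -> s <= t -> past X s A -> M_distributed s A ->
  forall y, P (A `&` X t @^-1` [set y]) =
    ((M (phi y) y)%:E * \int[P]_(w in A) (lumped (t - s) (Y s w) (phi y))%:E)%E.
Proof.
move=> s0 st pA gA y; have [_ /(_ s t s0 st y)[_ ->]] := X_markov; last by [].
have ts0 : 0 <= t - s by rewrite subr_ge0.
have mA : measurable A by apply: past_measurable pA => s' x; exact: mX.
have mY z := measurable_lumped_path z s0.
pose c := M (phi y) y.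
have l0 z : 0 <= lumped (t - s) z (phi y) by exact: lumped_kernel_ge0.
have mXs x := mX x s0.
have mfl : measurable_fun A (fun w => (lumped (t - s) (Y s w) (phi y))%:E).
  exact: (measurable_fun_discrete mY (fun z => lumped (t - s) z (phi y))).
rewrite -ge0_integralZl_EFin //; last by move=> w _; rewrite lee_fin.
under [RHS]eq_integral => w _ do rewrite -EFinM.
apply: (integral_discrete_eq (X := Y s)) => //.
- exact: (measurable_fun_discrete mXs (fun x => p (t - s) x y)).
- exact: (measurable_fun_discrete mY (fun z => M (phi y) y * lumped (t - s) z (phi y))).
- by move=> w; rewrite lee_fin (tf_ge0 tf).
- by move=> w; rewrite lee_fin mulr_ge0.
move=> z; have mAY : measurable (A `&` Y s @^-1` [set z]) by exact: measurableI.
rewrite (integral_discrete_finite P (f := fun x => p (t - s) x y) (r := fib z) mXs) //; last 2 first.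
- by move=> x; exact: (tf_ge0 tf).
- by move=> w [_ /= yz]; rewrite mem_fib; apply/eqP.
rewrite (integral_discrete_finite P (r := [:: z])
  (f := fun z => M (phi y) y * lumped (t - s) z (phi y)) mY) //; last 2 first.
- by move=> z'; rewrite mulr_ge0.
- by move=> w [_ /= ->]; rewrite inE.
rewrite big_seq1 mulrC -mixed_kernel_lumped // /mixed_kernel -setIA setIid.
have fP : P (A `&` Y s @^-1` [set z]) \is a fin_num by exact: fin_num_measure.
rewrite -(fineK fP) -EFinM mulr_suml -sumEFin; apply: eq_big_seq => x; rewrite mem_fib => /eqP xz.
have -> : A `&` Y s @^-1` [set z] `&` X s @^-1` [set x] = A `&` X s @^-1` [set x].
  apply/seteqP; split=> w []; first by move=> [Aw _].
  by move=> Aw /= Xx; split=> //; split=> //=; rewrite /Y Xx.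
by rewrite gA xz -(fineK fP) -!EFinM; congr (_%:E); ring.
Qed.

Lemma propagate_lumped s t A : 0 <= s -> s <= t -> past X s A -> M_distributed s A ->
  forall z, P (A `&` Y t @^-1` [set z]) = (\int[P]_(w in A) (lumped (t - s) (Y s w) z)%:E)%E.
Proof.
move=> s0 st pA gA z; have mA : measurable A by apply: past_measurable pA => s' x; exact: mX.
have t0 : 0 <= t by exact: le_trans st.
rewrite prob_fibre //.
under eq_big_seq => y yz do rewrite (propagate s0 st pA gA).
transitivity (\sum_(y <- fib z) (M z y)%:E * \int[P]_(w in A) (lumped (t - s) (Y s w) z)%:E)%E.
  by apply: eq_big_seq => y; rewrite mem_fib => /eqP ->.
rewrite -ge0_sume_distrl; last by move=> y _; rewrite lee_fin.
by rewrite sumEFin sum_M mul1e.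
Qed.

Lemma M_distributed_le s t A : 0 <= s -> s <= t -> past X s A -> M_distributed s A ->
  M_distributed t A.
Proof.
by move=> s0 st pA gA y; rewrite (propagate s0 st pA gA) (propagate_lumped s0 st pA gA).
Qed.

Lemma M_distributedT : M_distributed 0 setT.
Proof.
move=> y; rewrite prob_fibre // setTI X_init.
under eq_bigr => x _ do rewrite setTI X_init.
rewrite sumEFin -EFinM; congr (_%:E).
have [->|yz] := eqVneq z0 (phi y); first by rewrite sum_M mulr1.
rewrite M_out 1?eq_sym // big_seq big1 ?mulr0 // => x; rewrite mem_fib => /eqP xy.
by rewrite M_out // xy eq_sym.
Qed.

Lemma M_distributed_current t A z : measurable A -> 0 <= t -> M_distributed t A ->
  M_distributed t (A `&` Y t @^-1` [set z]).
Proof.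
move=> mA t0 gA y; rewrite -!setIA; have [yz|yz] := eqVneq (phi y) z.
  rewrite -yz setIid -gA; congr (P (A `&` _)).
  by apply/seteqP; split=> w /= => [[]//|Xy]; split=> //; rewrite /Y Xy.
have -> : Y t @^-1` [set z] `&` X t @^-1` [set y] = set0.
  rewrite -subset0 => w [/= h1 h2]; case/eqP: yz; by rewrite -h1 /Y h2.
have -> : Y t @^-1` [set z] `&` Y t @^-1` [set phi y] = set0.
  by rewrite -subset0 => w [/= h1 h2]; case/eqP: yz; rewrite -h1 -h2.
by rewrite setI0 measure0 mule0.
Qed.

Definition cylinder (L : seq (R * T)) : set Omega :=
  [set w | all (fun e => Y e.1 w == e.2) L].

(** The times are sorted in decreasing order: condition on the latest one after having
    propagated the property from the earlier ones. *)
Lemma cylinder_sorted L t : sorted (fun e f : R * T => f.1 <= e.1) L -> 0 <= t ->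
  all (fun e => 0 <= e.1 <= t) L -> past X t (cylinder L) /\ M_distributed t (cylinder L).
Proof.
elim: L t => [|[s z] L IHL] t /= hL t0 hle.
  have -> : cylinder [::] = setT by apply/seteqP; split.
  have pT u : past X u setT by rewrite -setC0; apply: sigma_algebraC; exact: sigma_algebra0.
  split=> //; apply: (M_distributed_le (lexx 0) t0) => //; exact: M_distributedT.
move: hle => /andP[/andP[s0 st] hle].
have hs : all (fun e : R * T => 0 <= e.1 <= s) L.
  have tr : transitive (fun e f : R * T => f.1 <= e.1) by move=> a b c h1 h2; exact: le_trans h2 h1.
  have /allP h := order_path_min tr hL.
  by apply/allP => e eL; have /andP[-> _] := allP hle e eL; exact: h.
have [pL gL] := IHL s (path_sorted hL) s0 hs.
have E : cylinder ((s, z) :: L) = cylinder L `&` Y s @^-1` [set z].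
  by apply/seteqP; split=> w /=; [case/andP => /eqP h1 h2|case=> h1 h2; rewrite /cylinder /= h2 eqxx].
have mL : measurable (cylinder L) by apply: past_measurable pL => s' x; exact: mX.
have pY : past X s (Y s @^-1` [set z]).
  by apply: (@past_lump R _ _ S T X phi s); exact: past_current.
have pE : past X s (cylinder ((s, z) :: L)).
  have [_ _ _ pI] := (sigma_algebraP (U := setT) (fun _ _ => subsetT _)).1
    (smallest_sigma_algebra setT [set A | exists s' x, [/\ 0 <= s', s' <= s & A = X s' @^-1` [set x]]]).
  by rewrite E; exact: pI.
split; first exact: past_mono st _ pE.
apply: (M_distributed_le s0 st pE); rewrite E; exact: M_distributed_current.
Qed.

Lemma cylinder_distributed L t : 0 <= t -> all (fun e => 0 <= e.1 <= t) L ->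
  past X t (cylinder L) /\ M_distributed t (cylinder L).
Proof.
move=> t0 hL; pose r := (fun e f : R * T => f.1 <= e.1).
have pL : perm_eq (sort r L) L by rewrite perm_sort.
have -> : cylinder L = cylinder (sort r L).
  by apply/seteqP; split=> w; rewrite /cylinder /= (perm_all _ pL).
apply: cylinder_sorted => //; last by rewrite (perm_all _ pL).
by apply: sort_sorted => e f; exact: le_total.
Qed.

(** Cylinders generate the past and are stable under intersection, and the property is stable
    under complements and disjoint unions. *)
Theorem past_distributed t A : 0 <= t -> past Y t A -> M_distributed t A.
Proof.
move=> t0.
pose G := [set A | exists2 L, all (fun e => 0 <= e.1 <= t) L & A = cylinder L].
pose H := [set A | measurable A /\ M_distributed t A].
have GH : G `<=` H.
  move=> _ [L hL ->]; have [pL gL] := cylinder_distributed t0 hL; split=> //.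
  by apply: past_measurable pL => s' x; exact: mX.
have GI : setI_closed G.
  move=> _ _ [L hL ->] [L' hL' ->]; exists (L ++ L'); first by rewrite all_cat hL.
  by apply/seteqP; split=> w; rewrite /cylinder /= all_cat => /andP.
have [mT gT] : H setT.
  by apply: GH; exists [::] => //; apply/seteqP; split.
have mXt y := mX y t0; have mYt z := measurable_lumped_path z t0.
have lH : lambda_system setT H.
  apply/dynkin_lambda_system; split.
  - by split.
  - move=> B [mB gB]; split; first exact: measurableC.
    have compl C : measurable C -> P (~` B `&` C) = (P C - P (B `&` C))%E.
      move=> mC; rewrite setIC -setDE measureD // 1?setIC //.
      by rewrite (le_lt_trans (probability_le1 P mC)) // ltry.
    move=> y; rewrite !compl // gB; have := gT y; rewrite !setTI => ->.
    by rewrite muleBr // fin_num_adde_defr // fin_num_measure.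
  - move=> F tF hF; split; first by apply: bigcup_measurable => k _; case: (hF k).
    have PF C : measurable C -> P ((\bigcup_k F k) `&` C) = (\sum_(0 <= k <oo) P (F k `&` C))%E.
      move=> mC; have mFC k : measurable (F k `&` C) by apply: measurableI => //; case: (hF k).
      rewrite setI_bigcupl measure_semi_bigcup //; first exact: trivIset_setIr.
      by apply: bigcup_measurable => k _; exact: mFC.
    move=> y; rewrite !PF // -nneseriesZl //.
    by apply: eq_eseriesr => k _; have [_ ->] := hF k.
have sub : <<s G>> `<=` H by apply: lambda_system_subset.
move=> pA; suff : H A by case.
apply: sub; move: A pA; apply: smallest_sub; first exact: smallest_sigma_algebra.
move=> A [s [z [s0 st ->]]]; apply: sub_sigma_algebra.
exists [:: (s, z)]; first by rewrite /= s0 st.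
by apply/seteqP; split=> w; rewrite /cylinder /= andbT => /eqP.
Qed.

Theorem lumped_markov : markov_process P Y lumped.
Proof.
split=> [t z t0|s t s0 st z]; first exact: measurable_lumped_path.
split=> [B _|A pA].
  apply: (discrete_preimage ((fun z' => lumped (t - s) z' z) @^-1` B)) => z'.
  exact: past_current.
apply: propagate_lumped => //; last exact: past_distributed.
exact: (@past_lump R _ _ S T X phi s).
Qed.

Theorem lumped_cond_law t : 0 <= t -> cond_law P (past Y t) (X t) (fun w => M (Y t w)).
Proof.
move=> t0 y; split=> [B _|A pA].
  apply: (discrete_preimage ((fun z' => M z' y) @^-1` B)) => z'.
  exact: past_current.
have mA : measurable A.
  by apply: past_measurable pA => s z s0; exact: measurable_lumped_path.
rewrite (past_distributed t0 pA) -integral_indicZ //; last exact: measurable_lumped_path.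
apply: eq_integral => w _; congr (_%:E); rewrite indicE.
have [yw|yw] := eqVneq (phi y) (Y t w); first by rewrite mem_set // mulr1 yw.
rewrite (M_out yw) memNset ?mulr0 //= => h.
by rewrite h eqxx in yw.
Qed.

End MarkovFunctions.

(** * The bottom row of the dynamics *)

Theorem theorem4p3p1 (R : realType) (n : nat) (q : R) (a : 'I_n -> R)
    (d : measure_display) (Omega : measurableType d) (P : probability Omega R)
    (Z : R -> Omega -> pattern n) (z : chamber n) :
  (1 <= n)%N -> 0 < q -> q < 1 -> (forall i, 0 < a i) ->
  markov_with_rates P Z (berele_rate q a) ->
  (forall y, P (Z 0 @^-1` [set y]) = (Mlaw q a z y)%:E) ->
  [/\ markov_with_rates P (fun t w => bottom_row (Z t w)) (Qrate q a),
      P ((fun w => bottom_row (Z 0 w)) @^-1` [set z]) = 1%E &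
      forall t, 0 < t ->
        cond_law P (past (fun s w => bottom_row (Z s w)) t) (Z t)
          (fun w => Mlaw q a (bottom_row (Z t w)))].
Proof.
move=> n_gt0 q_gt0 q_lt1 a_gt0 [p [tf hr Z_markov]] Z_init.
have /choice[F hF] := berele_row a n_gt0 q_gt0 q_lt1.
have F_uniq v : uniq (F v) by have [] := hF v.
have F_self v : v \in F v by have [] := hF v.
have F_out v u : u \notin F v -> berele_rate q a v u = 0 by have [_ _ + _] := hF v; apply.
have F_cons v : \sum_(u <- F v) berele_rate q a v u = 0 by have [] := hF v.
have M_ge0 := Mlaw_ge0 n_gt0 q_gt0 q_lt1 a_gt0.
have M_out (w : chamber n) (v : pattern n) : bottom_row v != w -> Mlaw q a w v = 0.
  exact: Mlaw_out.
have sum_M := sum_Mlaw n_gt0 q_gt0 q_lt1 a_gt0.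
have inter := generator_intertwining n_gt0 q_gt0 q_lt1 a_gt0.
have c_gt0 : 0 < clock_rate a.
  rewrite /clock_rate (bigD1 (Ordinal n_gt0)) //= ltr_pwDl //.
    by rewrite addr_gt0 ?invr_gt0.
  by apply: sumr_ge0 => i _; rewrite addr_ge0 ?invr_ge0 // ltW.
have diag (w : chamber n) : - clock_rate a <= Qrate q a w w by rewrite /Qrate eqxx.
have fu := @fibre_uniq n.
have mf := @mem_fibre n.
have ml := mixed_kernel_lumped fu mf M_ge0 M_out sum_M F_uniq F_self F_out F_cons inter c_gt0 diag tf hr.
have lt := lumped_kernel_transition fu mf M_ge0 M_out sum_M F_uniq F_self F_out F_cons inter c_gt0 diag tf hr.
have lr := lumped_kernel_rates fu mf M_out sum_M inter tf hr.
split.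
- exists (lumped_kernel (@fibre n) (Mlaw q a) p); split=> //.
  exact: (lumped_markov fu mf M_ge0 M_out sum_M tf ml Z_markov Z_init).
- have := prob_fibre fu mf Z_markov z measurableT (lexx 0).
  rewrite setTI => ->; rewrite -(sum_M z) -sumEFin; apply: eq_bigr => v _.
  by rewrite setTI Z_init.
- move=> t t0; exact: (lumped_cond_law fu mf M_ge0 M_out sum_M tf ml Z_markov Z_init (ltW t0)).
Qed.
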